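(* Let $G$ be an abelian group with bounded $p$-torsion. Then the following are equivalent: (a) $G$ is simply presented; (b) $G$ is the direct sum of a set of groups of torsion-free rank at most $1$; (c) $G$ is a Warfield group.
   Context: All groups are abelian. A group $G$ has bounded $p$-torsion if, for every prime $p$, the $p$-primary component $T_p$ of its torsion subgroup $T$ is bounded (i.e., $p^nT_p=0$ for some $n$ depending on $p$). The torsion-free rank of a group $A$ is $r_0(A)=\dim_{\mathbb Q}(A\otimes\mathbb Q)$. A group is simply presented if it can be defined by generators and relations in which every relation has the form $px=y$ or $px=0$, where $p$ is a prime and $x,y$ are generators. A Warfield group is a group isomorphic to a direct summand of a simply presented group. *)

(* Defs.v *)
From HB Require Import structures.
From mathcomp Require Import all_boot all_order all_algebra.
From mathcomp Require Import all_classical.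
From mathcomp Require Export freeg.

Set Implicit Arguments.
Unset Strict Implicit.
Unset Printing Implicit Defensive.

Import GRing.Theory.
Local Open Scope ring_scope.
Local Open Scope quotient_scope.
Local Open Scope classical_set_scope.

Definition zmod_iso (G H : zmodType) : Prop :=
  exists f : {additive G -> H}, bijective f.

Definition p_primary (G : zmodType) (p : nat) : set G :=
  [set x | exists k : nat, x *+ (p ^ k)%N = 0].

Definition bounded_p_torsion (G : zmodType) : Prop :=
  forall p : nat, prime p ->
    exists n : nat, forall x : G, p_primary p x -> x *+ (p ^ n)%N = 0.

Section Gen.
Variables (V : zmodType) (R : set V).

(* The subgroup generated by R, as the intersection of all subgroups
   containing R. *)
Definition gen : {pred V} := fun v =>
  `[< forall S : {pred V}, zmod_closed S ->
        (forall r, R r -> r \in S) -> v \in S >].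

Lemma genP v : reflect (forall S : {pred V}, zmod_closed S ->
  (forall r, R r -> r \in S) -> v \in S) (v \in gen).
Proof. exact: asboolP. Qed.

Fact gen_zmod_closed : zmod_closed gen.
Proof.
split=> [|u v /genP Su /genP Sv]; apply/genP => S [S0 SB] RS //.
exact: SB (Su S (conj S0 SB) RS) (Sv S (conj S0 SB) RS).
Qed.

HB.instance Definition _ := GRing.isZmodClosed.Build V gen gen_zmod_closed.

Lemma mem_gen r : R r -> r \in gen.
Proof. by move=> Rr; apply/genP => S _; apply. Qed.

End Gen.

Definition free_gen (X : choiceType) (x : X) : {freeg X} := << x >>.

Definition presented (X : choiceType) (R : set {freeg X}) : Type :=
  Quotient.quot (gen R).

HB.instance Definition _ (X : choiceType) (R : set {freeg X}) :=
  GRing.Zmodule.on (presented R).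

Section Presented.
Variables (X : choiceType) (R : set {freeg X}).

Definition pres (u : {freeg X}) : presented R := \pi_(Quotient.quot (gen R)) u.

Fact pres_is_additive : zmod_morphism pres.
Proof. by move=> u v; rewrite /pres raddfB. Qed.

HB.instance Definition _ :=
  GRing.isZmodMorphism.Build {freeg X} (presented R) pres pres_is_additive.

Lemma pres_surj (t : presented R) : exists u, t = pres u.
Proof. by exists (repr (t : Quotient.quot (gen R))); rewrite /pres reprK. Qed.

Lemma pres_eq0 u : (pres u == 0) = (u \in gen R).
Proof.
have -> : 0 = pres 0 by rewrite raddf0.
by rewrite /pres -Quotient.idealrBE subr0.
Qed.

Lemma freeg_ext (V : zmodType) (f g : {additive {freeg X} -> V}) :
  (forall x, f (free_gen x) = g (free_gen x)) -> f =1 g.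
Proof.
move=> fg u; rewrite -(freeg_sumE u) !raddf_sum; apply: eq_bigr => x _.
have -> : << coeff x u *g x >> = free_gen x *~ coeff x u.
  by rewrite /free_gen freegU_mulz intz.
by rewrite !raddfMz fg.
Qed.

Lemma presented_ext (V : zmodType) (f g : {additive presented R -> V}) :
  (forall x, f (pres (free_gen x)) = g (pres (free_gen x))) -> f =1 g.
Proof.
move=> fg t; have [u ->] := pres_surj t.
exact: (@freeg_ext _ (f \o pres) (g \o pres)).
Qed.

Section Lift.
Variables (V : zmodType) (h : {additive {freeg X} -> V}).
Hypothesis hR : forall r, R r -> h r = 0.

Definition pres_lift (_ : forall r, R r -> h r = 0) (t : presented R) : V :=
  h (repr (t : Quotient.quot (gen R))).

Lemma gen_lift0 u : u \in gen R -> h u = 0.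
Proof.
move=> /genP/(_ [pred v | h v == 0]) h0; apply/eqP; apply: h0.
  split=> [|v w]; rewrite !inE ?raddf0 // => /eqP hv /eqP hw.
  by rewrite raddfB hv hw subr0.
by move=> r /hR; rewrite inE => ->.
Qed.

Lemma pres_liftE u : pres_lift hR (pres u) = h u.
Proof.
apply/eqP; rewrite -subr_eq0 -raddfB; apply/eqP/gen_lift0.
by rewrite Quotient.idealrBE reprK.
Qed.

Fact pres_lift_is_additive : zmod_morphism (pres_lift hR).
Proof.
move=> s t; have [u ->] := pres_surj s; have [v ->] := pres_surj t.
by rewrite -raddfB !pres_liftE raddfB.
Qed.

HB.instance Definition _ := GRing.isZmodMorphism.Build (presented R) V
  (pres_lift hR) pres_lift_is_additive.

End Lift.
End Presented.

Definition simple_relation (X : choiceType) (r : {freeg X}) : Prop :=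
  exists2 p : nat, prime p &
    (exists x y : X, r = free_gen x *+ p - free_gen y) \/
    (exists x : X, r = free_gen x *+ p).

Definition simply_presented (G : zmodType) : Prop :=
  exists (X : choiceType) (R : set {freeg X}),
    (forall r, R r -> simple_relation r) /\ zmod_iso G (presented R).

(* G is isomorphic to a direct summand of H exactly when G + K is isomorphic
   to H for some complement K. *)
Definition warfield (G : zmodType) : Prop :=
  exists H K : zmodType, simply_presented H /\ zmod_iso (G * K)%type H.

Definition dprod (I : Type) (A : I -> zmodType) : Type := forall i, A i.

Section DProd.
Variables (I : Type) (A : I -> zmodType).
Implicit Types f g h : dprod A.

HB.instance Definition _ := gen_eqMixin (dprod A).
HB.instance Definition _ := gen_choiceMixin (dprod A).

Definition dprod_zero : dprod A := fun=> 0.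
Definition dprod_opp f : dprod A := fun i => - f i.
Definition dprod_add f g : dprod A := fun i => f i + g i.

Fact dprod_addA : associative dprod_add.
Proof. by move=> f g h; apply: functional_extensionality_dep => i; exact: addrA. Qed.
Fact dprod_addC : commutative dprod_add.
Proof. by move=> f g; apply: functional_extensionality_dep => i; exact: addrC. Qed.
Fact dprod_add0 : left_id dprod_zero dprod_add.
Proof. by move=> f; apply: functional_extensionality_dep => i; exact: add0r. Qed.
Fact dprod_addN : left_inverse dprod_zero dprod_opp dprod_add.
Proof. by move=> f; apply: functional_extensionality_dep => i; exact: addNr. Qed.

HB.instance Definition _ := GRing.isZmodule.Build (dprod A)
  dprod_addA dprod_addC dprod_add0 dprod_addN.

Definition finite_support : {pred dprod A} := fun f =>
  `[< finite_set [set i | f i <> 0] >].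

Fact finite_support_zmod_closed : zmod_closed finite_support.
Proof.
split=> [|f g /asboolP fin_f /asboolP fin_g]; apply/asboolP.
  by apply: (sub_finite_set _ (finite_set0 I)) => i /=.
have fin_fg : finite_set ([set i | f i <> 0] `|` [set i | g i <> 0]).
  by rewrite finite_setU.
apply: sub_finite_set fin_fg => i /= fg_i.
have [f0|] := eqVneq (f i) 0; last by move/eqP; left.
right=> g0; apply: fg_i; rewrite -[LHS]/(f i - g i).
by rewrite f0 g0 subr0.
Qed.

HB.instance Definition _ :=
  GRing.isZmodClosed.Build (dprod A) finite_support finite_support_zmod_closed.

Record dsum : Type :=
  DSum { dsum_val :> dprod A; dsum_valP : dsum_val \in finite_support }.

HB.instance Definition _ := [isSub for dsum_val].
HB.instance Definition _ := [Choice of dsum by <:].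
HB.instance Definition _ := [SubChoice_isSubZmodule of dsum by <:].

End DProd.

Section TensorQ.
Variable A : zmodType.

(* The alias forces a single choiceType instance on the generators. *)
Local Notation X := ((A * rat)%type : choiceType).

Definition pure_gen (a : A) (q : rat) : {freeg X} := @free_gen X (a, q).

(* The tensor product is over Z, so biadditivity already implies the balancing
   relation (a *~ m) (x) q = a (x) (m%:~R * q). *)
Inductive biadditive_relator : {freeg X} -> Prop :=
| BiaddL (a b : A) (q : rat) :
    biadditive_relator (pure_gen (a + b) q - pure_gen a q - pure_gen b q)
| BiaddR (a : A) (q r : rat) :
    biadditive_relator (pure_gen a (q + r) - pure_gen a q - pure_gen a r).

Definition tensorQ : Type := presented biadditive_relator.

HB.instance Definition _ := GRing.Zmodule.on tensorQ.

Definition pure (a : A) (q : rat) : tensorQ :=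
  pres biadditive_relator (pure_gen a q).

Lemma pureDl a b q : pure (a + b) q = pure a q + pure b q.
Proof.
apply/eqP; rewrite -subr_eq0 opprD addrA -!raddfB pres_eq0.
by apply: mem_gen; exact: BiaddL.
Qed.

Lemma pureDr a q r : pure a (q + r) = pure a q + pure a r.
Proof.
apply/eqP; rewrite -subr_eq0 opprD addrA -!raddfB pres_eq0.
by apply: mem_gen; exact: BiaddR.
Qed.

Lemma tensorQ_ext (V : zmodType) (f g : {additive tensorQ -> V}) :
  (forall a q, f (pure a q) = g (pure a q)) -> f =1 g.
Proof. by move=> fg; apply: presented_ext => -[a q]; exact: fg. Qed.

Definition scale_free (c : rat) : {freeg X} -> {freeg X} :=
  fglift (fun x : X => pure_gen x.1 (c * x.2)).

HB.instance Definition _ c := GRing.isAdditive.Build {freeg X} {freeg X} (scale_free c)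
  (lift_is_additive _).

Lemma scale_freeU c a q : scale_free c (pure_gen a q) = pure_gen a (c * q).
Proof. by rewrite /scale_free liftU scale1r. Qed.

Fact scale_free_relator c r : biadditive_relator r ->
  (pres biadditive_relator \o scale_free c) r = 0.
Proof.
case=> [a b q|a q q'] /=; rewrite !raddfB /= !scale_freeU;
  apply/eqP; rewrite -addrA -opprD subr_eq0; apply/eqP.
  exact: pureDl.
by rewrite mulrDr; exact: pureDr.
Qed.

Definition scaleQ (c : rat) : tensorQ -> tensorQ :=
  pres_lift (@scale_free_relator c).

HB.instance Definition _ c := GRing.Additive.on (scaleQ c).

Lemma scaleQ_pure c a q : scaleQ c (pure a q) = pure a (c * q).
Proof. by rewrite /scaleQ pres_liftE /= scale_freeU. Qed.

Fact scaleQA c d t : scaleQ c (scaleQ d t) = scaleQ (c * d) t.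
Proof.
apply: (@tensorQ_ext _ (scaleQ c \o scaleQ d) (scaleQ (c * d))) => a q /=.
by rewrite !scaleQ_pure mulrA.
Qed.

Fact scale1Q : left_id 1 scaleQ.
Proof.
by apply: (@tensorQ_ext _ (scaleQ 1) idfun) => a q /=; rewrite scaleQ_pure mul1r.
Qed.

Fact scaleQDr : right_distributive scaleQ +%R.
Proof. by move=> c s t; rewrite raddfD. Qed.

Fact scaleQDl t : {morph scaleQ^~ t : c d / c + d}.
Proof.
move=> c d.
apply: (@tensorQ_ext _ (scaleQ (c + d)) (scaleQ c \+ scaleQ d)) => a q /=.
by rewrite !scaleQ_pure mulrDl pureDr.
Qed.

HB.instance Definition _ := GRing.Zmodule_isLmodule.Build rat tensorQ
  scaleQA scale1Q scaleQDr scaleQDl.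

End TensorQ.

Definition is_basis (F : fieldType) (V : lmodType F) (n : nat) (b : 'I_n -> V) : Prop :=
  forall v : V, exists! c : {ffun 'I_n -> F}, v = \sum_(i < n) c i *: b i.

Definition has_dim (F : fieldType) (V : lmodType F) (n : nat) : Prop :=
  exists b : 'I_n -> V, is_basis b.

Definition torsion_free_rank (A : zmodType) (n : nat) : Prop :=
  has_dim (tensorQ A) n.

Definition dsum_of_rank_le1 (G : zmodType) : Prop :=
  exists (I : choiceType) (A : I -> zmodType),
    (forall i, exists2 n : nat, (n <= 1)%N & torsion_free_rank (A i) n) /\
    zmod_iso G (dsum A).

(* Main.v *)
Require Import Defs.
From HB Require Import structures.
From mathcomp Require Import all_boot all_order all_algebra.
From mathcomp Require Import all_classical.
From mathcomp Require Import zify ring.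

Set Implicit Arguments.
Unset Strict Implicit.
Unset Printing Implicit Defensive.

Import Order.TTheory GRing.Theory Num.Theory.
Local Open Scope ring_scope.
Local Open Scope classical_set_scope.

(** The generators of a simple presentation fall into commensurability classes
    that no relation links, and the generators of one class are rational
    multiples of each other up to torsion.  The presentation therefore splits as
    a direct sum of groups of torsion-free rank at most one
    ([simply_presented_dsum]).  A simply presented group is trivially a direct
    summand of itself.  What remains is that a group [G] with bounded
    [p]-torsion that is a retract of a direct sum [H] of groups of rank at most
    one is simply presented; this covers both missing implications, and the
    torsion of [H] may be unbounded.

    The intermediate notion is a decomposition basis: an independent family
    with torsion quotient such that, for each prime [p], the [p]-height of a
    combination is the minimum of the [p]-heights of its terms.

    A group with bounded [p]-torsion and a decomposition basis is simply
    presented ([decomposition_basis_simply_presented]).  Modulo the span of the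
    basis the group is the direct sum of its primary parts, so one prime can be
    treated at a time.  Far up in the height filtration there is no
    [p]-torsion left, and the hull of the span is a direct sum of rank one
    groups, generated by the [p]-power roots of multiples of basis elements.
    Going down one height at a time, the elements of height [al] are generated,
    modulo those of height [al + 1] and the span, by elements whose
    [p]-multiple is zero, a generator already chosen, or a multiple of a single
    basis element; a maximal independent set of these is added.  Boundedness
    makes this descent finite.  Every element then has a unique expansion with
    digits below [p], and the rules for carrying are the simple relations.

    A retract [G] of [H] inherits a decomposition basis
    ([retract_decomposition_basis]).  Elements [x j] of infinite order in the
    rank one summands of [H] form a decomposition basis of [H].  Tensoring with
    the rationals, [H] becomes a rational vector space with basis [x], but the
    heights are remembered by declaring a rational [c] to be a morphism from
    the line of [x k] to the line of [x i] when multiplication by [c] does not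
    lower heights, after a common multiple has been taken.  Since torsion is
    bounded (modulo a subgroup that [G] does not see), lines with nonzero
    morphisms both ways are isomorphic ([hom_rep_iso]).  In this category of
    lines, the projector onto [G] splits off a direct sum of lines
    ([projector_frame]), which is the analogue of the theorem of Baer, Kulikov
    and Kaplansky on summands of completely decomposable groups.  Following
    them, a given vector is put into a summand that is a finite sum of lines
    ([finite_summand]): an admissible map is triangular for the order of the
    isomorphism classes of lines, so the classes in the support of the vector
    can be treated one after the other, and in one class the problem is the
    Bezout identity.  Iteration gives the countable case, and Zorn's lemma the
    general one, because each basis vector lies in a stable subspace spanned by
    countably many of them.  Finally a suitable multiple of the basis obtained
    has exactly the right heights in [G]. *)

(** * Rational vector spaces with a distinguished basis *)

Section RationalFreeg.
Variable I : choiceType.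
Local Notation V := {freeg I / rat}.

Lemma rat_scaleE (a b : rat) : a *: (b : rat^o) = a * b.
Proof. by []. Qed.

Lemma freeg_coeff_ext (u v : V) : (forall i, coeff i u = coeff i v) -> u = v.
Proof. by move=> uv; apply/eqP/freeg_eqP. Qed.

Lemma freegU_scale (c : rat) (i : I) : << c *g i >> = c *: (<< i >> : V).
Proof. by apply: freeg_coeff_ext => k; rewrite coeffZ !coeffU mul1r. Qed.

Lemma freeg_expand (v : V) : v = \sum_(i <- dom v) coeff i v *: << i >>.
Proof.
by rewrite -{1}(freeg_sumE v); apply: eq_bigr => i _; rewrite freegU_scale.
Qed.

Fact coeff_is_scalar i : linear (coeff i : V -> rat^o).
Proof. by move=> a u v; rewrite coeffD coeffZ. Qed.
Definition coef (i : I) : V -> rat^o := coeff i.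
HB.instance Definition _ i :=
  GRing.isLinear.Build rat V rat^o *:%R (coef i) (coeff_is_scalar i).

Fact fglift_is_linear (W : lmodType rat) (f : I -> W) :
  linear (fglift f : V -> W).
Proof.
have addf : {morph (fglift f : V -> W) : u v / u + v}.
  move=> u v; have fN w : fglift f (- w : V) = - fglift f w.
    rewrite -[X in fglift f X]sub0r (lift_is_additive f).
    have -> : fglift f (0 : V) = 0.
      by rewrite -(subrr (0 : V)) (lift_is_additive f) subrr.
    by rewrite sub0r.
  by rewrite -{1}[v]opprK (lift_is_additive f) fN opprK.
have f0 : fglift f (0 : V) = 0.
  by rewrite -(subrr (0 : V)) (lift_is_additive f) subrr.
have fsum (r : seq I) (F : I -> V) :
    fglift f (\sum_(i <- r) F i) = \sum_(i <- r) fglift f (F i).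
  by elim: r => [|i r IH]; rewrite ?big_nil // !big_cons addf IH.
move=> a u v; rewrite addf; congr (_ + _).
rewrite [u in LHS]freeg_expand scaler_sumr fsum -[u in RHS]freeg_sumE fsum.
rewrite scaler_sumr; apply: eq_bigr => i _.
by rewrite liftU !scalerA -freegU_scale liftU.
Qed.

Lemma linear_package (W : lmodType rat) (f : V -> W) : linear f ->
  exists g : {linear V -> W}, forall v, g v = f v.
Proof.
by move=> lf; exists (HB.pack_for {linear V -> W} f (GRing.isLinear.Build rat V W *:%R f lf)).
Qed.

Definition linext (W : lmodType rat) (f : I -> W) : V -> W := fglift f.
HB.instance Definition _ (W : lmodType rat) (f : I -> W) :=
  GRing.isLinear.Build rat V W *:%R (linext f) (fglift_is_linear f).

Lemma linextU (W : lmodType rat) (f : I -> W) i : linext f << i >> = f i.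
Proof. by rewrite /linext liftU scale1r. Qed.

Definition restr (J : set I) : V -> V :=
  linext (fun i => if `[< J i >] then << i >> else 0).
HB.instance Definition _ J := GRing.Linear.on (restr J).

Lemma linear_expand (W : lmodType rat) (f : {linear V -> W}) v :
  f v = \sum_(i <- dom v) coeff i v *: f << i >>.
Proof.
by rewrite {1}[v]freeg_expand raddf_sum; apply: eq_bigr => i _; rewrite /= linearZ.
Qed.

Lemma linextE (W : lmodType rat) (f : I -> W) v :
  linext f v = \sum_(i <- dom v) coeff i v *: f i.
Proof.
by rewrite (linear_expand (linext f)); apply: eq_bigr => i _; rewrite /= linextU.
Qed.

Lemma coeff_linear (f : {linear V -> V}) i v :
  coeff i (f v) = \sum_(j <- dom v) coeff j v * coeff i (f << j >>).
Proof.
rewrite linear_expand raddf_sum; apply: eq_bigr => j _.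
by rewrite /= coeffZ.
Qed.

Lemma coeff_restr J i v :
  coeff i (restr J v) = if `[< J i >] then coeff i v else 0.
Proof.
rewrite (coeff_linear (restr J)) [in RHS](freeg_expand v) raddf_sum /=.
have E j : coeff i (restr J (<< j >> : V)) =
    if `[< J i >] then coeff i (<< j >> : V) else 0.
  rewrite /restr linextU coeffU mul1r; have [<-|ji] := eqVneq j i.
    by case: ifP; rewrite ?coeffU ?mul1r ?eqxx ?coeff0.
  case: ifP => _; last by rewrite coeff0; case: ifP.
  by rewrite coeffU mul1r (negbTE ji); case: ifP.
case: ifP E => _ E; last first.
  by rewrite big1 // => j _; rewrite E mulr0.
by apply: eq_bigr => j _; rewrite E coeffZ.
Qed.

End RationalFreeg.

(** * Idempotents between lines: the homogeneous case *)

Lemma rat_pair_gcd (a b : rat) : exists (h : rat) (m n p q : int),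
  [/\ a = m%:~R * h, b = n%:~R * h & h = p%:~R * a + q%:~R * b].
Proof.
pose d := denq a * denq b; pose x := numq a * denq b; pose y := numq b * denq a.
have d0 : d%:~R != 0 :> rat by rewrite intr_eq0 mulf_neq0 ?denq_neq0.
have ax : a = x%:~R / d%:~R.
  rewrite -{1}(divq_num_den a) /x /d !intrM -mulf_div divff ?mulr1 //.
  by rewrite intr_eq0 denq_neq0.
have by_ : b = y%:~R / d%:~R.
  rewrite -{1}(divq_num_den b) /y /d !intrM [(denq a)%:~R * (denq b)%:~R]mulrC -mulf_div.
  by rewrite divff ?mulr1 // intr_eq0 denq_neq0.
have [p [q pq]] := Bezoutz x y.
have /dvdzP[m xm] := dvdz_gcdl x y; have /dvdzP[n yn] := dvdz_gcdr x y.
exists ((gcdz x y)%:~R / d%:~R), m, n, p, q; split.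
- by rewrite mulrA -intrM -xm.
- by rewrite mulrA -intrM -yn.
- by rewrite ax by_ !mulrA -mulrDl -!intrM -intrD pq.
Qed.

(** Over a common denominator, finitely many rationals have a greatest common
    divisor: it is what a vector has to be divided by to become the generator of
    a line. *)
Lemma rat_seq_gcd (T : eqType) (s : seq T) (r : T -> rat) : uniq s ->
  exists (g : rat) (n m : T -> int),
    (forall i, i \in s -> r i = (n i)%:~R * g) /\
    g = \sum_(i <- s) (m i)%:~R * r i.
Proof.
elim: s => [|t s IH] /=; first by exists 0, (fun=> 0), (fun=> 0); rewrite big_nil.
move=> /andP[ts /IH[g [n [m [rn gm]]]]].
have [h [a [b [p [q [ga rb hpq]]]]]] := rat_pair_gcd g (r t).
exists h, (fun i => if i == t then b else n i * a).
exists (fun i => if i == t then q else p * m i); split.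
  move=> i; rewrite in_cons; have [->//|_ /= /rn ->] := eqVneq i t.
  by rewrite ga intrM mulrA.
rewrite big_cons eqxx hpq addrC; congr (_ + _); rewrite gm mulr_sumr.
apply: eq_big_seq => i i_s.
have /negbTE-> : i != t by apply: contraNneq ts => <-.
by rewrite intrM mulrA.
Qed.

(** A skeleton of a category whose objects are lines: [A i j] is the group of
    rationals [c] for which multiplication by [c] is a morphism from the line
    [i] to the line [j].  The field [line_iso] is the one that bounded torsion
    provides; it makes the existence of nonzero morphisms a preorder whose
    classes are isomorphism classes. *)
Record line_category (I : Type) (A : I -> I -> rat -> Prop) : Prop := {
  line_zero : forall i j, A i j 0;
  line_sub : forall i j c d, A i j c -> A i j d -> A i j (c - d);
  line_id : forall i, A i i 1;
  line_comp : forall i j k c d, A i j c -> A j k d -> A i k (c * d);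
  line_iso : forall i j c d, c != 0 -> d != 0 -> A i j c -> A j i d ->
    exists2 u, u != 0 & A i j u /\ A j i u^-1
}.

Section Lines.
Variables (I : choiceType) (A : I -> I -> rat -> Prop).
Hypothesis catA : line_category A.
Local Notation V := {freeg I / rat}.

Lemma line_opp i j c : A i j c -> A i j (- c).
Proof. by rewrite -sub0r; apply: line_sub => //; apply: line_zero. Qed.

Lemma line_add i j c d : A i j c -> A i j d -> A i j (c + d).
Proof. by move=> Ac /line_opp Ad; rewrite -[d]opprK; apply: line_sub. Qed.

Lemma line_sum (T : Type) (s : seq T) (P : pred T) F i j :
  (forall x, P x -> A i j (F x)) -> A i j (\sum_(x <- s | P x) F x).
Proof.
move=> AF; elim: s => [|x s IH]; rewrite ?big_nil ?big_cons.
  exact: line_zero.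
by case: ifP => // /AF Ax; apply: line_add.
Qed.

Lemma line_sum_seq (T : eqType) (s : seq T) F i j :
  (forall x, x \in s -> A i j (F x)) -> A i j (\sum_(x <- s) F x).
Proof. by move=> AF; rewrite big_seq; apply: line_sum. Qed.

Lemma line_int i (n : int) : A i i n%:~R.
Proof.
have An (m : nat) : A i i m%:R.
  elim: m => [|m IH]; first exact: line_zero.
  by rewrite -addn1 natrD; apply: line_add => //; apply: line_id.
by case: n => n; rewrite ?NegzE ?mulrNz; [|apply: line_opp]; apply: An.
Qed.

(** A morphism from the line [k] to the direct sum of all the lines, given by the
    image [v] of the generator. *)
Definition mor (k : I) (v : V) : Prop := forall i, A k i (coeff i v).

Definition admissible (f : V -> V) : Prop := forall k v, mor k v -> mor k (f v).

Definition admissible_to (t : I) (f : V -> rat) : Prop :=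
  forall k v, mor k v -> A k t (f v).

Lemma mor0 k : mor k 0.
Proof. by move=> i; rewrite coeff0; apply: line_zero. Qed.

Lemma morD k u v : mor k u -> mor k v -> mor k (u + v).
Proof. by move=> mu mv i; rewrite coeffD; apply: line_add. Qed.

Lemma morB k u v : mor k u -> mor k v -> mor k (u - v).
Proof. by move=> mu mv i; rewrite coeffB; apply: line_sub. Qed.

Lemma morZ k l c v : A k l c -> mor l v -> mor k (c *: v).
Proof. by move=> Ac mv i; rewrite coeffZ; apply: line_comp Ac (mv i). Qed.

Lemma mor_sum (T : eqType) (s : seq T) F k :
  (forall x, x \in s -> mor k (F x)) -> mor k (\sum_(x <- s) F x).
Proof.
by move=> mF i; rewrite raddf_sum; apply: line_sum_seq => x /mF/(_ i).
Qed.

Lemma morU k : mor k << k >>.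
Proof.
move=> i; rewrite coeffU mul1r; have [->|_] := eqVneq.
  exact: line_id.
exact: line_zero.
Qed.

Lemma mor_restr J k v : mor k v -> mor k (restr J v).
Proof.
by move=> mv i; rewrite coeff_restr; case: ifP => // _; apply: line_zero.
Qed.

Definition line_le (i j : I) : Prop := exists2 c, c != 0 & A i j c.
Definition line_sim (i j : I) : Prop := line_le i j /\ line_le j i.

Lemma line_le_refl i : line_le i i.
Proof. by exists 1 => //; apply: line_id. Qed.

Lemma line_le_trans i j k : line_le i j -> line_le j k -> line_le i k.
Proof.
move=> [c c0 Ac] [d d0 Ad]; exists (c * d); first by rewrite mulf_neq0.
exact: line_comp Ac Ad.
Qed.

Lemma line_sim_refl i : line_sim i i.
Proof. by split; apply: line_le_refl. Qed.

Lemma line_sim_sym i j : line_sim i j -> line_sim j i.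
Proof. by case. Qed.

Lemma line_sim_trans i j k : line_sim i j -> line_sim j k -> line_sim i k.
Proof.
move=> [ij ji] [jk kj].
by split; [apply: line_le_trans ij jk|apply: line_le_trans kj ji].
Qed.

Definition cls (t : I) : set I := [set i | line_sim i t].

(** In coordinates adapted to a line [t], a vector supported on lines
    isomorphic to [t] has rational coordinates that generate a cyclic group;
    dividing by its generator makes the Bezout relation a retraction onto a
    copy of [t]. *)
Lemma homogeneous_line t (z : V) : z != 0 ->
  (forall i, coeff i z != 0 -> line_sim i t) ->
  exists (y : V) (phi : {linear V -> rat^o}) (g : rat),
    [/\ mor t y, admissible_to t phi, phi y = 1, z = g *: y &
        forall u, (forall i, line_sim i t -> coeff i u = 0) -> phi u = 0].
Proof.
move=> z0 supz.
have /choice[a aP] i : exists a, line_sim i t ->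
    [/\ a != 0, A t i a & A i t a^-1].
  have [[[c c0 Ac] [d d0 Ad]]|nit] := pselect (line_sim i t); last by exists 0.
  by have [a a0 [Aa Aa']] := line_iso catA d0 c0 Ad Ac; exists a.
have simz i : i \in dom z -> line_sim i t by rewrite mem_dom => /supz.
have [g [n [m [rn gm]]]] :=
  rat_seq_gcd (fun i => coeff i z / a i) (uniq_dom z).
have zE i : i \in dom z -> coeff i z = g * ((n i)%:~R * a i).
  move=> iz; have [ai0 _ _] := aP i (simz i iz).
  by rewrite -[LHS](divfK ai0) rn // mulrAC mulrC.
have g0 : g != 0.
  apply: contra_neq z0 => g0; rewrite (freeg_expand z) big_seq big1 // => i iz.
  by rewrite zE // g0 mul0r scale0r.
pose phi := linext (W := rat^o)
  (fun i : I => if i \in dom z then (m i)%:~R / a i else 0 : rat^o).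
exists (g^-1 *: z), phi, g; split.
- move=> i; rewrite coeffZ; have [iz|/coeff_outdom->] := boolP (i \in dom z).
    rewrite zE // mulKf //; have [_ Aa _] := aP i (simz i iz).
    by apply: line_comp Aa => //; apply: line_int.
  by rewrite mulr0; apply: line_zero.
- move=> k v mv; rewrite [X in A k t X]linextE; apply: line_sum_seq => i _.
  apply: line_comp (mv i) _ => //.
  case: ifP => [iz|_]; last exact: line_zero.
  have [_ _ Aa] := aP i (simz i iz); rewrite mulrC.
  by apply: line_comp Aa _ => //; apply: line_int.
- have gE : phi z = g.
    by rewrite [LHS]linextE [RHS]gm; apply: eq_big_seq => i iz; rewrite iz /= mulrCA.
  by rewrite linearZ /= -/phi gE; apply: mulVf.
- by rewrite scalerA divff // scale1r.
- move=> u u0; rewrite [LHS]linextE big1 // => i _.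
  case: ifP => [iz|_]; last by rewrite scaler0.
  by rewrite u0 ?scale0r //; apply: simz.
Qed.

End Lines.

(** * Finite rank summands through a given vector *)

Lemma preorder_max (T : eqType) (le : T -> T -> Prop) (s : seq T) :
  (forall x, le x x) -> (forall x y z, le x y -> le y z -> le x z) ->
  s != [::] -> exists2 t, t \in s & forall r, r \in s -> le t r -> le r t.
Proof.
move=> lexx letr; elim: s => // x [|y s] IH _.
  by exists x => [|r]; rewrite ?mem_head // mem_seq1 => /eqP->.
have [t ts tmax] := IH isT; have [tx|ntx] := pselect (le t x); last first.
  exists t => [|r]; first by rewrite in_cons ts orbT.
  by rewrite in_cons => /orP[/eqP->|/tmax].
exists x => [|r]; first exact: mem_head.
rewrite in_cons => /orP[/eqP->//|rs xr].
exact: letr (tmax _ rs (letr _ _ _ tx xr)) tx.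
Qed.

Section FiniteSummand.
Variables (I : choiceType) (A : I -> I -> rat -> Prop).
Hypothesis catA : line_category A.
Local Notation V := {freeg I / rat}.
Variable e : {linear V -> V}.
Hypothesis adm_e : admissible A e.
Hypothesis idem_e : forall v, e (e v) = e v.

(** A nonzero coefficient of an admissible map is a morphism of lines, so it
    only leads upwards in the preorder. *)
Lemma admissible_triangular v r :
  (forall i, coeff i v != 0 -> ~ line_le A i r) -> restr (cls A r) (e v) = 0.
Proof.
move=> vr; apply: freeg_coeff_ext => j; rewrite coeff_restr coeff0.
case: ifP => // /asboolP[jr _]; rewrite coeff_linear big_seq big1 // => i.
rewrite mem_dom => vi; have [->|ej0] := eqVneq (coeff j (e << i >>)) 0.
  by rewrite mulr0.
case: (vr i vi); apply: line_le_trans catA _ _ _ _ jr.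
by exists (coeff j (e << i >>)) => //; apply: adm_e; apply: morU.
Qed.

Lemma restr_cls_supp t v i : coeff i (restr (cls A t) v) != 0 -> line_sim A i t.
Proof. by rewrite coeff_restr; case: ifP => [/asboolP|]; rewrite ?eqxx. Qed.

(** The induction removes a maximal isomorphism class [t] from the support [s]
    of a vector [v] that [e] fixes in its own classes.  The class [t] component
    of [v] is the sum of its image under the idempotent block of [e], a
    multiple of one line by [homogeneous_line], and of terms coming from the
    lower classes; the latter are put into the vectors already found. *)
Lemma fixed_vector_lines (s : seq I) (v : V) :
  (forall i, coeff i v != 0 -> exists2 t, t \in s & line_sim A i t) ->
  (forall t, t \in s -> restr (cls A t) (e v) = restr (cls A t) v) ->
  exists (s' : seq I) (y : I -> V) (psi : I -> {linear V -> rat^o})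
      (tau : I -> I) (a : I -> rat),
    [/\ {subset s' <= s} /\ uniq s',
        forall l, l \in s' -> mor A (tau l) (y l) /\ admissible_to A (tau l) (psi l),
        forall l m, l \in s' -> m \in s' -> psi l (e (y m)) = (l == m)%:R,
        v = \sum_(l <- s') a l *: y l &
        forall l, l \in s' -> forall u,
          (forall i r, r \in s -> line_sim A i r -> coeff i u = 0) ->
          psi l u = 0].
Proof.
have [n] := ubnP (size s); elim: n s v => // n IH s v; rewrite ltnS => sn vs ve.
have [s0|s_n0] := eqVneq s [::].
  have v0 : v = 0.
    apply: freeg_coeff_ext => i; rewrite coeff0; apply/eqP/negP => /negP /vs[t].
    by rewrite s0.
  exists [::], (fun=> 0), (fun i => coef i), id, (fun=> 0).
  by split=> //; rewrite big_nil.
have [t ts tmax] := preorder_max (line_le_refl catA) (line_le_trans catA) s_n0.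
pose P : {linear V -> V} := restr (cls A t).
pose s1 := [seq r <- s | ~~ `[< line_sim A r t >]].
have s1P r : r \in s1 -> r \in s /\ ~ line_sim A r t.
  by rewrite mem_filter => /andP[/asboolPn].
have PE u i : coeff i (P u) = if `[< line_sim A i t >] then coeff i u else 0.
  exact: coeff_restr.
have vBP u i : coeff i (u - P u) != 0 -> coeff i u != 0 /\ ~ line_sim A i t.
  rewrite coeffB PE; case: ifP => [_|/asboolPn nit]; first by rewrite subrr eqxx.
  by rewrite subr0.
have Psupp u i : coeff i (P u) != 0 -> line_sim A i t by apply: restr_cls_supp.
(* t is maximal, so e maps the class of t into none of the remaining classes *)
have low u r : r \in s1 -> restr (cls A r) (e (P u)) = 0.
  move=> /s1P[rs nrt]; apply: admissible_triangular => i /Psupp[it ti] ir.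
  have tr := line_le_trans catA ti ir.
  by apply: nrt; split=> //; apply: tmax.
have [||| s' [y [psi [tau [a [[s's us'] morphs dual vE van]]]]]] :=
    IH s1 (v - P v).
- rewrite (leq_trans _ sn) // size_filter ltn_neqAle count_size andbT -all_count.
  by apply/negP => /allP/(_ t ts)/asboolPn; apply; apply: line_sim_refl.
- move=> i /vBP[/vs[r rs ir] nit]; exists r => //.
  rewrite mem_filter rs andbT; apply/asboolPn => rt; apply: nit.
  exact: line_sim_trans ir rt.
- move=> r rs1; have [rs nrt] := s1P r rs1.
  rewrite !raddfB /= low // subr0 ve //.
  rewrite -[LHS]subr0; congr (_ - _); apply: freeg_coeff_ext => i.
  rewrite coeff0 coeff_restr; case: ifP => // /asboolP ir; rewrite PE.
  case: ifP => // /asboolP it; case: nrt.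
  exact: line_sim_trans (line_sim_sym ir) it.
have psi_low u l : l \in s' -> psi l (e (P u)) = 0.
  move=> ls; apply: van => // i r rs1 ir.
  have := congr1 (coeff i) (low u r rs1); rewrite coeff0 coeff_restr.
  by rewrite (asboolT (ir : cls A r i)).
pose y1 l := y l + P (e (y l)); pose z := P (e (P v)).
have vE1 : v = \sum_(l <- s') a l *: y1 l + z.
  have -> : \sum_(l <- s') a l *: y1 l = (v - P v) + P (e (v - P v)).
    rewrite {2}vE raddf_sum raddf_sum vE -big_split; apply: eq_bigr => l _ /=.
    by rewrite scalerDr !linearZ.
  have PD : P (e (v - P v)) + P (e (P v)) = P v.
    rewrite -[RHS]/(restr _ _) -ve // -[v in RHS](subrK (P v)).
    by rewrite !raddfD.
  by rewrite -addrA PD subrK.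
have mor1 l : l \in s' -> mor A (tau l) (y1 l).
  by move=> /morphs[ml _]; apply: (morD catA) => //; apply/(mor_restr catA)/adm_e.
have dual1 l m : l \in s' -> m \in s' -> psi l (e (y1 m)) = (l == m)%:R.
  by move=> ls ms; rewrite !raddfD /= psi_low // addr0 dual.
have [z0|z_n0] := eqVneq z 0.
  exists s', y1, psi, tau, a; split=> //.
  - by split=> // l /s's /s1P[].
  - by move=> l ls; split; [apply: mor1|case: (morphs l ls)].
  - by rewrite {1}vE1 z0 addr0.
  - by move=> l ls u u0; apply: van => // i r /s1P[rs _]; apply: u0.
(* z is fixed by the block of e in the class of t, hence so is its line yt *)
have [yt [phi [g [mor_yt adm_phi phi_yt zE phi_van]]]] :=
  homogeneous_line catA z_n0 (fun i => @Psupp _ i).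
have ts' : t \notin s'.
  by apply/negP => /s's /s1P[_]; apply; apply: line_sim_refl.
have PeP u : P (e (P (e (P u)))) = P (e (P u)).
  rewrite -[RHS]/(P (e (P u))) -[in RHS](idem_e (P u)).
  apply/eqP; rewrite -subr_eq0 -!raddfB -opprB !raddfN oppr_eq0; apply/eqP.
  apply: admissible_triangular => i /vBP[ei nit] it; apply: nit; split=> //.
  apply: contrapT => nti; move/eqP: ei; apply.
  have /(congr1 (coeff i)) : restr (cls A i) (e (P u)) = 0.
    apply: admissible_triangular => j /Psupp[_ tj] ji.
    by apply: nti; apply: line_le_trans tj ji.
  by rewrite coeff0 coeff_restr (asboolT (line_sim_refl catA i : cls A i i)).
have g0 : g != 0 by apply: contra_neq z_n0 => g0; rewrite zE g0 scale0r.
have Pyt : P (e yt) = yt.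
  by apply: (scalerI g0); rewrite -!linearZ -zE /= -/P PeP.
have phiP u : phi u = phi (P u).
  apply/eqP; rewrite -subr_eq0 -raddfB; apply/eqP/phi_van => i it.
  by rewrite coeffB PE (asboolT it) subrr.
(* phi is made to vanish on the images of the vectors already found *)
have [psit psitE] : exists f : {linear V -> rat^o}, forall u,
    f u = phi u - \sum_(l <- s') phi (e (y1 l)) * psi l u.
  apply: linear_package => c u w.
  rewrite linearP /= (_ : \sum_(l <- s') _ = c * (\sum_(l <- s') phi (e (y1 l)) * psi l u)
      + \sum_(l <- s') phi (e (y1 l)) * psi l w).
    by rewrite scalerBr opprD addrACA.
  rewrite mulr_sumr -big_split; apply: eq_bigr => l _.
  by rewrite linearP /= mulrDr mulrCA.
have yt_low l : l \in s' -> psi l (e yt) = 0.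
  move=> ls; have := psi_low (e (P v)) l ls; rewrite -/z zE !linearZ /= => /eqP.
  by rewrite scaler_eq0 (negbTE g0) => /eqP.
pose upd (T : Type) (f : I -> T) x l := if l == t then x else f l.
have updE (T : Type) (f : I -> T) x l : l \in s' -> upd T f x l = f l.
  by rewrite /upd; case: eqVneq => // -> /(negP ts').
have updt (T : Type) (f : I -> T) x : upd T f x t = x by rewrite /upd eqxx.
exists (t :: s'), (upd _ y1 yt), (upd _ psi psit), (upd _ tau t), (upd _ a g).
split.
- split; last by rewrite /= ts'.
  by move=> l; rewrite in_cons => /orP[/eqP->//|/s's /s1P[]].
- move=> l; rewrite in_cons => /orP[/eqP->|ls]; rewrite ?updt ?updE //.
    split=> // k u mu; rewrite psitE; apply: line_sub => //; first exact: adm_phi.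
    apply: line_sum_seq => // m ms; have [_ mm] := morphs m ms; rewrite mulrC.
    by apply: (line_comp catA) (mm _ _ mu) _; apply/adm_phi/adm_e/mor1.
  by split; [apply: mor1|case: (morphs l ls)].
- have tl l : l \in s' -> (l == t) = false.
    by move=> ls; apply/negbTE; apply: contraNneq ts' => <-.
  move=> l m; rewrite !in_cons => /orP[/eqP->|ls] /orP[/eqP->|ms];
    rewrite ?updt ?updE //.
  + rewrite psitE eqxx phiP Pyt phi_yt big_seq big1 ?subr0 // => k ks.
    by rewrite yt_low // mulr0.
  + rewrite eq_sym tl // psitE (bigD1_seq m) //= dual1 // eqxx mulr1.
    rewrite big_seq_cond big1 ?addr0 ?subrr // => k /andP[ks km].
    by rewrite dual1 // (negbTE km) mulr0.
  + by rewrite tl // yt_low.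
  + exact: dual1.
- rewrite big_cons !updt {1}vE1 zE addrC; congr (_ + _).
  by apply: eq_big_seq => l ls; rewrite !updE.
- move=> l; rewrite in_cons => /orP[/eqP->|ls] u u0; rewrite ?updt ?updE //.
    rewrite psitE phi_van ?big_seq ?big1 ?subrr // => [k ks|i it]; last exact: u0 it.
    rewrite van ?mulr0 // => i r /s1P[rs _]; exact: u0.
  by apply: van => // i r /s1P[rs _]; apply: u0.
Qed.

End FiniteSummand.

(** * Splitting idempotents between direct sums of lines *)

Lemma directed_seq (K : Type) (T : eqType) (S : K -> set T) (s : seq T) :
  (forall k k', exists k'', S k `<=` S k'' /\ S k' `<=` S k'') ->
  (forall x, x \in s -> (\bigcup_k S k) x) ->
  s = [::] \/ exists k, forall x, x \in s -> S k x.
Proof.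
move=> dir; elim: s => [|x s IH] xsS; [by left|right].
have [k _ xk] := xsS x (mem_head _ _).
have [|->|[k' sk']] := IH; first by move=> y ys; apply: xsS; rewrite in_cons ys orbT.
  by exists k => y; rewrite mem_seq1 => /eqP->.
have [k'' [kk k'k]] := dir k k'; exists k'' => y.
by rewrite in_cons => /orP[/eqP->|/sk' ?]; [apply: kk|apply: k'k].
Qed.

Lemma inj_transport (T U : eqType) (R : pointedType) (s : seq T) (f : T -> U) (a : T -> R) :
  {in s &, injective f} -> exists c : U -> R, forall x, x \in s -> c (f x) = a x.
Proof.
move=> f_inj.
suff /choice[c cP] : forall u, exists r, forall x, x \in s -> f x = u -> r = a x.
  by exists c => x xs; apply: cP.
move=> u; have [[x [xs <-]]|nex] := pselect (exists x, x \in s /\ f x = u).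
  by exists (a x) => y ys /f_inj ->.
by exists point => x xs fx; case: nex; exists x.
Qed.

Section Frame.
Variables (I : choiceType) (A : I -> I -> rat -> Prop).
Hypothesis catA : line_category A.
Local Notation V := {freeg I / rat}.

(** A frame of [U] is a basis that exhibits [U] as a direct sum of lines in the
    category: an element [j] is a basis vector [j.1] with its line [j.2], and
    the coordinate maps are morphisms as well as the inclusions. *)
Record frame (U : set V) (Y : set (V * I)) : Prop := {
  frame_sub : forall j, Y j -> U j.1 /\ mor A j.2 j.1;
  frame_span : forall u, U u -> exists (s : seq (V * I)) (c : V * I -> rat),
    [/\ uniq s, forall j, j \in s -> Y j & u = \sum_(j <- s) c j *: j.1];
  frame_free : forall s c, uniq s -> (forall j, j \in s -> Y j) ->
    \sum_(j <- s) c j *: j.1 = 0 -> forall j, j \in s -> c j = 0;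
  frame_mor : forall s c k, uniq s -> (forall j, j \in s -> Y j) ->
    mor A k (\sum_(j <- s) c j *: j.1) -> forall j, j \in s -> A k j.2 (c j)
}.

Lemma frame_bigcup (K : Type) (U : K -> set V) (Y : K -> set (V * I)) :
  (forall k k', exists k'', Y k `<=` Y k'' /\ Y k' `<=` Y k'') ->
  (forall k, frame (U k) (Y k)) -> frame (\bigcup_k U k) (\bigcup_k Y k).
Proof.
move=> dir fr; split.
- move=> j [k _ Yj]; have [Uj mj] := frame_sub (fr k) Yj.
  by split=> //; exists k.
- move=> u [k _ Uu]; have [s [c [us sY ->]]] := frame_span (fr k) Uu.
  by exists s, c; split=> // j /sY; exists k.
- move=> s c us sY s0; have [->//|[k sk]] := directed_seq dir sY.
  exact: (frame_free (fr k) us sk s0).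
- move=> s c k us sY sk; have [->//|[l sl]] := directed_seq dir sY.
  exact: (frame_mor (fr l) us sl sk).
Qed.

(** Frames are inherited by extensions whose quotient lifts: [r] is the
    projection of [U'] to the quotient [Ub] with kernel [U], and [l] a section. *)
Lemma frame_ext (U U' Ub : set V) (Y Yb : set (V * I)) (l r : {linear V -> V}) :
  admissible A l -> admissible A r -> frame U Y -> frame Ub Yb ->
  (forall y, Ub y -> U' (l y) /\ r (l y) = y) ->
  (forall u, U' u -> Ub (r u)) -> (forall u, U' u -> r u = 0 -> U u) ->
  U `<=` U' -> (forall u, U u -> r u = 0) ->
  (forall u v, U' u -> U' v -> U' (u - v)) ->
  frame U' (Y `|` [set (l j.1, j.2) | j in Yb]).
Proof.
move=> adm_l adm_r fr frb lU rU kerU UU' r0 U'B.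
set Y' := Y `|` _.
pose up (j : V * I) : V * I := (l j.1, j.2).
pose down (j : V * I) : V * I := (r j.1, j.2).
have YbP j : Y' j -> ~ Y j -> Yb (down j) /\ up (down j) = j.
  case=> [//|[jb Ybj <-] _]; rewrite /down /up /=.
  have [Ubj _] := frame_sub frb Ybj; have [_ ->] := lU _ Ubj.
  by rewrite -surjective_pairing.
have Yr j : Y j -> r j.1 = 0 by move=> /(frame_sub fr)[/r0].
have split_comb s c : uniq s -> (forall j, j \in s -> Y' j) ->
    exists s1 s2, [/\ (forall j, j \in s -> j \in s1 \/ j \in s2),
      uniq s1 /\ (forall j, j \in s1 -> Y j),
      forall j, j \in s2 -> Yb (down j) /\ up (down j) = j,
      \sum_(j <- s) c j *: j.1 =
        \sum_(j <- s1) c j *: j.1 + \sum_(j <- s2) c j *: j.1 &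
      uniq (map down s2) /\ r (\sum_(j <- s) c j *: j.1) =
        \sum_(j <- map down s2) c (up j) *: j.1].
  move=> us sY; exists [seq j <- s | `[< Y j >]], [seq j <- s | ~~ `[< Y j >]].
  have dY j : j \in [seq j <- s | ~~ `[< Y j >]] ->
      Yb (down j) /\ up (down j) = j.
    by rewrite mem_filter => /andP[/asboolPn nYj /sY/YbP]; apply.
  split=> //.
  - by move=> j js; rewrite !mem_filter js !andbT; case: asboolP; [left|right].
  - by split; rewrite ?filter_uniq // => j; rewrite mem_filter => /andP[/asboolP].
  - by rewrite !big_filter [LHS](bigID (fun j => `[< Y j >])).
  - split.
      rewrite map_inj_in_uniq ?filter_uniq // => i j /dY[_ iE] /dY[_ jE] ij.
      by rewrite -iE ij jE.
    rewrite big_map (bigID (fun j => `[< Y j >])) raddfD raddf_sum /=.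
    rewrite big1 ?add0r; last first.
      by move=> j /asboolP Yj; rewrite linearZ /= Yr // scaler0.
    rewrite -big_filter raddf_sum; apply: eq_big_seq => j /dY[_ jE].
    by rewrite /= linearZ /= jE.
split.
- move=> j [Yj|[jb /(frame_sub frb)[Uj mj] <-]] /=.
    by have [Uj mj] := frame_sub fr Yj; split=> //; apply: UU'.
  by have [Ul _] := lU _ Uj; split=> //; apply: adm_l.
- move=> u Uu; have [sb [cb [usb sbY uE]]] := frame_span frb (rU u Uu).
  have Ulr : U' (u - l (r u)) by apply: U'B => //; apply: (lU _ (rU u Uu)).1.
  have [|s [c [us sY u1E]]] := frame_span fr (kerU _ Ulr _).
    by rewrite raddfB /= (lU _ (rU u Uu)).2 subrr.
  have upK j : j \in sb -> down (up j) = j.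
    move=> /sbY/(frame_sub frb)[Uj _]; have [_] := lU _ Uj.
    by rewrite /down /up /= => ->; rewrite -surjective_pairing.
  have upY j : j \in sb -> ~ Y (up j).
    move=> js Yj; have /sbY Ybj := js.
    suff : 1 = 0 :> rat by apply/eqP; rewrite oner_eq0.
    apply: (frame_free frb (s := [:: j]) (c := fun=> 1)) (mem_head j _) => //.
      by move=> i; rewrite mem_seq1 => /eqP->.
    by rewrite big_seq1 scale1r -(upK _ js) /= (Yr _ Yj).
  pose d j := if j \in s then c j else cb (down j).
  exists (s ++ map up sb), d; split.
  + rewrite cat_uniq us /=; apply/andP; split.
      by apply/hasPn => _ /mapP[j /upY nYj ->]; apply/negP => /sY.
    by rewrite map_inj_in_uniq // => i j /upK iE /upK jE ij; rewrite -iE ij jE.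
  + move=> j; rewrite mem_cat => /orP[/sY|/mapP[jb /sbY Ybj ->]]; [by left|right].
    by exists jb.
  + rewrite big_cat big_map -(subrK (l (r u)) u) u1E; congr (_ + _).
      by apply: eq_big_seq => j js; rewrite /d js.
    rewrite uE raddf_sum; apply: eq_big_seq => j js.
    rewrite /= linearZ /d ifF ?upK //; apply/negP => /sY; exact: upY.
- move=> s c us sY s0.
  have [s1 [s2 [ss [us1 s1Y] s2Y sE [us2 rE]]]] := split_comb s c us sY.
  have c2 j : j \in s2 -> c j = 0.
    move=> js; have [_ <-] := s2Y j js.
    apply: (frame_free frb us2 (c := c \o up)); last exact: map_f.
      by move=> _ /mapP[i /s2Y[Yi _] ->].
    by rewrite -rE s0 raddf0.
  move=> j /ss[js1|/c2//]; apply: (frame_free fr us1 s1Y _ js1).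
  have s20 : \sum_(j <- s2) c j *: j.1 = 0.
    by rewrite big_seq big1 // => i /c2 ->; rewrite scale0r.
  by move: s0; rewrite sE s20 addr0.
- move=> s c k us sY mk.
  have [s1 [s2 [ss [us1 s1Y] s2Y sE [us2 rE]]]] := split_comb s c us sY.
  have c2 j : j \in s2 -> A k j.2 (c j).
    move=> js; have [_ jE] := s2Y j js; rewrite -{2}jE.
    apply: (frame_mor frb us2 (c := c \o up) (k := k) _ _ (map_f down js)).
      by move=> _ /mapP[i /s2Y[Yi _] ->].
    by rewrite -rE; apply: adm_r.
  move=> j /ss[js1|/c2//]; apply: (frame_mor fr us1 s1Y _ js1).
  rewrite (_ : \sum_(j <- s1) _ =
     \sum_(j <- s) c j *: j.1 - \sum_(j <- s2) c j *: j.1); last by rewrite sE addrK.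
  apply: (morB catA) => //; apply: (mor_sum catA) => i is2.
  apply: (morZ catA) (c2 i is2) _; have [Ybi <-] := s2Y i is2.
  exact: adm_l (frame_sub frb Ybi).2.
Qed.

Lemma frame0 (U : set V) : (forall u, U u -> u = 0) -> frame U set0.
Proof.
move=> U0; split=> //.
- by move=> u /U0->; exists [::], (fun=> 0); rewrite big_nil.
- by move=> s c _ s0 _ j /s0.
- by move=> s c k _ s0 _ j /s0.
Qed.

Definition projector (f : V -> V) : Prop :=
  admissible A f /\ forall v, f (f v) = f v.

(** The vectors of [fixed_vector_lines] for [e w] become, after application of
    [e], a basis of a finite rank summand of the image of [e], whose dual basis
    consists of admissible functionals. *)
Lemma finite_summand (e : {linear V -> V}) (w : V) : projector e ->
  exists (th : {linear V -> V}) (Y : set (V * I)),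
    [/\ projector th, forall v, e (th v) = th v, forall v, th (e v) = th v,
        th (e w) = e w & frame (range th) Y].
Proof.
move=> [adm_e idem_e].
have [||s [y [psi [tau [a [[_ us] morphs dual wE _]]]]]] :=
    fixed_vector_lines catA adm_e idem_e (s := dom (e w)) (v := e w).
- by move=> i wi; exists i; [rewrite mem_dom|apply: line_sim_refl].
- by move=> t _; rewrite idem_e.
pose th0 u := \sum_(l <- s) psi l (e u) *: e (y l).
have [th thE] : exists th : {linear V -> V}, forall u, th u = th0 u.
  apply: linear_package => c u v; rewrite /th0 scaler_sumr -big_split.
  by apply: eq_bigr => l _; rewrite !linearP /= scalerDl scalerA.
have th_y l : l \in s -> th (e (y l)) = e (y l).
  move=> ls; rewrite thE /th0 (bigD1_seq l) //= idem_e dual // eqxx scale1r.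
  rewrite big_seq_cond big1 ?addr0 // => k /andP[ks kl].
  by rewrite dual // (negbTE kl) scale0r.
have th_sum c : th (\sum_(l <- s) c l *: e (y l)) = \sum_(l <- s) c l *: e (y l).
  by rewrite raddf_sum; apply: eq_big_seq => l ls; rewrite /= linearZ /= th_y.
pose g l : V * I := (e (y l), tau l).
have g_inj : {in s &, injective g}.
  move=> l m ls ms [elm _]; have := dual l m ls ms.
  rewrite -(idem_e (y m)) -elm idem_e dual // eqxx.
  by case: eqVneq => // _ /eqP; rewrite oner_eq0.
pose Y := [set j | exists2 l, l \in s & j = g l].
(* the functional of an element of Y reads off the coefficients *)
have coordP r c j : uniq r -> (forall i, i \in r -> Y i) -> j \in r ->
    exists2 l, l \in s /\ j = g l &
      psi l (e (\sum_(i <- r) c i *: i.1)) = c j.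
  move=> ur rY jr; have [l ls jE] := rY j jr; exists l => //.
  have pE i : i \in r -> psi l (e i.1) = (i == j)%:R.
    move=> /rY[m ms ->]; rewrite [(g m).1]/= idem_e dual // jE.
    by rewrite (inj_in_eq g_inj) // eq_sym.
  rewrite !raddf_sum (bigD1_seq j) //= !linearZ /= pE // eqxx rat_scaleE mulr1.
  rewrite big_seq_cond big1 ?addr0 // => i /andP[ir ij].
  by rewrite !linearZ /= pE // (negbTE ij) rat_scaleE mulr0.
exists th, Y; split.
- split=> [k v mv|v]; last by rewrite [X in th X]thE /th0 th_sum thE.
  rewrite thE; apply: (mor_sum catA) => l ls; have [ml adml] := morphs l ls.
  by apply: (morZ catA) (adml _ _ (adm_e _ _ mv)) _; apply: adm_e.
- move=> v; rewrite thE /th0 raddf_sum; apply: eq_bigr => l _.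
  by rewrite /= linearZ /= idem_e.
- by move=> v; rewrite !thE /th0; apply: eq_bigr => l _; rewrite idem_e.
- have ewE : e w = \sum_(l <- s) a l *: e (y l).
    rewrite -{1}idem_e wE raddf_sum; apply: eq_bigr => l _.
    by rewrite /= linearZ.
  by rewrite ewE th_sum.
- split.
  + move=> j [l ls ->] /=; split; first by exists (e (y l)) => //; apply: th_y.
    by apply: adm_e; case: (morphs l ls).
  + move=> _ [v _ <-]; have [c cE] := inj_transport (R := rat)
      (fun l => psi l (e v)) g_inj.
    exists (map g s), c; split.
    * by rewrite map_inj_in_uniq.
    * by move=> _ /mapP[l ls ->]; exists l.
    * by rewrite thE big_map; apply: eq_big_seq => l ls; rewrite cE.
  + move=> r c ur rY r0 j jr; have [l _ <-] := coordP r c j ur rY jr.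
    by rewrite r0 !raddf0.
  + move=> r c k ur rY mk j jr; have [l [ls ->] <-] := coordP r c j ur rY jr.
    by have [_ adml] := morphs l ls; apply/adml/adm_e.
Qed.

(** A stage in the exhaustion of the image of [e]: [th] projects onto the summand
    split off so far, along a subspace that contains the kernel of [e]. *)
Record partial_splitting (e : V -> V) (th : V -> V) (Y : set (V * I)) : Prop := {
  psplit_projector : projector th;
  psplit_l : forall v, e (th v) = th v;
  psplit_r : forall v, th (e v) = th v;
  psplit_frame : frame (range th) Y
}.

(** The difference [e - th] is the projector onto the complementary summand of
    the image of [e]; another finite rank summand is split off there. *)
Lemma partial_splitting_step (e th : {linear V -> V}) Y w :
  projector e -> partial_splitting e th Y ->
  exists (th' : {linear V -> V}) Y',
    [/\ partial_splitting e th' Y', Y `<=` Y', forall v, th' (th v) = th v &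
        th' (e w) = e w].
Proof.
move=> [adm_e idem_e] [[adm_th idem_th] eth the frY].
have [e1 e1E] : exists e1 : {linear V -> V}, forall v, e1 v = e v - th v.
  apply: linear_package => c u v.
  by rewrite !linearP /= scalerBr scalerN addrACA.
have proj_e1 : projector e1.
  split=> [k v mv|v]; first by rewrite e1E; apply: (morB catA); [apply: adm_e|apply: adm_th].
  by rewrite !e1E (raddfB e) (raddfB th) /= idem_e eth the idem_th subrr subr0.
have [th1 [Y1 [[adm_th1 idem_th1] e1th the1 th1w frY1]]] := finite_summand w proj_e1.
have thth1 v : th (th1 v) = 0.
  by rewrite -e1th e1E raddfB /= the idem_th subrr.
have th1th v : th1 (th v) = 0.
  by rewrite -the1 e1E eth idem_th subrr raddf0.
have [th' th'E] : exists th' : {linear V -> V}, forall v, th' v = th v + th1 v.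
  by apply: linear_package => c u v; rewrite !linearP /= scalerDr addrACA.
have eth1 v : e (th1 v) = th1 v.
  by rewrite -[in RHS]e1th e1E thth1 subr0.
have th1e v : th1 (e v) = th1 v.
  by rewrite -[in LHS]the1 -[in RHS]the1 !e1E idem_e the.
exists th', (Y `|` [set (j.1, j.2) | j in Y1]); split.
- split.
  + split=> [k v mv|v]; last first.
      by rewrite !th'E !raddfD /= idem_th idem_th1 thth1 th1th add0r addr0.
    by rewrite th'E; apply: (morD catA); [apply: adm_th|apply: adm_th1].
  + by move=> v; rewrite th'E raddfD /= eth eth1.
  + by move=> v; rewrite !th'E the th1e.
  + apply: (frame_ext (l := idfun) (r := th1) _ adm_th1 frY frY1).
    * by [].
    * move=> _ [v _ <-] /=; split; last exact: idem_th1.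
      by exists (th1 v) => //; rewrite th'E thth1 idem_th1 add0r.
    * by move=> _ [v _ <-]; exists v => //; rewrite th'E raddfD /= th1th add0r idem_th1.
    * move=> _ [v _ <-]; rewrite th'E raddfD /= th1th add0r idem_th1 => ->.
      by exists v => //; rewrite addr0.
    * by move=> _ [v _ <-]; exists (th v) => //; rewrite th'E th1th addr0 idem_th.
    * by move=> _ [v _ <-].
    * by move=> _ _ [u _ <-] [v _ <-]; exists (u - v) => //; rewrite raddfB.
- by move=> j; left.
- by move=> v; rewrite th'E th1th addr0 idem_th.
- by rewrite th'E the th1e -the1 th1w e1E addrC subrK.
Qed.

(** The summands found by successive steps form an increasing chain, and their
    union is a direct sum of lines even though it need not be reached at any
    finite step. *)
Lemma countable_frame (e : {linear V -> V}) (w : nat -> V) : projector e ->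
  (forall v, exists s : seq (rat * nat), e v = \sum_(p <- s) p.1 *: e (w p.2)) ->
  exists Y, frame (range e) Y.
Proof.
move=> proj_e span_w; have [adm_e idem_e] := proj_e.
pose S := {p : {linear V -> V} * set (V * I) | partial_splitting e p.1 p.2}.
have [z zE] : exists z : {linear V -> V}, forall v, z v = 0.
  by apply: linear_package => c u v; rewrite scaler0 addr0.
have S0 : partial_splitting e z set0.
  split.
  - by split=> [k v _|v]; rewrite !zE //; apply: mor0.
  - by move=> v; rewrite zE raddf0.
  - by move=> v; rewrite !zE.
  - by apply: frame0 => _ [v _ <-]; rewrite zE.
have /choice[step stepP] (pn : S * nat) : exists p' : S,
    [/\ (sval pn.1).2 `<=` (sval p').2,
        forall v, (sval p').1 ((sval pn.1).1 v) = (sval pn.1).1 v &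
        (sval p').1 (e (w pn.2)) = e (w pn.2)].
  case: pn => [[[th Y] sp] n].
  have [th' [Y' [sp' YY' th'th th'w]]] := partial_splitting_step (w n) proj_e sp.
  by exists (exist _ (th', Y') sp').
pose fix seqS n : S := if n is m.+1 then step (seqS m, m) else exist _ (z, set0) S0.
pose th n := (sval (seqS n)).1; pose Y n := (sval (seqS n)).2.
have spS n : partial_splitting e (th n) (Y n) by rewrite /th /Y; case: (seqS n).
have YS m n : (m <= n)%N -> Y m `<=` Y n.
  elim: n => [|n IH]; first by rewrite leqn0 => /eqP->.
  rewrite leq_eqVlt => /orP[/eqP->//|/IH mn] j /mn.
  by have [Yn _ _] := stepP (seqS n, n); apply: Yn.
have thS m n v : (m <= n)%N -> th n (th m v) = th m v.
  elim: n => [|n IH]; first by rewrite leqn0 => /eqP->; have [[_ ->]] := spS 0.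
  rewrite leq_eqVlt => /orP[/eqP->|/IH mn]; first by have [[_ ->]] := spS n.+1.
  rewrite -{1}mn; have [_ thn _] := stepP (seqS n, n).
  by rewrite [LHS]thn.
have thw m n : (m < n)%N -> th n (e (w m)) = e (w m).
  move=> mn; have [_ _ thm] := stepP (seqS m, m).
  by rewrite -{1}thm [LHS](thS m.+1) //; apply: thm.
exists (\bigcup_n Y n).
suff -> : range e = \bigcup_n range (th n).
  apply: frame_bigcup => [m n|n]; last by have [] := spS n.
  by exists (maxn m n); split; apply: YS; rewrite ?leq_maxl ?leq_maxr.
apply/seteqP; split=> u; last first.
  by move=> [n _ [v _ <-]]; exists (th n v) => //; have [_ ->] := spS n.
move=> [v _ <-]; have [s sE] := span_w v.
exists (\max_(p <- s) p.2).+1 => //; exists (e v) => //.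
rewrite sE raddf_sum; apply: eq_big_seq => p ps.
by rewrite /= linearZ /= thw // ltnS; apply: (@leq_bigmax_seq _ _ xpredT snd).
Qed.

Definition supp_in (J : set I) (v : V) : Prop := forall i, coeff i v != 0 -> J i.

Definition closed_under (e : V -> V) (J : set I) : Prop :=
  forall k, J k -> supp_in J (e << k >>).

Lemma closed_supp (e : {linear V -> V}) J v :
  closed_under e J -> supp_in J v -> supp_in J (e v).
Proof.
move=> clJ vJ i; apply: contraNP => nJi; apply/eqP.
rewrite coeff_linear big_seq big1 // => k; rewrite mem_dom => /vJ Jk.
have [->|/(clJ k Jk)//] := eqVneq (coeff i (e << k >>)) 0.
by rewrite mulr0.
Qed.

Lemma supp_inB J u v : supp_in J u -> supp_in J v -> supp_in J (u - v).
Proof.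
move=> uJ vJ i; rewrite coeffB; have [->|/uJ//] := eqVneq (coeff i u) 0.
by rewrite sub0r oppr_eq0 => /vJ.
Qed.

Lemma restr_supp J v : supp_in J v -> restr J v = v.
Proof.
move=> vJ; apply: freeg_coeff_ext => i; rewrite coeff_restr.
by case: asboolP => // nJi; apply/esym/eqP/negPn/negP => /vJ.
Qed.

Lemma supp_restr J v : supp_in J (restr J v).
Proof. by move=> i; rewrite coeff_restr; case: asboolP; rewrite ?eqxx. Qed.

Lemma restr_eq0 J D v : supp_in J v -> (forall i, J i -> ~ D i) -> restr D v = 0.
Proof.
move=> vJ JD; apply: freeg_coeff_ext => i; rewrite coeff_restr coeff0.
by case: asboolP => // Di; apply/eqP/negPn/negP => /vJ /JD.
Qed.

(** The set of lines reached from [i] through [e] is countable because the image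
    of a basis vector has finite support. *)
Lemma countable_closure (e : V -> V) (i : I) : exists (c : nat -> I),
  closed_under e (range c) /\ range c i.
Proof.
pose fix L n := if n is m.+1 then L m ++ flatten [seq dom (e << k >>) | k <- L m]
  else [:: i].
pose c n := if unpickle n is Some (a, b) then nth i (L a) b else i.
have L0 n : i \in L n by elim: n => [|n IH]; rewrite ?mem_head // mem_cat IH.
have cP k : range c k <-> exists n, k \in L n.
  split=> [[n _ <-]|[n kn]].
    rewrite /c; case: (unpickle n) => [[a b]|]; last by exists 0%N.
    exists a; have [ba|ba] := ltnP b (size (L a)); first exact: mem_nth.
    by rewrite nth_default.
  by exists (pickle (n, index k (L n))) => //; rewrite /c pickleK nth_index.
exists c; split; last by apply/cP; exists 0%N.
move=> k /cP[n kn] j ej; apply/cP; exists n.+1; rewrite mem_cat; apply/orP; right.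
by apply/flattenP; exists (dom (e << k >>)); rewrite ?mem_dom //; apply: map_f.
Qed.

(** A maximal [e]-stable coordinate subspace on which [e] splits is everything,
    because otherwise it could be enlarged by countably many lines. *)
Theorem projector_frame (e : {linear V -> V}) : projector e ->
  exists Y, frame (range e) Y.
Proof.
move=> [adm_e idem_e].
pose img J : set V := [set e v | v in supp_in J].
pose ix (Z : set (I + V * I)) : set I := [set i | Z (inl i)].
pose fr (Z : set (I + V * I)) : set (V * I) := [set j | Z (inr j)].
pose good Z := closed_under e (ix Z) /\ frame (img (ix Z)) (fr Z).
have [F Fgood Ftot|Z [[clZ frZ] Zmax]] := @Zorn_bigcup _ good.
  split; first by move=> k [X FX Xk] i /((Fgood X FX).1 k Xk) Xi; exists X.
  have dir (X Y : {X | F X}) : exists W : {X | F X},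
      sval X `<=` sval W /\ sval Y `<=` sval W.
    have [XY|YX] := Ftot _ _ (svalP X) (svalP Y).
      by exists Y; split=> // x.
    by exists X; split=> // x.
  have -> : fr (\bigcup_(X in F) X) = \bigcup_(X : {X | F X}) fr (sval X).
    apply/seteqP; split=> j; first by move=> [X FX Xj]; exists (exist _ X FX).
    by move=> [[X FX] _ Xj]; exists X.
  have [[X0]|F0] := pselect (inhabited {X | F X}); last first.
    rewrite [X in frame _ X]bigcup0 => [|X _]; last by case: (F0 (inhabits X)).
    apply: frame0 => _ [v vF <-]; rewrite (_ : v = 0) ?raddf0 //.
    apply: freeg_coeff_ext => i; rewrite coeff0; apply/eqP/negPn/negP => /vF.
    by case=> X FX _; case: F0; exact: inhabits (exist _ X FX).
  have -> : img (ix (\bigcup_(X in F) X)) = \bigcup_(X : {X | F X}) img (ix (sval X)).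
    apply/seteqP; split=> [_ [v vF <-]|_ [[X FX] _ [v vX <-]]]; last first.
      by exists v => // i /vX Xi; exists X.
    have [||v0|[X vX]] := @directed_seq {X | F X} _ (fun X => ix (sval X)) (dom v).
    - move=> X Y; have [W [XW YW]] := dir X Y.
      by exists W; split=> i; [apply: XW|apply: YW].
    - move=> i; rewrite mem_dom => /vF[X FX Xi]; by exists (exist _ X FX).
    - exists X0 => //; exists v => // i; by rewrite -mem_dom v0.
    - exists X => //; exists v => // i; by rewrite -mem_dom => /vX.
  apply: frame_bigcup => [X Y|[X FX]]; last exact: (Fgood X FX).2.
  have [W [XW YW]] := dir X Y.
  by exists W; split=> j; [apply: XW|apply: YW].
suff allZ i : ix Z i.
  exists (fr Z); suff -> : range e = img (ix Z) by [].
  by apply/seteqP; split=> _ [v _ <-]; exists v.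
apply: contrapT => nZi.
have [c [clC Ci]] := countable_closure e i.
pose J := ix Z; pose C := range c; pose D := C `\` J; pose U' := J `|` C.
have clU : closed_under e U'.
  by move=> k [/clZ eJ|/clC eC] l; [move=> /eJ; left|move=> /eC; right].
have restrJ v : supp_in J v -> restr D v = 0.
  by move=> /restr_eq0; apply=> l Jl [_].
(* the idempotent that e induces modulo J on the new lines *)
have [eb ebE] : exists eb : {linear V -> V}, forall v, eb v = restr D (e (restr D v)).
  by apply: linear_package => a u v; rewrite !linearP.
have restrD v : restr D (restr D v) = restr D v.
  by apply: restr_supp; apply: supp_restr.
have DC v : supp_in D v -> supp_in C v by move=> vD l /vD[].
have proj_eb : projector eb.
  split=> [k v mv|v].
    by rewrite ebE; apply/(mor_restr catA)/adm_e/(mor_restr catA).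
  rewrite !ebE restrD; set u := restr D v.
  have eJ : supp_in J (e u - restr D (e u)).
    have uC : supp_in C (e u) by apply: (closed_supp clC); apply: DC; apply: supp_restr.
    move=> l; rewrite coeffB coeff_restr; case: asboolP => [_|nDl].
      by rewrite subrr eqxx.
    rewrite subr0 => /uC Cl; apply: contrapT => nJl; exact: nDl.
  have := restrJ _ (closed_supp clZ eJ).
  by rewrite !raddfB /= idem_e => /eqP; rewrite subr_eq0 => /eqP.
have [Yb frb] : exists Yb, frame (range eb) Yb.
  apply: (countable_frame (w := fun n => << c n >>)) => // v.
  have /choice[n nP] k : exists n, C k -> c n = k.
    by have [[n _ <-]|nC] := pselect (C k); [exists n|exists 0%N].
  exists [seq (coeff k v, n k) | k <- dom (restr D v)].
  have -> : eb v = eb (restr D v) by rewrite !ebE restrD.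
  rewrite big_map.
  rewrite (linear_expand eb); apply: eq_big_seq => k; rewrite mem_dom.
  move=> /[dup] /supp_restr[Ck nJk]; rewrite coeff_restr; case: ifP => [_|_].
    by rewrite nP.
  by rewrite eqxx.
pose Z' : set (I + V * I) := [set x | match x with
  | inl k => U' k
  | inr j => (fr Z `|` [set (e j.1, j.2) | j in Yb]) j
  end].
apply: (Zmax Z').
  split; first by move=> [k|j] Zx; left.
  by move=> /(_ (inl i)) ZZ; apply: nZi; apply: ZZ; right.
split=> //.
apply: (frame_ext (r := restr D) adm_e _ frZ frb).
- by move=> k v mv; apply: mor_restr.
- move=> _ [v _ <-]; split.
    exists (eb v) => // l; rewrite ebE => /supp_restr[Cl _]; by right.
  have [_ idem_eb] := proj_eb.
  rewrite -[RHS]idem_eb [RHS]ebE; congr (restr D (e _)).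
  by rewrite [in RHS]ebE restrD ebE.
- move=> _ [v vU <-]; exists v => //; rewrite ebE.
  have vJ : supp_in J (v - restr D v).
    move=> l; rewrite coeffB coeff_restr; case: asboolP => [_|nDl].
      by rewrite subrr eqxx.
    rewrite subr0 => /vU[//|Cl]; apply: contrapT => nJl; exact: nDl.
  have := restrJ _ (closed_supp clZ vJ).
  by rewrite !raddfB /= => /eqP; rewrite subr_eq0 => /eqP ->.
- move=> _ [v vU <-] r0; exists (e v); last exact: idem_e.
  move=> l /[dup] el /(closed_supp clU vU)[//|Cl]; apply: contrapT => nJl.
  have := congr1 (coeff l) r0; rewrite coeff0 coeff_restr asboolT; last by split.
  by move/eqP: el.
- by move=> _ [v vJ <-]; exists v => // l /vJ; left.
- by move=> _ [v vJ <-]; apply: restrJ; apply: closed_supp.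
- move=> _ _ [u uU <-] [v vU <-]; exists (u - v); last by rewrite raddfB.
  exact: supp_inB.
Qed.

End Frame.

(** * Decomposition bases *)

Section Subgroups.
Variable G : zmodType.

Definition divides (n : nat) (x : G) : Prop := exists y, x = y *+ n.

Lemma dividesB n x y : divides n x -> divides n y -> divides n (x - y).
Proof. by move=> [u ->] [v ->]; exists (u - v); rewrite mulrnBl. Qed.

Lemma divides0 n : divides n 0.
Proof. by exists 0; rewrite mul0rn. Qed.

Lemma dividesN n x : divides n x -> divides n (- x).
Proof. by move=> ?; rewrite -sub0r; apply: dividesB => //; apply: divides0. Qed.

Lemma dividesD n x y : divides n x -> divides n y -> divides n (x + y).
Proof. by move=> dx dy; rewrite -[y]opprK; apply/dividesB/dividesN. Qed.

Lemma divides_sum n (T : eqType) (s : seq T) F :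
  (forall i, i \in s -> divides n (F i)) -> divides n (\sum_(i <- s) F i).
Proof.
move=> sF; rewrite big_seq; elim/big_ind: _ => //; first exact: divides0.
by move=> *; apply: dividesD.
Qed.

Lemma dividesMn n x m : divides n x -> divides n (x *+ m).
Proof. by move=> [y ->]; exists (y *+ m); rewrite mulrnAC. Qed.

Lemma dividesMz n x m : divides n x -> divides n (x *~ m).
Proof.
by move=> dx; case: m => m; rewrite ?NegzE ?mulrNz; [|apply: dividesN]; apply: dividesMn.
Qed.

Lemma divides_mulr m n x : (m %| n)%N -> divides n x -> divides m x.
Proof. by move=> /dvdnP[k ->] [y ->]; exists (y *+ k); rewrite mulrnA. Qed.

Lemma mulrz_swap (x : G) m n : x *~ m *~ n = x *~ n *~ m.
Proof. by rewrite -!mulrzA mulrC. Qed.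

Lemma coprime_comb (a b : nat) : coprime a b ->
  exists u v : int, u * a + v * b = 1.
Proof.
move=> /eqP ab; have [u [v uv]] := Bezoutz a b.
by exists u, v; rewrite uv /gcdz /= ab.
Qed.

Lemma coprime_mem (S : zmodClosed G) (a b : nat) x :
  coprime a b -> x *+ a \in S -> x *+ b \in S -> x \in S.
Proof.
move=> /coprime_comb[u [v uv]] Sa Sb.
rewrite -[x]mulr1z -uv mulrzDr (mulrC u) (mulrC v) !mulrzA.
by rewrite rpredD // rpredMz.
Qed.

Lemma gen_sub (A : set G) (S : zmodClosed G) x :
  (forall a, A a -> a \in S) -> x \in gen A -> x \in S.
Proof.
move=> AS /genP; apply=> //; split; first exact: rpred0.
by move=> u v; apply: rpredB.
Qed.

Lemma gen_mono (A B : set G) x : A `<=` B -> x \in gen A -> x \in gen B.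
Proof. by move=> AB; apply: (gen_sub (S := gen B)) => a /AB/mem_gen. Qed.

End Subgroups.

Section LinearCombination.
Variables (G : zmodType) (J : choiceType) (b : J -> G).

Definition lincomb : {freeg J} -> G := fglift (b : J -> zmodule G).

Fact lincomb_is_additive : zmod_morphism lincomb.
Proof. exact: (lift_is_additive (M := zmodule G)). Qed.
HB.instance Definition _ :=
  GRing.isZmodMorphism.Build {freeg J} G lincomb lincomb_is_additive.

Lemma lincombU k j : lincomb << k *g j >> = b j *~ k.
Proof. by rewrite /lincomb liftU. Qed.

Lemma lincombE u : lincomb u = \sum_(j <- dom u) b j *~ coeff j u.
Proof.
by rewrite -{1}(freeg_sumE u) raddf_sum; apply: eq_bigr => j _; rewrite /= lincombU.
Qed.

End LinearCombination.

Lemma int_freeg_ext (J : choiceType) (u v : {freeg J}) :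
  (forall j, coeff j u = coeff j v) -> u = v.
Proof. by move=> uv; apply/eqP/freeg_eqP. Qed.

(** The last field says that the heights of combinations are the minima of the
    heights of their terms. *)
Record decomposition_basis (G : zmodType) (J : choiceType) (b : J -> G) : Prop := {
  dbasis_torsion : forall g, exists2 n, (0 < n)%N & exists u, g *+ n = lincomb b u;
  dbasis_free : forall u, lincomb b u = 0 -> u = 0;
  dbasis_divides : forall p k u, prime p -> divides (p ^ k) (lincomb b u) ->
    forall j, divides (p ^ k) (b j *~ coeff j u)
}.

(** * Digit systems *)

Section Digits.
Variables (G : zmodType) (p : nat).
Hypothesis p_pr : prime p.

Definition digit_free (X S : set G) : Prop :=
  forall s (a : G -> nat), uniq s -> (forall x, x \in s -> X x) ->
    (forall x, x \in s -> (a x < p)%N) -> S (\sum_(x <- s) x *+ a x) ->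
    forall x, x \in s -> a x = 0%N.

Lemma digit_coprime a : (0 < a < p)%N -> coprime a p.
Proof.
move=> /andP[a0 ap]; rewrite coprime_sym prime_coprime //.
by apply/negP => /(dvdn_leq a0); rewrite leqNgt ap.
Qed.

(** Independence over the field with [p] elements, expressed by digits: an
    element outside a maximal independent set has an invertible coefficient in
    some relation. *)
Lemma maximal_digit_free (Z S : set G) (gS : zmodClosed G) :
  (forall x, x \in gS <-> S x) -> (forall z, Z z -> S (z *+ p)) ->
  exists X, [/\ X `<=` Z, digit_free X S & forall z, Z z -> z \in gen (X `|` S)].
Proof.
move=> gSP ZS; pose good X := X `<=` Z /\ digit_free X S.
have [F Fgood Ftot|X [[XZ dX] Xmax]] := @Zorn_bigcup _ good.
  split=> [x [X FX Xx]|s a us sX ap sS]; first exact: (Fgood X FX).1.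
  have [X Y|||[X sXX]] := @directed_seq {X | F X} _ (@sval _ _) s.
  - have [XY|YX] := Ftot _ _ (svalP X) (svalP Y).
      by exists Y; split=> // x.
    by exists X; split=> // x.
  - by move=> x /sX[X FX Xx]; exists (exist _ X FX).
  - by move->.
  - exact: ((Fgood _ (svalP X)).2 s a us sXX ap sS).
exists X; split=> // z Zz; apply: contrapT => nz.
have nXz : ~ X z by move=> Xz; apply/nz/mem_gen; left.
apply: (Xmax (X `|` [set z])).
  by split=> [x|/(_ z)]; [left|move=> sub; apply/nXz/sub; right].
split; first by move=> x [/XZ//|->].
move=> s a us sX ap sS.
have [zs|nzs] := boolP (z \in s); last first.
  apply: dX => // x xs; have [//|xz] := sX x xs.
  by rewrite xz (negPf nzs) in xs.
have us' := rem_uniq z us.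
have sX' x : x \in rem z s -> X x.
  by rewrite mem_rem_uniq // => /andP[/= xz /sX[//|xz']]; rewrite xz' eqxx in xz.
have ap' x : x \in rem z s -> (a x < p)%N by move=> /mem_rem; apply: ap.
have sE : \sum_(x <- s) x *+ a x = z *+ a z + \sum_(x <- rem z s) x *+ a x.
  by rewrite (perm_big _ (perm_to_rem zs)) big_cons.
have [az0|az0] := eqVneq (a z) 0%N.
  move: sS; rewrite sE az0 mulr0n add0r => /(dX _ _ us' sX' ap') a0 x xs.
  have [->//|xz] := eqVneq x z; apply: a0.
  by rewrite mem_rem_uniq // inE xz.
case: nz; apply: (coprime_mem (a := a z) (b := p)).
- by apply: digit_coprime; rewrite lt0n az0 ap.
- rewrite -[_ *+ _](addrK (\sum_(x <- rem z s) x *+ a x)) -sE rpredB //.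
    by apply: mem_gen; right.
  rewrite big_seq rpred_sum // => x xs; rewrite rpredMn //.
  by apply: mem_gen; left; apply: sX'.
- by apply: mem_gen; right; apply: ZS.
Qed.

End Digits.

Section Layers.
Variables (G : zmodType) (J : choiceType) (b : J -> G) (p n : nat).
Hypothesis p_pr : prime p.
Hypothesis dbb : decomposition_basis b.
Hypothesis pn_tors : forall (x : G) k, x *+ (p ^ k) = 0 -> x *+ (p ^ n) = 0.

Let p_gt0 k : (0 < p ^ k)%N. Proof. by rewrite expn_gt0 prime_gt0. Qed.

Definition in_span (x : G) : Prop := exists u, x = lincomb b u.
Definition in_hull (x : G) : Prop := exists k, in_span (x *+ (p ^ k)).

Lemma in_spanB (x y : G) : in_span x -> in_span y -> in_span (x - y).
Proof. by move=> [u ->] [v ->]; exists (u - v); rewrite raddfB. Qed.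

Lemma in_span0 : in_span 0.
Proof. by exists 0; rewrite raddf0. Qed.

Lemma in_spanb j k : in_span (b j *~ k).
Proof. by exists << k *g j >>; rewrite lincombU. Qed.

Definition span_pred : {pred G} := fun x => `[< in_span x >].

Fact span_zmod_closed : zmod_closed span_pred.
Proof.
split=> [|x y /asboolP Fx /asboolP Fy]; apply/asboolP; first exact: in_span0.
exact: in_spanB.
Qed.
HB.instance Definition _ := GRing.isZmodClosed.Build G span_pred span_zmod_closed.

Lemma span_predP (x : G) : x \in span_pred <-> in_span x.
Proof. by split=> /asboolP. Qed.

Lemma in_spanMn (x : G) k : in_span x -> in_span (x *+ k).
Proof. by move=> /span_predP Fx; apply/span_predP; rewrite rpredMn. Qed.

Lemma pn_torsion_free (x : G) k : divides (p ^ n) x -> x *+ (p ^ k) = 0 -> x = 0.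
Proof.
move=> [y ->]; rewrite -mulrnA -expnD => /pn_tors.
by [].
Qed.

Lemma pn_cancel (x y : G) k : divides (p ^ n) x -> divides (p ^ n) y ->
  x *+ (p ^ k) = y *+ (p ^ k) -> x = y.
Proof.
move=> dx dy xy; apply/eqP; rewrite -subr_eq0; apply/eqP.
by apply: (@pn_torsion_free _ k (dividesB dx dy)); rewrite mulrnBl xy subrr.
Qed.

(** These are the relations of a simple presentation. *)
Definition chained (X : set G) (x : G) : Prop :=
  [\/ x *+ p = 0, X (x *+ p) | exists j, exists2 m, (0 < m)%N & x *+ p = b j *+ m].

(** A simple presentation, relative to the span of the basis, of the elements of
    height at least [al] in its [p]-hull.  Uniqueness of digit expansions is
    what makes the relations sufficient. *)
Record layer (al : nat) (X : set G) : Prop := {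
  layer_height : forall x, X x -> divides (p ^ al) x;
  layer_hull : forall x, X x -> in_hull x;
  layer_chain : forall x, X x -> chained X x;
  layer_free : digit_free p X in_span;
  layer_gen : forall x, in_hull x -> divides (p ^ al) x -> x \in gen (X `|` in_span)
}.

(** The defining property of a decomposition basis, in the form in which it
    lets an element of the hull be corrected by terms that each belong to one
    basis element. *)
Lemma divide_terms al k u : divides (p ^ (al + k)) (lincomb b u) ->
  exists w : J -> G, (forall j, divides (p ^ al) (w j)) /\
    forall j, w j *+ (p ^ k) = b j *~ coeff j u.
Proof.
move=> /(dbasis_divides dbb p_pr) du.
have /choice[y yE] j : exists y, b j *~ coeff j u = y *+ (p ^ (al + k)) := du j.
exists (fun j => y j *+ (p ^ al)); split=> j; first by exists (y j).
by rewrite yE -mulrnA expnD.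
Qed.

(** Multiples of [p ^ n] have no [p]-torsion, so that roots are unique and the
    hull splits into pieces, one for each basis element [b j], that embed in the
    rationals.  Such a piece is generated by the roots [z] of
    [z *+ p ^ k = b j *+ p ^ n]; those in the span are omitted. *)
Lemma top_layer : exists X, layer n X.
Proof.
pose X := [set z | [/\ divides (p ^ n) z, ~ in_span z &
  exists j k, z *+ (p ^ k) = b j *+ (p ^ n)]].
have X_or_span z : divides (p ^ n) z ->
    (exists j k, z *+ (p ^ k) = b j *+ (p ^ n)) -> z \in gen (X `|` in_span).
  by move=> dz ez; apply: mem_gen; have [Fz|nFz] := pselect (in_span z); [right|left].
have span_gen z : in_span z -> z \in gen (X `|` in_span).
  by move=> Fz; apply: mem_gen; right.
have pos_mult j c k : (0 < k)%N -> b j *~ c *+ k = b j *+ (p ^ n) ->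
    exists2 m, (0 < m)%N & c = m%:Z.
  move=> k0; rewrite !pmulrn -mulrzA => /eqP; rewrite -subr_eq0 -mulrzBr -lincombU.
  move=> /eqP/(dbasis_free dbb)/(congr1 (coeff j)); rewrite coeffU eqxx mulr1 coeff0.
  move=> /eqP; rewrite subr_eq0 => /eqP cE; have pn0 := p_gt0 n.
  by exists `|c|%N; nia.
exists X; split.
- by move=> x [].
- by move=> x [_ _ [j [k xk]]]; exists k; rewrite xk; exact: (in_spanb j (p ^ n)%:Z).
- move=> x [dx nFx [j [[|k] xk]]].
    by case: nFx; rewrite -[x]mulr1n -(expn0 p) xk; exact: (in_spanb j (p ^ n)%:Z).
  have xpk : x *+ p *+ (p ^ k) = b j *+ (p ^ n) by rewrite -mulrnA -expnS.
  have [[u uE]|nFxp] := pselect (in_span (x *+ p)); last first.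
    by apply: Or32; split; [apply: dividesMn|by []|exists j, k].
  apply: Or33; exists j.
  have uj : u = << coeff j u *g j >>.
    apply: int_freeg_ext => i; rewrite coeffU.
    have [<-|ji] := eqVneq j i; first by rewrite mulr1.
    have /(dbasis_free dbb)/(congr1 (coeff i)) :
        lincomb b (u *+ (p ^ k) - << (p ^ n)%:Z *g j >>) = 0.
      by rewrite raddfB raddfMn /= -uE lincombU xpk subrr.
    rewrite coeffB coeffMn coeffU (negbTE ji) mulr0 subr0 coeff0 => /eqP.
    by rewrite mulrn_eq0 expn_eq0 -leqn0 leqNgt prime_gt0 //= mulr0 => /eqP.
  move: uE; rewrite uj lincombU => uE; move: xpk; rewrite uE.
  by move=> /(pos_mult _ _ _ (p_gt0 k))[m m0 mE]; exists m => //; rewrite mE.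
- move=> s a us sX ap [u sE].
  have /choice[jk jkP] z : exists jk : option J * nat, X z ->
      exists2 j, jk.1 = Some j & z *+ (p ^ jk.2) = b j *+ (p ^ n).
    have [[_ _ [j [k zk]]]|nXz] := pselect (X z); last by exists (None, 0%N).
    by exists (Some j, k) => _; exists j.
  pose jz z := (jk z).1; pose kz z := (jk z).2.
  move=> x xs; apply/eqP/negPn/negP => ax0.
  have [j0 jx _] := jkP x (sX x xs); rewrite -/(jz x) in jx.
  have zP z : z \in s -> jz z = Some j0 -> z *+ (p ^ kz z) = b j0 *+ (p ^ n).
    by move=> /sX/jkP[j]; rewrite -/(jz z) -/(kz z) => -> zk [<-].
  pose s0 := [seq y <- s | (jz y == Some j0) && (a y != 0%N)].
  have s0P y : y \in s0 -> [/\ y \in s, jz y = Some j0 & a y != 0%N].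
    by rewrite mem_filter => /andP[/andP[/eqP]].
  (* both sides are divisible by p ^ n, so that p ^ K can be cancelled *)
  have S0E : \sum_(y <- s0) y *+ a y = b j0 *~ coeff j0 u.
    have sdiv : divides (p ^ n) (lincomb b u).
      by rewrite -sE; apply: divides_sum => y /sX[dy _ _]; apply: dividesMn.
    pose K := (\max_(y <- s) kz y)%N.
    have Kz y : y \in s -> (kz y <= K)%N by move=> ys; apply: (@leq_bigmax_seq _ _ xpredT kz).
    pose N y := (p ^ n * p ^ (K - kz y) * a y)%N.
    have yN y j : y \in s -> jz y = Some j -> y *+ a y *+ (p ^ K) = b j *+ N y.
      move=> ys jy; have [j'] := jkP y (sX y ys); rewrite -/(jz y) jy => -[<-] yk.
      rewrite -mulrnA -(subnKC (Kz y ys)) expnD mulnC -mulnA mulrnA yk -mulrnA.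
      by rewrite /N mulnA.
    apply: (@pn_cancel _ _ K); last 1 first.
    - pose g y : {freeg J} := if jz y is Some j then << (N y)%:Z *g j >> else 0.
      have /(dbasis_free dbb) : lincomb b (u *+ (p ^ K) - \sum_(y <- s) g y) = 0.
        rewrite raddfB raddfMn raddf_sum /= -sE -sumrMnl.
        apply/eqP; rewrite subr_eq0; apply/eqP; apply: eq_big_seq => y ys.
        have [j jy _] := jkP y (sX y ys); rewrite -/(jz y) in jy.
        by rewrite (yN y j) // /g jy lincombU pmulrn.
      move=> /(congr1 (coeff j0)); rewrite coeffB coeffMn coeff0 raddf_sum /=.
      move=> /eqP; rewrite subr_eq0 => /eqP uK.
      have uK' : coeff j0 u * (p ^ K)%N%:Z = \sum_(y <- s) coeff j0 (g y).
        by rewrite -uK -[(p ^ K)%N%:Z]natz mulr_natr.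
      rewrite [RHS]pmulrn -mulrzA uK' mulrz_sumr big_filter -sumrMnl big_mkcond /=.
      apply: eq_big_seq => y ys; have [j jy _] := jkP y (sX y ys).
      rewrite -/(jz y) in jy; rewrite /g jy coeffU (inj_eq (@Some_inj _)).
      have [jj|_] := eqVneq j j0; last by rewrite mulr0 mulr0z.
      rewrite mulr1 -pmulrn -jj -yN //; case: eqVneq => //= ->.
      by rewrite mulr0n mul0rn.
    - by apply: divides_sum => y /s0P[/sX[dy _ _] _ _]; apply: dividesMn.
    - exact: (dbasis_divides dbb p_pr sdiv).
  have xs0 : x \in s0 by rewrite mem_filter xs jx eqxx ax0.
  have s0n : s0 != [::] by apply: contraTneq xs0 => ->.
  have [z zs0 zmax] := preorder_max (le := fun y1 y2 => (kz y1 <= kz y2)%N)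
    (fun y => leqnn _) (fun y1 y2 y3 => @leq_trans _ _ _) s0n.
  have [zs jz0 az0] := s0P z zs0; have [dz nFz _] := sX z zs.
  pose c := (\sum_(y <- s0) p ^ (kz z - kz y) * a y)%N.
  have kmax y : y \in s0 -> (kz y <= kz z)%N.
    by move=> /zmax; case: (leqP (kz y) (kz z)) => // /ltnW zy; apply.
  have yz y : y \in s0 -> y = z *+ (p ^ (kz z - kz y)).
    move=> ys0; have [ys jy _] := s0P y ys0; have [dy _ _] := sX y ys.
    apply: (@pn_cancel _ _ (kz y) dy); first exact: dividesMn.
    by rewrite -mulrnA -expnD subnK ?kmax // !zP.
  have zc : z *+ c = b j0 *~ coeff j0 u.
    rewrite -S0E /c -sumrMnr; apply: eq_big_seq => y ys0.
    by rewrite mulrnA -yz.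
  apply: nFz; apply/span_predP; apply: (coprime_mem (a := c) (b := p ^ kz z)).
  + rewrite coprimeXr // /c (bigD1_seq z) ?filter_uniq //= subnn expn0 mul1n.
    rewrite -[coprime _ _]/(gcdn _ _ == 1)%N gcdnC.
    have /dvdnP[q ->] : (p %| \sum_(y <- s0 | y != z) p ^ (kz z - kz y) * a y)%N.
      rewrite big_seq_cond; apply: dvdn_sum => y /andP[ys0 yz'].
      apply: dvdn_mulr; apply: dvdn_exp => //; rewrite subn_gt0 ltn_neqAle kmax // andbT.
      apply: contraNneq yz' => kk; apply/eqP.
      by rewrite (yz y ys0) kk subnn expn0 mulr1n.
    rewrite addnC gcdnMDl gcdnC; apply: digit_coprime => //.
    by rewrite lt0n az0 ap.
  + by apply/span_predP; rewrite zc; apply: in_spanb.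
  + by apply/span_predP; rewrite zP //; exact: (in_spanb j0 (p ^ n)%:Z).
- have single z j k c : divides (p ^ n) z -> z *+ (p ^ k) = b j *+ c ->
      z \in gen (X `|` in_span).
    move=> dz zc; have [c0|c0] := posnP c.
      by rewrite (@pn_torsion_free z k) ?rpred0 // zc c0 mulr0n.
    have [m pm cE] := pfactor_coprime p_pr c0.
    set a := logn p c in cE.
    pose q := (p ^ (k + n))%N; pose P := (p ^ (a + n))%N.
    have /coprime_comb[u [v uv]] : coprime m q by rewrite coprimeXr // coprime_sym.
    have zq : z *~ q = b j *~ (m%:Z * P%:Z).
      by rewrite -pmulrn /q expnD mulrnA zc -PoszM -pmulrn -mulrnA {1}cE /P expnD mulnA.
    pose w := z *~ u + b j *~ (v * P%:Z).
    have dw : divides (p ^ n) w.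
      apply: dividesD; first exact: dividesMz.
      exists (b j *~ (v * (p ^ a)%N%:Z)); rewrite pmulrn -mulrzA; congr (_ *~ _).
      by rewrite /P expnD PoszM mulrA.
    have wq : w *+ q = b j *+ P.
      have zuq : z *~ u *~ q = b j *~ (m%:Z * P%:Z * u).
        by rewrite mulrz_swap zq -mulrzA.
      rewrite !pmulrn /w mulrzDl zuq -!mulrzA -mulrzDr.
      by congr (_ *~ _); rewrite -[RHS]mulr1 -uv; ring.
    suff wgen : w \in gen (X `|` in_span).
      have -> : z = w *~ m + b j *~ (m%:Z * P%:Z * v - v * P%:Z * m%:Z).
        rewrite -[LHS]mulr1z -uv mulrzDr (mulrC v) !mulrzA zq /w mulrzDl -!mulrzA.
        by rewrite -addrA -mulrzDr; congr (_ + _ *~ _); ring.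
      by apply: rpredD; [apply: rpredMz|apply: span_gen; apply: in_spanb].
    have [ka|ak] := leqP (k + n) a.
      have -> : w = b j *+ (p ^ (a - k)).
        apply: (@pn_cancel _ _ (k + n)) => //.
          exists (b j *+ (p ^ (a - k - n))); rewrite -mulrnA -expnD subnK //.
          by rewrite leq_subRL ?(leq_trans (leq_addr n k)).
        rewrite -/q wq -mulrnA -expnD; congr (_ *+ p ^ _).
        by rewrite addnA subnK // (leq_trans (leq_addr n k)).
      by apply: span_gen; exact: (in_spanb j (p ^ (a - k))%:Z).
    apply: X_or_span => //; exists j, (k + n - a)%N.
    apply: (@pn_cancel _ _ a); [exact: dividesMn|by exists (b j)|].
    have aE : (k + n - a + a = k + n)%N by rewrite subnK // ltnW.
    by rewrite -[LHS]mulrnA -expnD aE -/q wq -mulrnA -expnD (addnC n).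
  have singlez z j k c : divides (p ^ n) z -> z *+ (p ^ k) = b j *~ c ->
      z \in gen (X `|` in_span).
    case: c => c; first exact: single.
    move=> dz; rewrite NegzE mulrNz => zc; rewrite -[z]opprK rpredN.
    by apply: (single _ j k c.+1); [apply: dividesN|rewrite mulNrn zc opprK].
  move=> z [k [u uE]] dz.
  have dk : divides (p ^ (n + k)) (lincomb b u).
    by have [y zE] := dz; exists y; rewrite -uE zE -mulrnA -expnD.
  have [w [dw wE]] := divide_terms dk.
  have -> : z = \sum_(j <- dom u) w j.
    apply: (@pn_cancel _ _ k dz); first by apply: divides_sum => j _.
    by rewrite uE lincombE -sumrMnl; apply: eq_bigr => j _; rewrite wE.
  by rewrite rpred_sum // => j _; apply: singlez (wE j).
Qed.

(** The element [x] is corrected by a root of the generators that occur in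
    [x *+ p], and then by one root for each basis element that occurs; what
    remains is killed by [p].  So the elements of height [al] whose
    [p]-multiple is as in [chained] span the new layer, and a maximal
    independent subset of them is chosen. *)
Lemma next_layer al X' : layer al.+1 X' -> exists X, layer al X.
Proof.
move=> lX'.
pose Z := [set w | divides (p ^ al) w /\ chained X' w].
pose S : set G := fun x => x \in gen (X' `|` in_span).
have spanS x : in_span x -> S x by move=> Fx; apply: mem_gen; right.
have ZS w : Z w -> S (w *+ p).
  move=> [_ [->|Xw|[j [m _ ->]]]]; first exact: rpred0.
    by apply: mem_gen; left.
  by apply: spanS; exact: (in_spanb j m%:Z).
have [X [XZ dX Xgen]] := maximal_digit_free p_pr (gS := gen (X' `|` in_span))
  (fun x => iff_refl _) ZS.
have subXX : gen (X `|` S) `<=` gen ((X `|` X') `|` in_span).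
  move=> x; apply: (gen_sub (S := gen ((X `|` X') `|` in_span))) => y [Xy|].
    by apply: mem_gen; left; left.
  apply: gen_mono => z [Xz|Fz]; [by left; right|by right].
have dX1 x : X x -> ~ S x.
  move=> Xx Sx; have : 1%N = 0%N :> nat; last by [].
  apply: (dX [:: x] (fun=> 1%N) _ _ _ _ x (mem_head _ _)) => //.
  - by move=> y; rewrite mem_seq1 => /eqP->.
  - by move=> y _; apply: prime_gt1.
  - by rewrite big_seq1.
exists (X `|` X'); split.
- move=> x [/XZ[]//|/(layer_height lX')]; apply: divides_mulr.
  by rewrite expnS dvdn_mull.
- move=> x [/XZ[_ [xp|/(layer_hull lX')[k Fxk]|[j [m _ xp]]]]|/(layer_hull lX')//].
  + by exists 1%N; rewrite expn1 xp; apply: in_span0.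
  + by exists k.+1; rewrite expnS mulrnA.
  + by exists 1%N; rewrite expn1 xp; exact: (in_spanb j m%:Z).
- move=> x [/XZ[_ [xp|Xp|jm]]|/(layer_chain lX')[xp|Xp|jm]].
  1-6: by first [apply: Or31; exact: xp|apply: Or32; right; exact: Xp|apply: Or33; exact: jm].
- move=> s a us sX ap [u sE].
  pose s1 := [seq x <- s | `[< X x >]]; pose s2 := [seq x <- s | ~~ `[< X x >]].
  have s2X' x : x \in s2 -> X' x.
    by rewrite mem_filter => /andP[/asboolP nXx /sX[]].
  have sumE : \sum_(x <- s) x *+ a x = \sum_(x <- s1) x *+ a x + \sum_(x <- s2) x *+ a x.
    by rewrite !big_filter [LHS](bigID (fun x => `[< X x >])).
  have s1S : S (\sum_(x <- s1) x *+ a x).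
    rewrite -[X in S X](addrK (\sum_(x <- s2) x *+ a x)) -sumE sE.
    apply: rpredB; first by apply: spanS; exists u.
    rewrite big_seq rpred_sum // => x /s2X' Xx; rewrite rpredMn //.
    by apply: mem_gen; left.
  have a1 x : x \in s1 -> a x = 0%N.
    apply: (dX s1 a _ _ _ s1S); rewrite ?filter_uniq // => y; rewrite mem_filter.
      by move=> /andP[/asboolP].
    by move=> /andP[_]; apply: ap.
  have a2 x : x \in s2 -> a x = 0%N.
    apply: (layer_free lX') => //; first by rewrite filter_uniq.
      by move=> y; rewrite mem_filter => /andP[_]; apply: ap.
    exists u; rewrite -sE sumE; have -> : \sum_(x <- s1) x *+ a x = 0.
      by rewrite big_seq big1 // => y ys; rewrite a1.
    by rewrite add0r.
  move=> x xs; have [Xx|nXx] := pselect (X x).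
    by apply: a1; rewrite mem_filter xs andbT; apply/asboolP.
  by apply: a2; rewrite mem_filter xs andbT; apply/asboolPn.
- have liftS y : S y -> exists w f, [/\ w \in gen Z, divides (p ^ al) w,
      in_span f & y = w *+ p + f].
    pose T : {pred G} := fun y => `[< exists w f, [/\ w \in gen Z,
      divides (p ^ al) w, in_span f & y = w *+ p + f] >].
    suff : y \in gen (X' `|` in_span) -> y \in T by move=> yT /yT/asboolP.
    move=> /genP; apply.
      split=> [|y1 y2 /asboolP[w1 [f1 [w1Z dw1 Ff1 ->]]]].
        apply/asboolP; exists 0, 0; split; rewrite ?rpred0 ?mul0rn ?addr0 //.
          exact: divides0.
        exact: in_span0.
      move=> /asboolP[w2 [f2 [w2Z dw2 Ff2 ->]]]; apply/asboolP.
      exists (w1 - w2), (f1 - f2); split; [exact: rpredB|exact: dividesB| |].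
        exact: in_spanB.
      by rewrite mulrnBl opprD addrACA.
    move=> x [Xx|Fx]; apply/asboolP; last first.
      by exists 0, x; split; rewrite ?rpred0 ?mul0rn ?add0r //; exact: divides0.
    have [v vE] := layer_height lX' Xx; have vp : v *+ (p ^ al) *+ p = x.
      by rewrite vE expnSr mulrnA.
    exists (v *+ (p ^ al)), 0; split; rewrite ?addr0 ?vp //; last exact: in_span0.
      by apply: mem_gen; split; [exists v|apply: Or32; rewrite vp].
    by exists v.
  move=> x [k Fxk] dx.
  have Sxp : S (x *+ p).
    apply: (layer_gen lX').
      by exists k; rewrite mulrnAC; apply: in_spanMn.
    by have [y ->] := dx; exists y; rewrite expnSr mulrnA.
  have [w [f [wZ dw [u fE] xpE]]] := liftS _ Sxp.
  have df : divides (p ^ (al + 1)) (lincomb b u).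
    have [y yE] := dividesB dx dw; exists y.
    by rewrite addn1 expnSr mulrnA -yE mulrnBl xpE addrC addKr.
  have [v [dv vE]] := divide_terms df; rewrite expn1 in vE.
  have vZ j : v j \in gen Z.
    case E : (coeff j u) (vE j) => [[|m]|m] vj.
    - by apply: mem_gen; split=> //; apply: Or31; rewrite vj mulr0z.
    - by apply: mem_gen; split=> //; apply: Or33; exists j, m.+1.
    - rewrite -rpredN; apply: mem_gen; split; first exact: dividesN.
      by apply: Or33; exists j, m.+1 => //; rewrite mulNrn vj NegzE mulrNz opprK.
  pose x2 := x - w - \sum_(j <- dom u) v j.
  have x2Z : x2 \in gen Z.
    apply: mem_gen; split.
      apply: dividesB; first exact: dividesB.
      by apply: divides_sum => j _; apply: dv.
    apply: Or31; rewrite /x2 !mulrnBl xpE [w *+ p + f]addrC addrK fE lincombE.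
    by rewrite -sumrMnl (eq_bigr _ (fun j _ => vE j)) subrr.
  have -> : x = x2 + (\sum_(j <- dom u) v j + w).
    by rewrite /x2 addrA subrK subrK.
  apply: subXX; apply: (gen_sub (A := Z)); first exact: Xgen.
  apply: rpredD => //; apply: rpredD => //.
  by apply: rpred_sum => j _; apply: vZ.
Qed.

Lemma bottom_layer : exists X, layer 0 X.
Proof.
suff : forall k, exists X, layer (n - k) X by move=> /(_ n); rewrite subnn.
elim=> [|k [X lX]]; first by rewrite subn0; apply: top_layer.
have [nk|nk] := leqP n k.
  by exists X; rewrite subnS; move: lX; have /eqP -> : (n - k == 0)%N by [].
by apply: (@next_layer _ X); rewrite subnSK.
Qed.
End Layers.

(** * Groups with a decomposition basis are simply presented *)

Lemma zmod_iso_of_bij (P G : zmodType) (f : {additive P -> G}) :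
  injective f -> (forall g, exists t, f t = g) -> zmod_iso G P.
Proof.
move=> f_inj /choice[h hK].
have h_add : zmod_morphism h.
  by move=> x y; apply: f_inj; rewrite raddfB !hK.
pose H : {additive G -> P} := HB.pack_for {additive G -> P} h
  (GRing.isZmodMorphism.Build G P h h_add).
by exists H; exists f => t; [apply: hK|apply: f_inj; apply: hK].
Qed.

Section Presentation.
Variables (G : zmodType) (J : choiceType) (b : J -> G) (X : nat -> set G).
Hypothesis dbb : decomposition_basis b.
Hypothesis layX : forall p, prime p -> layer b p 0 (X p).

Local Notation span := (in_span b).

Lemma layer_notin p x : prime p -> X p x -> ~ span x.
Proof.
move=> p_pr Xx Fx; have : 1%N = 0%N :> nat; last by [].
apply: (layer_free (layX p_pr) (s := [:: x]) (a := fun=> 1%N) _ _ _ _ (mem_head x _)) => //.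
- by move=> y; rewrite mem_seq1 => /eqP->.
- by move=> y _; apply: prime_gt1.
- by rewrite big_seq1.
Qed.

Definition is_generator (x : G) : Prop :=
  (exists2 p, prime p & X p x) \/ (exists j, exists2 m, (0 < m)%N & x = b j *+ m).

Definition generator := {x : G | `[< is_generator x >]}.
HB.instance Definition _ := Choice.on generator.

Definition gval (x : generator) : G := val x.

Lemma gvalP (x : generator) : is_generator (gval x).
Proof. exact/asboolP/(valP x). Qed.

Lemma gval_inj : injective gval.
Proof. exact: val_inj. Qed.

Lemma generator_ex x : is_generator x -> exists g, gval g = x.
Proof. by move=> /asboolP gx; exists (exist _ x gx). Qed.

Definition relators : set {freeg generator} :=
  [set r | simple_relation r /\ lincomb gval r = 0].

Local Notation P := (presented relators).

Definition pgen (x : generator) : P := pres relators (free_gen x).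

Lemma pgen_mul p x y : prime p -> gval x *+ p = gval y -> pgen x *+ p = pgen y.
Proof.
move=> p_pr xy; apply/eqP; rewrite -subr_eq0 -raddfMn -raddfB pres_eq0.
apply: mem_gen; split; first by exists p => //; left; exists x, y.
by rewrite raddfB raddfMn /= /free_gen !lincombU !mulr1z xy subrr.
Qed.

Lemma pgen_tors p x : prime p -> gval x *+ p = 0 -> pgen x *+ p = 0.
Proof.
move=> p_pr x0; apply/eqP; rewrite -raddfMn pres_eq0.
apply: mem_gen; split; first by exists p => //; right; exists x.
by rewrite raddfMn /= /free_gen !lincombU !mulr1z x0.
Qed.

Definition evalP : P -> G :=
  pres_lift (h := lincomb gval) (fun r (Rr : relators r) => Rr.2).
HB.instance Definition _ := GRing.Additive.on evalP.

Lemma evalP_pgen x : evalP (pgen x) = gval x.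
Proof. by rewrite /evalP /pgen pres_liftE /= /free_gen lincombU mulr1z. Qed.

Lemma basis_generator j : is_generator (b j).
Proof. by right; exists j, 1%N. Qed.

Definition bgen (j : J) : generator :=
  exist _ (b j) (asboolT (basis_generator j)).

Lemma pgen_multiple j m x : (0 < m)%N -> gval x = b j *+ m ->
  pgen x = pgen (bgen j) *+ m.
Proof.
have [k] := ubnP m; elim: k m x => // k IH m x; rewrite ltnS => mk m0 xE.
have [m1|m1] := leqP m 1.
  have -> : m = 1%N by apply/eqP; rewrite eqn_leq m1 m0.
  congr (pgen _); apply: gval_inj; rewrite xE.
  by have -> : m = 1%N by apply/eqP; rewrite eqn_leq m1 m0.
have p_pr := pdiv_prime m1; set p := pdiv m in p_pr.
have mE : (m = m %/ p * p)%N by rewrite divnK // pdiv_dvd.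
have m'0 : (0 < m %/ p)%N by rewrite divn_gt0 ?pdiv_gt0 // dvdn_leq ?pdiv_dvd.
have [y yE] : exists y, gval y = b j *+ (m %/ p).
  by apply: generator_ex; right; exists j, (m %/ p)%N.
rewrite -(pgen_mul (x := y) p_pr); last by rewrite yE xE -mulrnA -mE.
rewrite (IH (m %/ p)%N) //; first by rewrite -mulrnA -mE.
by rewrite (leq_trans _ mk) // ltn_Pdiv ?prime_gt1.
Qed.

Lemma generator_prime_ex (x : generator) : exists p,
  (exists j, exists2 m, (0 < m)%N & gval x = b j *+ m) \/ (prime p /\ X p (gval x)).
Proof.
by case: (gvalP x) => [[p p_pr Xx]|bx]; [exists p; right|exists 0%N; left].
Qed.

Definition spanP : {freeg J} -> P := lincomb (pgen \o bgen).
HB.instance Definition _ := GRing.Additive.on spanP.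

(** The function [pr] chooses the prime that a generator belongs to. *)
Definition digit_form (pr : generator -> nat) (t : P) : Prop :=
  exists (s : seq generator) (a : generator -> nat) (v : {freeg J}),
    [/\ uniq s, forall x, x \in s -> [/\ prime (pr x), X (pr x) (gval x) & (a x < pr x)%N]
      & t = \sum_(x <- s) pgen x *+ a x + spanP v].

Section NormalForm.
Variable pr : generator -> nat.
Hypothesis prP : forall x, (exists j, exists2 m, (0 < m)%N & gval x = b j *+ m) \/
  (prime (pr x) /\ X (pr x) (gval x)).

Local Notation N := (digit_form pr).

Lemma digit_form_span t v : N t -> N (t + spanP v).
Proof.
move=> [s [a [w [us sP ->]]]]; exists s, a, (w + v); split=> //.
by rewrite raddfD addrA.
Qed.

Lemma digit_form_basis t j m : N t ->
  N (t + pgen (bgen j) *+ m) /\ N (t - pgen (bgen j) *+ m).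
Proof.
move=> Nt; have -> : pgen (bgen j) *+ m = spanP << m%:Z *g j >>.
  by rewrite /spanP lincombU.
by split; [|rewrite -raddfN]; apply: digit_form_span.
Qed.

Lemma digit_form_split t x : prime (pr x) -> X (pr x) (gval x) -> N t ->
  exists t0 d, [/\ (d < pr x)%N, t = t0 + pgen x *+ d &
    forall d', (d' < pr x)%N -> N (t0 + pgen x *+ d')].
Proof.
move=> p_pr Xx [s [a [v [us sP tE]]]].
exists (\sum_(y <- rem x s) pgen y *+ a y + spanP v), (if x \in s then a x else 0%N).
split.
- by case: ifP => [/sP[]//|_]; apply: prime_gt0.
- rewrite tE addrAC; congr (_ + _); case: ifP => xs.
    by rewrite (perm_big _ (perm_to_rem xs)) big_cons addrC.
  by rewrite mulr0n addr0 rem_id ?xs.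
- move=> d' d'p; exists (x :: rem x s), (fun y => if y == x then d' else a y), v.
  have nx y : y \in rem x s -> (y == x) = false.
    by rewrite mem_rem_uniq // => /andP[/negbTE].
  split.
  + by rewrite /= rem_uniq // mem_rem_uniqF.
  + move=> y; rewrite in_cons; case: eqVneq => [->//|_ /=].
    by move=> /mem_rem /sP.
  + rewrite big_cons eqxx addrC addrA; congr (_ + _ + _).
    by apply: eq_big_seq => y /nx ->.
Qed.

(** Adding a generator to a digit expansion may produce a carry, which the simple
    relation of this generator turns into a generator that needs fewer
    multiplications by [p] to reach the span, or into an element of the span. *)
Lemma digit_form_pgen t x : N t -> N (t + pgen x) /\ N (t - pgen x).
Proof.
have basis_case j m y u : (0 < m)%N -> gval y = b j *+ m -> N u ->
    N (u + pgen y) /\ N (u - pgen y).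
  by move=> m0 yE; rewrite (pgen_multiple m0 yE); apply: digit_form_basis.
case: (prP x) => [[j [m m0 xE]]|[p_pr Xx]]; first exact: basis_case xE.
have [k Fk] := layer_hull (layX p_pr) Xx.
elim: k x t p_pr Xx Fk => [|k IH] x t p_pr Xx Fk Nt.
  by case: (layer_notin p_pr Xx); rewrite expn0 in Fk.
set p := pr x in p_pr Xx Fk.
have [t0 [d [dp tE t0N]]] := digit_form_split p_pr Xx Nt.
have carry u : N u -> N (u + pgen x *+ p) /\ N (u - pgen x *+ p).
  move=> Nu; case: (layer_chain (layX p_pr) Xx) => [xp|Xxp|[j [m m0 xp]]].
  - by rewrite pgen_tors // addr0 subr0.
  - have [y yE] : exists y, gval y = gval x *+ p by apply: generator_ex; left; exists p.
    rewrite (pgen_mul p_pr (esym yE)).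
    case: (prP y) => [[j [m m0 yb]]|[q_pr Xy]]; first exact: basis_case yb Nu.
    apply: IH => //; have [l Fl] := layer_hull (layX q_pr) Xy.
    have [->|qp] := eqVneq (pr y) p; first by rewrite yE -mulrnA -expnS.
    (* an element of two different hulls lies in the span *)
    case: (layer_notin q_pr Xy); apply/span_predP.
    apply: (coprime_mem (a := pr y ^ l) (b := p ^ k)); last 2 first.
    + exact/span_predP.
    + by apply/span_predP; rewrite yE -mulrnA -expnS.
    + by rewrite coprimeXl // coprimeXr // prime_coprime // dvdn_prime2.
  - have [y yE] : exists y, gval y = b j *+ m by apply: generator_ex; right; exists j, m.
    rewrite (pgen_mul (y := y) p_pr) ?yE //.
    exact: basis_case yE Nu.
have t0N0 : N t0 by rewrite -[t0]addr0 -(mulr0n (pgen x)); apply/t0N/prime_gt0.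
split.
- have -> : t + pgen x = t0 + pgen x *+ d.+1 by rewrite tE mulrSr addrA.
  have [dp1|dp1] := ltnP d.+1 p; first exact: t0N.
  have -> : d.+1 = p by apply/eqP; rewrite eqn_leq dp dp1.
  exact: (carry t0 t0N0).1.
- rewrite tE; case: d dp {tE} => [|d] dp.
    have -> : t0 + pgen x *+ 0 - pgen x = t0 + pgen x *+ p.-1 - pgen x *+ p.
      rewrite mulr0n addr0 -{2}(prednK (prime_gt0 p_pr)) mulrSr opprD addrA.
      by rewrite addrK.
    by apply: (carry _ _).2; apply: t0N; rewrite prednK ?prime_gt0.
  by rewrite mulrSr addrA addrK; apply: t0N; apply: ltnW.
Qed.

Lemma digit_form_all t : N t.
Proof.
have [u ->] := pres_surj t; rewrite -(freeg_sumE u) raddf_sum.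
elim: (dom u) => [|x s IH].
  by rewrite big_nil; exists [::], (fun=> 0%N), 0; rewrite big_nil raddf0 addr0.
rewrite big_cons addrC /=; have -> : pres relators << coeff x u *g x >> =
    pgen x *~ coeff x u.
  by rewrite -(raddfMz (pres relators)) freegU_mulz intz.
have multN (m : nat) r : N r -> N (r + pgen x *+ m) /\ N (r - pgen x *+ m).
  elim: m r => [|m IHm] r Nr; first by rewrite mulr0n addr0 subr0.
  rewrite mulrSr opprD !addrA; have [N1 N2] := IHm r Nr.
  by split; [apply: (digit_form_pgen _ N1).1|apply: (digit_form_pgen _ N2).2].
case: (coeff x u) => m; first exact: (multN m _ IH).1.
by rewrite NegzE mulrNz; apply: (multN m.+1 _ IH).2.
Qed.

(** An expansion with value zero has all its digits zero: the part that belongs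
    to one prime lies in the span, since the other parts are brought into the
    span by multipliers prime to it. *)
Lemma evalP_inj : injective evalP.
Proof.
suff ker t : evalP t = 0 -> t = 0.
  by move=> t u tu; apply/eqP; rewrite -subr_eq0 (ker (t - u)) // raddfB /= tu subrr.
have [s [a [v [us sP ->]]]] := digit_form_all t.
have evs : evalP (spanP v) = lincomb b v.
  rewrite /spanP !lincombE raddf_sum; apply: eq_bigr => j _.
  by rewrite /= raddfMz /= evalP_pgen.
rewrite raddfD /= evs raddf_sum /=.
under eq_bigr do rewrite raddfMn /= evalP_pgen.
move=> t0.
have a0 x : x \in s -> a x = 0%N.
  move=> xs; have [p_pr _ _] := sP x xs; set p := pr x in p_pr.
  pose yp := \sum_(y <- s | pr y == p) gval y *+ a y.
  have hullp : exists k, span (yp *+ (p ^ k)).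
    rewrite /yp big_seq_cond; elim/big_rec: _ => [|y z /andP[ys /eqP yp'] [k Fk]].
      by exists 0%N; rewrite mul0rn; apply: in_span0.
    have [_ Xy _] := sP y ys; rewrite yp' in Xy.
    have [l Fl] := layer_hull (layX p_pr) Xy; exists (l + k)%N.
    apply/span_predP; rewrite mulrnDl rpredD //; apply/span_predP.
      by rewrite mulrnAC expnD mulrnA; do 2! apply: in_spanMn.
    by rewrite addnC expnD mulrnA; apply: in_spanMn.
  have hullp' : exists2 q, coprime q p & span (yp *+ q).
    have -> : yp = - lincomb b v - \sum_(y <- s | pr y != p) gval y *+ a y.
      have := t0; rewrite (bigID (fun y => pr y == p)) /= -/yp -addrA => /eqP.
      by rewrite addr_eq0 => /eqP ->; rewrite opprD addrC.
    suff [q qp Fq] : exists2 q, coprime q p &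
        span ((\sum_(y <- s | pr y != p) gval y *+ a y) *+ q).
      exists q => //; rewrite mulrnBl; apply: in_spanB => //.
      by apply: in_spanMn; exists (- v); rewrite raddfN.
    rewrite big_seq_cond; elim/big_rec: _ => [|y z /andP[ys yp'] [q qp Fq]].
      by exists 1%N; rewrite ?coprime1n // mul0rn; apply: in_span0.
    have [q_pr Xy _] := sP y ys.
    have [l Fl] := layer_hull (layX q_pr) Xy; exists (pr y ^ l * q)%N.
      by rewrite coprimeMl qp andbT coprimeXl // prime_coprime // dvdn_prime2.
    apply/span_predP; rewrite mulrnDl rpredD //; apply/span_predP.
      by rewrite mulrnAC mulrnA; do 2! apply: in_spanMn.
    by rewrite mulnC mulrnA; apply: in_spanMn.
  have Fyp : span yp.
    have [k Fk] := hullp; have [q qp Fq] := hullp'.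
    apply/span_predP; apply: (coprime_mem (a := q) (b := p ^ k)).
    - by rewrite coprimeXr.
    - exact/span_predP.
    - exact/span_predP.
  pose s' := [seq gval y | y <- s & pr y == p].
  pose a' g := if insub g is Some y then a (y : generator) else 0%N.
  have a'E y : a' (gval y) = a y by rewrite /a' /gval valK.
  rewrite -a'E; apply: (layer_free (layX p_pr) (s := s')).
  - by rewrite map_inj_uniq ?filter_uniq //; apply: gval_inj.
  - move=> _ /mapP[y + ->]; rewrite mem_filter => /andP[/eqP yp' /sP[_ + _]].
    by rewrite yp'.
  - move=> _ /mapP[y + ->]; rewrite mem_filter a'E => /andP[/eqP yp' /sP[_ _]].
    by rewrite yp'.
  - rewrite big_map big_filter; move: Fyp; congr (span _).
    by apply: eq_bigr => y _; rewrite a'E.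
  - by apply: map_f; rewrite mem_filter eqxx.
have s0 (Q : zmodType) (F : generator -> Q) : \sum_(x <- s) F x *+ a x = 0.
  by rewrite big_seq big1 // => x /a0 ->.
by move: t0; rewrite s0 add0r => /(dbasis_free dbb) ->; rewrite s0 add0r raddf0.
Qed.

End NormalForm.

(** An element with a multiple in the span is a combination of elements of the
    hulls for the primes that divide the multiplier. *)
Lemma evalP_surj g : exists t, evalP t = g.
Proof.
pose im : {pred G} := fun g => `[< exists t, evalP t = g >].
have im_closed : zmod_closed im.
  split=> [|x y /asboolP[t <-] /asboolP[u <-]]; apply/asboolP.
    by exists 0; rewrite raddf0.
  by exists (t - u); rewrite raddfB.
pose I : zmodClosed G := HB.pack_for (zmodClosed G) im
  (GRing.isZmodClosed.Build G im im_closed).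
have im_gen x : is_generator x -> x \in I.
  by move=> /generator_ex[y <-]; apply/asboolP; exists (pgen y); apply: evalP_pgen.
have im_span x : span x -> x \in I.
  move=> [u ->]; rewrite lincombE; apply: rpred_sum => j _.
  by apply: rpredMz; apply: im_gen; apply: basis_generator.
have im_hull p x : prime p -> in_hull b p x -> x \in I.
  move=> p_pr Bx.
  have : x \in gen (X p `|` span).
    by apply: (layer_gen (layX p_pr)) => //; exists x; rewrite mulr1n.
  apply: gen_sub => y [Xy|]; last exact: im_span.
  by apply: im_gen; left; exists p.
suff /asboolP : g \in I by [].
have [n n0 Fg] := dbasis_torsion dbb g.
elim/ltn_ind: n g n0 Fg => n IH g n0 Fg.
have [n1|n1] := leqP n 1.
  by apply: im_span; move: Fg; have -> : n = 1%N by apply/eqP; rewrite eqn_leq n1 n0.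
have p_pr := pdiv_prime n1; set p := pdiv n in p_pr.
have [m pm nE] := pfactor_coprime p_pr n0; set a := logn p n in nE.
have a0 : (0 < a)%N by rewrite logn_gt0 mem_primes p_pr n0 pdiv_dvd.
have m0 : (0 < m)%N by move: n0; rewrite {1}nE muln_gt0 => /andP[].
apply: (coprime_mem (a := p ^ a) (b := m)).
- by rewrite coprimeXl.
- apply: (IH m) => //; last by rewrite -mulrnA mulnC -nE.
  by rewrite [X in (_ < X)%N]nE ltn_Pmulr // -(expn0 p) ltn_exp2l ?prime_gt1.
- by apply: (im_hull p) => //; exists a; rewrite -mulrnA -nE.
Qed.

Lemma presented_iso : zmod_iso G P.
Proof.
have /choice[pr prP] := generator_prime_ex.
exact: zmod_iso_of_bij (evalP_inj prP) evalP_surj.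
Qed.

End Presentation.

Theorem decomposition_basis_simply_presented (G : zmodType) (J : choiceType) (b : J -> G) :
  bounded_p_torsion G -> decomposition_basis b -> simply_presented G.
Proof.
move=> bG dbb.
have /choice[X layX] p : exists X, prime p -> layer b p 0 X.
  have [p_pr|np] := pselect (prime p); last by exists set0.
  have [n nP] := bG p p_pr.
  have [|X lX] := bottom_layer (n := n) p_pr dbb; last by exists X.
  by move=> x k xk; apply: nP; exists k.
exists (generator b X : choiceType), (relators (b := b) (X := X)); split; first by move=> r [].
exact: presented_iso.
Qed.

(** * Torsion-free rank at most one *)

Section Rank.
Variable A : zmodType.

Lemma pureMzl (a : A) n q : pure (a *~ n) q = pure a (n%:~R * q).
Proof.
pose f a := pure (A := A) a q.
have fB : zmod_morphism f.
  by move=> x y; rewrite /f -[x in RHS](subrK y) [in RHS]pureDl addrK.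
pose F : {additive A -> tensorQ A} := HB.pack_for {additive A -> tensorQ A} f
  (GRing.isZmodMorphism.Build A (tensorQ A) f fB).
pose g q := pure a q.
have gB : zmod_morphism g.
  by move=> x y; rewrite /g -[x in RHS](subrK y) [in RHS]pureDr addrK.
pose H : {additive rat -> tensorQ A} := HB.pack_for {additive rat -> tensorQ A} g
  (GRing.isZmodMorphism.Build rat (tensorQ A) g gB).
by rewrite -[LHS]/(F (a *~ n)) -[RHS]/(H (n%:~R * q)) mulrzl !raddfMz.
Qed.

Lemma pureBl (a b : A) q : pure (a - b) q = pure a q - pure b q.
Proof. by rewrite -[a in RHS](subrK b) [in RHS]pureDl addrK. Qed.

Lemma pure_scale (a : A) c q : c *: pure a q = pure a (c * q).
Proof. exact: scaleQ_pure. Qed.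

Lemma tensorQ_ind (S : {pred tensorQ A}) : zmod_closed S ->
  (forall a q, pure a q \in S) -> forall t, t \in S.
Proof.
move=> [S0 SB] Sp t; have [u ->] := pres_surj t.
pose I : zmodClosed _ := HB.pack_for (zmodClosed (tensorQ A)) S
  (GRing.isZmodClosed.Build (tensorQ A) S (conj S0 SB)).
have -> : S = I by [].
rewrite -(freeg_sumE u) raddf_sum; apply: rpred_sum => -[a q] _.
have -> : << coeff (a, q) u *g (a, q) >> = pure_gen a q *~ coeff (a, q) u.
  by rewrite /pure_gen /free_gen freegU_mulz intz.
by rewrite raddfMz rpredMz //; apply: Sp.
Qed.

Lemma has_dim_le1 (W : lmodType rat) (w : W) :
  (forall v, exists c, v = c *: w) -> exists2 n, (n <= 1)%N & has_dim W n.
Proof.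
move=> Ww; have [w0|w0] := eqVneq w 0.
  exists 0%N => //; exists (fun=> 0) => v; exists [ffun=> 0]; split.
    by rewrite big_ord0; have [c ->] := Ww v; rewrite w0 scaler0.
  by move=> c _; apply/ffunP => -[].
exists 1%N => //; exists (fun=> w) => v; have [c ->] := Ww v.
exists [ffun=> c]; split; first by rewrite big_ord1 ffunE.
move=> d; rewrite big_ord1 => /eqP; rewrite -subr_eq0 -scalerBl scaler_eq0.
rewrite (negbTE w0) orbF subr_eq0 => /eqP cd; apply/ffunP => i.
by rewrite ffunE cd; congr (d _); apply: val_inj; case: i => -[].
Qed.

Lemma rank_le1_commensurable (a0 : A) :
  (forall a, exists m n, (0 < m)%N /\ a *+ m = a0 *~ n) ->
  exists2 n, (n <= 1)%N & torsion_free_rank A n.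
Proof.
move=> comm; apply: (@has_dim_le1 (tensorQ A) (pure a0 1)) => t.
pose S : {pred tensorQ A} := fun t => `[< exists c, t = c *: pure a0 1 >].
suff /asboolP : t \in S by [].
apply: tensorQ_ind => [|a q].
  split=> [|_ _ /asboolP[c ->] /asboolP[d ->]]; apply/asboolP.
    by exists 0; rewrite scale0r.
  by exists (c - d); rewrite scalerBl.
have [m [n [m0 mn]]] := comm a; apply/asboolP; exists (n%:~R * (q / m%:R)).
have m0' : m%:R != 0 :> rat by rewrite pnatr_eq0 -lt0n.
have -> : pure a q = pure (a *~ m) (q / m%:R) by rewrite pureMzl mulrC divfK.
by rewrite -pmulrn mn pureMzl pure_scale mulr1.
Qed.

(** Clearing denominators by a multiple of all of them evaluates an element of
    the tensor product in [A], up to torsion. *)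
Definition clear_denominators (M : nat) : {freeg (A * rat)%type} -> A :=
  lincomb (fun x : A * rat => x.1 *~ numq (M%:R * x.2)).

Lemma numq_clear (M : nat) q : (`|denq q| %| M)%N ->
  (numq (M%:R * q))%:~R = M%:R * q.
Proof.
move=> /dvdnP[k ->]; have -> : (k * `|denq q|)%N%:R * q = (k%:Z * numq q)%:~R.
  rewrite natrM -mulrA intrM; congr (_ * _).
  rewrite -{2}(divq_num_den q) mulrC pmulrn gez0_abs ?denq_ge0 //.
  by rewrite divfK // intr_eq0 denq_neq0.
by rewrite numq_int.
Qed.

(** A relation that holds in the tensor product involves finitely many
    denominators; multiplied by all of them it holds in [A]. *)
Lemma pure_eq0_torsion (a : A) : pure a 1 = 0 -> exists2 n, (0 < n)%N & a *+ n = 0.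
Proof.
move=> /eqP; rewrite pres_eq0 => /genP genA.
pose S : {pred {freeg (A * rat)%type}} := fun u => `[< exists2 N, (0 < N)%N &
  forall M, (0 < M)%N -> (N %| M)%N -> clear_denominators M u = 0 >].
have /asboolP[N N0 /(_ N N0 (dvdnn N))] : pure_gen a 1 \in S; first apply: genA.
- split=> [|u v /asboolP[N N0 uN] /asboolP[K K0 vK]]; apply/asboolP.
    by exists 1%N => // M _ _; rewrite /clear_denominators raddf0.
  exists (N * K)%N => [|M M0 NKM]; first by rewrite muln_gt0 N0.
  rewrite /clear_denominators raddfB /=.
  rewrite [X in X - _]uN ?(dvdn_trans (dvdn_mulr _ _) NKM) //.
  by rewrite [X in _ - X]vK ?(dvdn_trans (dvdn_mull _ _) NKM) // subrr.
- move=> r [b c q|b q q'] ; apply/asboolP.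
    exists 1%N => // M _ _; rewrite /clear_denominators !raddfB /=.
    by rewrite /pure_gen /free_gen !lincombU !mulr1z /= mulrzDl addrAC addrK subrr.
  exists (`|denq q| * `|denq q'| * `|denq (q + q')|)%N => [|M M0 dM].
    by rewrite !muln_gt0 !absz_gt0 !denq_neq0.
  rewrite /clear_denominators !raddfB /= /pure_gen /free_gen !lincombU !mulr1z /=.
  suff -> : numq (M%:R * (q + q')) = numq (M%:R * q) + numq (M%:R * q').
    by rewrite mulrzDr addrAC addrK subrr.
  apply: (@intr_inj rat); rewrite intrD !numq_clear ?mulrDr //.
  - by apply: dvdn_trans dM; rewrite mulnAC dvdn_mull.
  - by apply: dvdn_trans dM; rewrite -mulnA dvdn_mulr.
  - by apply: dvdn_trans dM; rewrite dvdn_mull.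
- rewrite /clear_denominators /pure_gen /free_gen lincombU mulr1z /= mulr1.
  have -> : numq N%:R = N by rewrite -[N%:R]/(N%:~R) numq_int.
  by exists N.
Qed.

Lemma rank_le1_dependent n : (n <= 1)%N -> torsion_free_rank A n ->
  forall a b : A, exists m k : int, (m != 0) || (k != 0) /\ a *~ m = b *~ k.
Proof.
move=> n1 [e eP] a b.
have [c [d [cd0 cdE]]] : exists c d : rat, (c != 0) || (d != 0) /\
    c *: pure a 1 = d *: pure b 1.
  have [w wP] : exists w : tensorQ A, forall v, exists c, v = c *: w.
    case: n n1 e eP => [|[|//]] _ e eP.
      exists 0 => v; exists 0; have [c [-> _]] := eP v.
      by rewrite big_ord0 scaler0.
    exists (e ord0) => v; have [c [-> _]] := eP v; exists (c ord0).
    by rewrite big_ord1.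
  have [c cE] := wP (pure a 1); have [d dE] := wP (pure b 1).
  have [d0|d0] := eqVneq d 0.
    by exists 0, 1; rewrite oner_eq0 orbT dE d0 !scale0r scaler0.
  by exists d, c; rewrite d0 cE dE !scalerA mulrC.
pose m := numq c * denq d; pose k := numq d * denq c.
have mE : m%:~R = (denq c * denq d)%:~R * c.
  rewrite -{2}(divq_num_den c) !intrM mulrAC [X in _ = X * _]mulrC divfK 1?mulrC //.
  by rewrite intr_eq0 denq_neq0.
have kE : k%:~R = (denq c * denq d)%:~R * d.
  rewrite -{2}(divq_num_den d) !intrM -mulrA [X in _ = _ * X]mulrC divfK 1?mulrC //.
  by rewrite intr_eq0 denq_neq0.
have /pure_eq0_torsion[N N0 tors] : pure (a *~ m - b *~ k) 1 = 0.
  apply/eqP; rewrite pureBl subr_eq0 !pureMzl -!pure_scale mE kE.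
  by rewrite -![(_ * _) *: _]scalerA cdE.
exists (m * N), (k * N); split.
  rewrite !mulf_eq0 !numq_eq0 !(negbTE (denq_neq0 _)) !orbF.
  by rewrite -[N%:Z == 0]/(N == 0%N) eqn0Ngt N0 !orbF.
by apply/eqP; rewrite -subr_eq0 (mulrzA a m) (mulrzA b k) -mulrzBl -pmulrn tors.
Qed.

End Rank.

(** * Simply presented groups are direct sums of groups of rank at most one *)

Section Components.
Variables (X : choiceType) (R : set {freeg X}).
Hypothesis simpleR : forall r, R r -> simple_relation r.

Local Notation P := (presented R).

Definition pelt (x : X) : P := pres R (free_gen x).

(** Generators linked by relations are commensurable, so the commensurability
    classes of generators cut the presentation into independent pieces. *)
Definition commensurable (x y : X) : Prop :=
  exists m n : nat, [/\ (0 < m)%N, (0 < n)%N & pelt x *+ m = pelt y *+ n].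

Lemma comm_refl x : commensurable x x.
Proof. by exists 1%N, 1%N. Qed.

Lemma comm_sym x y : commensurable x y -> commensurable y x.
Proof. by move=> [m [n [m0 n0 xy]]]; exists n, m. Qed.

Lemma comm_trans x y z : commensurable x y -> commensurable y z -> commensurable x z.
Proof.
move=> [m [n [m0 n0 xy]]] [k [l [k0 l0 yz]]]; exists (m * k)%N, (l * n)%N.
by rewrite !muln_gt0 m0 n0 k0 l0 mulrnA xy mulrnAC yz mulrnA.
Qed.

Lemma comp_ex x : exists y, `[< commensurable x y >].
Proof. by exists x; apply/asboolP/comm_refl. Qed.

Definition comp (x : X) : X := xchoose (comp_ex x).

Lemma comp_comm x : commensurable x (comp x).
Proof. exact/asboolP/(xchooseP (comp_ex x)). Qed.

Lemma comp_eq x y : commensurable x y -> comp x = comp y.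
Proof.
move=> xy; apply: eq_xchoose => z; apply/asboolP/asboolP; last exact: comm_trans.
by apply: comm_trans; apply: comm_sym.
Qed.

Lemma pres_relation r : R r -> pres R r = 0.
Proof. by move=> Rr; apply/eqP; rewrite pres_eq0 mem_gen. Qed.

Lemma relation_comp p x y : prime p -> R (free_gen x *+ p - free_gen y) -> comp x = comp y.
Proof.
move=> p_pr /pres_relation; rewrite raddfB raddfMn /= => /eqP.
rewrite subr_eq0 => /eqP xy; apply: comp_eq; exists p, 1%N.
by rewrite prime_gt0.
Qed.

(** The components are presented on the same generators as the whole group, by
    killing the generators of the other components. *)
Definition part_relation (i : X) : set {freeg X} :=
  R `|` [set free_gen x | x in [set x | comp x != i]].

Definition part (i : X) : zmodType := presented (part_relation i).

Fact part_proj_rel i r : R r -> pres (part_relation i) r = 0.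
Proof. by move=> Rr; apply/eqP; rewrite pres_eq0 mem_gen //; left. Qed.

Definition part_proj i : P -> part i := pres_lift (@part_proj_rel i).
HB.instance Definition _ i := GRing.Additive.on (part_proj i).

Lemma part_projE i u : part_proj i (pres R u) = pres (part_relation i) u.
Proof. exact: pres_liftE. Qed.

Definition part_gen (i x : X) : P := if comp x == i then pelt x else 0.

Fact part_inj_rel i r : part_relation i r -> lincomb (part_gen i) r = 0.
Proof.
have pgenE x : lincomb (part_gen i) (free_gen x) = part_gen i x.
  by rewrite /free_gen lincombU.
case=> [Rr|[x /= xi <-]]; last by rewrite pgenE /part_gen (negbTE xi).
have [p p_pr [[x [y rE]]|[x rE]]] := simpleR Rr; rewrite rE in Rr *.
  rewrite raddfB raddfMn /= !pgenE /part_gen -(relation_comp p_pr Rr).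
  have := pres_relation Rr; rewrite raddfB raddfMn /= => xy.
  by case: ifP => _ //; rewrite mul0rn subrr.
rewrite raddfMn /= pgenE /part_gen; case: ifP => _; last by rewrite mul0rn.
by have := pres_relation Rr; rewrite raddfMn.
Qed.

Definition part_inj i : part i -> P := pres_lift (@part_inj_rel i).
HB.instance Definition _ i := GRing.Additive.on (@part_inj i).

Lemma part_injE i x : part_inj (pres (part_relation i) (free_gen x)) = part_gen i x.
Proof. by rewrite /part_inj pres_liftE /= /free_gen lincombU. Qed.

Lemma part_killed i x : comp x != i -> pres (part_relation i) (free_gen x) = 0.
Proof. by move=> xi; apply/eqP; rewrite pres_eq0 mem_gen //; right; exists x. Qed.

Lemma part_proj0 i j (t : part i) : i != j -> part_proj j (part_inj t) = 0.
Proof.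
move=> ij.
have [z zE] : exists z : {additive part i -> part j}, forall t, z t = 0.
  have z0 : zmod_morphism (fun _ : part i => 0 : part j) by move=> u v; rewrite subr0.
  by exists (HB.pack_for {additive part i -> part j} (fun _ : part i => 0 : part j)
    (GRing.isZmodMorphism.Build (part i) (part j) (fun=> 0) z0)).
rewrite -(zE t); apply: (presented_ext (f := part_proj j \o part_inj (i := i))) => x.
rewrite zE /= part_injE /part_gen; case: eqP => [xi|_]; last by rewrite raddf0.
by rewrite part_projE part_killed // xi.
Qed.

Lemma part_injK i (t : part i) : part_proj i (part_inj t) = t.
Proof.
apply: (presented_ext (f := part_proj i \o part_inj (i := i)) (g := idfun)) => x /=.
rewrite part_injE /part_gen; case: eqP => [xi|/eqP xi]; first by rewrite part_projE.
by rewrite raddf0 part_killed.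
Qed.

Lemma part_sum u (s : seq X) : uniq s -> (forall x, x \in dom u -> comp x \in s) ->
  \sum_(i <- s) part_inj (part_proj i (pres R u)) = pres R u.
Proof.
move=> us us'; rewrite -{2}(freeg_sumE u).
under eq_bigr => i _ do rewrite -{1}(freeg_sumE u) !raddf_sum.
rewrite exchange_big raddf_sum; apply: eq_big_seq => x xu /=.
have -> : << coeff x u *g x >> = free_gen x *~ coeff x u.
  by rewrite /free_gen freegU_mulz intz.
under eq_bigr => i _ do rewrite !raddfMz /= part_projE part_injE.
rewrite raddfMz -mulrz_suml; congr (_ *~ _).
rewrite (bigD1_seq (comp x)) ?us' //= /part_gen eqxx big1 ?addr0 // => i.
by rewrite eq_sym => /negbTE ->.
Qed.

Fact parts_finite (t : P) : (fun i => part_proj i t) \in Defs.finite_support (A := part).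
Proof.
have [u ->] := pres_surj t; apply/asboolP.
apply: sub_finite_set (finite_seq [seq comp x | x <- dom u]) => i /= nz.
apply/negPn/negP => ni; apply: nz.
rewrite part_projE -(freeg_sumE u) raddf_sum big_seq big1 // => x xu.
have -> : << coeff x u *g x >> = free_gen x *~ coeff x u.
  by rewrite /free_gen freegU_mulz intz.
rewrite /= raddfMz /= part_killed ?mul0rz //.
by apply: contraNneq ni => <-; apply: map_f.
Qed.

Definition parts (t : P) : dsum part := DSum (parts_finite t).

Fact parts_is_additive : zmod_morphism parts.
Proof.
move=> t u; apply: val_inj; apply: functional_extensionality_dep => i /=.
exact: raddfB.
Qed.
HB.instance Definition _ := GRing.isZmodMorphism.Build P (dsum part) parts parts_is_additive.

Lemma parts_inj : injective parts.
Proof.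
suff ker t : (forall i, part_proj i t = 0) -> t = 0.
  move=> t u tu; apply/eqP; rewrite -subr_eq0; apply/eqP/ker => i.
  rewrite raddfB; apply/eqP; rewrite subr_eq0; apply/eqP.
  exact: (congr1 (fun v : dsum part => dsum_val v i) tu).
have [u ->] := pres_surj t => t0.
rewrite -(@part_sum u (undup [seq comp x | x <- dom u])) ?undup_uniq //.
  by rewrite big1 // => i _; rewrite t0 raddf0.
by move=> x xu; rewrite mem_undup map_f.
Qed.

Lemma parts_surj (v : dsum part) : exists t, parts t = v.
Proof.
have /asboolP/finite_seqP[s sE] := dsum_valP v.
exists (\sum_(i <- undup s) part_inj (dsum_val v i)).
apply: val_inj; apply: functional_extensionality_dep => j /=.
rewrite raddf_sum /=; have [js|js] := boolP (j \in undup s).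
  rewrite (bigD1_seq j) ?undup_uniq //= part_injK big1 ?addr0 // => i ij.
  by rewrite part_proj0.
rewrite big_seq big1 => [|i is_]; last first.
  by rewrite part_proj0 //; apply: contraNneq js => <-.
have [->//|/eqP vj] := eqVneq (dsum_val v j) 0.
have js' : [set` s] j by move: vj; rewrite -sE.
by rewrite mem_undup in js; rewrite [j \in s]js' in js.
Qed.

Lemma part_rank i : exists2 n, (n <= 1)%N & torsion_free_rank (part i) n.
Proof.
have [a0 a0P] : exists a0 : part i, forall x, exists m n, (0 < m)%N /\
    pres (part_relation i) (free_gen x) *+ m = a0 *~ n.
  have [[x0 x0i]|nx] := pselect (exists x0, comp x0 = i); last first.
    exists 0 => x; exists 1%N, 0; split=> //; rewrite part_killed ?mul0rn //.
    by apply/eqP => xi; apply: nx; exists x.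
  exists (part_proj i (pelt x0)) => x; have [xi|xi] := eqVneq (comp x) i; last first.
    by exists 1%N, 0; rewrite part_killed.
  have [m [n [m0 n0 mn]]] : commensurable x x0.
    apply: comm_trans (comp_comm x) _; rewrite xi -x0i.
    exact: comm_sym (comp_comm x0).
  exists m, n; split=> //; rewrite -part_projE -pmulrn.
  by have := congr1 (part_proj i) mn; rewrite !raddfMn.
apply: (rank_le1_commensurable (a0 := a0)) => t.
pose S : {pred part i} := fun t => `[< exists m n, (0 < m)%N /\ t *+ m = a0 *~ n >].
have SS : zmod_closed S.
  split=> [|u v /asboolP[m [n [m0 um]]] /asboolP[k [l [k0 vk]]]]; apply/asboolP.
    by exists 1%N, 0; rewrite mul0rn mulr0z.
  exists (m * k)%N, (n * k%:Z - l * m%:Z); rewrite muln_gt0 m0 k0; split=> //.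
  by rewrite mulrnBl mulrzBr !mulrzA -um -vk -!pmulrn -!mulrnA [(m * k)%N in X in _ - X]mulnC.
pose I : zmodClosed (part i) := HB.pack_for (zmodClosed (part i)) S
  (GRing.isZmodClosed.Build (part i) S SS).
suff /asboolP : t \in I by [].
have [u ->] := pres_surj t; rewrite -(freeg_sumE u) raddf_sum.
apply: rpred_sum => x _.
have -> : << coeff x u *g x >> = free_gen x *~ coeff x u.
  by rewrite /free_gen freegU_mulz intz.
have xI : pres (part_relation i) (free_gen x) \in I by apply/asboolP; apply: a0P.
by rewrite raddfMz; exact: (rpredMz _ xI).
Qed.

End Components.

Lemma zmod_iso_comp (G H K : zmodType) : zmod_iso G H -> zmod_iso H K -> zmod_iso G K.
Proof. by move=> [f f_bij] [g g_bij]; exists (g \o f); apply: bij_comp. Qed.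

Theorem simply_presented_dsum (G : zmodType) : simply_presented G -> dsum_of_rank_le1 G.
Proof.
move=> [X [R [simpleR isoG]]]; exists X, (part R); split; first exact: part_rank.
apply: zmod_iso_comp isoG _; exists (@parts _ R).
have /choice[h hK] := parts_surj simpleR.
exists h => t; last exact: hK.
by apply: (@parts_inj _ _ simpleR); rewrite hK.
Qed.

(** * Divisibility modulo excessive torsion *)

Lemma prime_power_factor (s : seq nat) (f : nat -> nat) p :
  uniq s -> (forall q, q \in s -> prime q) -> prime p ->
  exists a, coprime a p /\
    (\prod_(q <- s) q ^ f q = p ^ (if p \in s then f p else 0) * a)%N.
Proof.
move=> us sp p_pr; have cop r : (forall q, q \in r -> prime q) -> p \notin r ->
    coprime (\prod_(q <- r) q ^ f q)%N p.
  elim: r => [|q r IH] rp pr; first by rewrite big_nil coprime1n.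
  rewrite big_cons coprimeMl; move: pr; rewrite in_cons negb_or => /andP[pq pr].
  rewrite IH // => [|t tr]; last by apply: rp; rewrite in_cons tr orbT.
  have q_pr := rp q (mem_head q r).
  by rewrite andbT coprimeXl // prime_coprime // dvdn_prime2 // eq_sym.
have [ps|ps] := boolP (p \in s); last first.
  by exists (\prod_(q <- s) q ^ f q)%N; rewrite cop // expn0 mul1n.
exists (\prod_(q <- rem p s) q ^ f q)%N; split.
  by apply: cop; [move=> q /mem_rem /sp|rewrite mem_rem_uniqF].
by rewrite (perm_big _ (perm_to_rem ps)) big_cons.
Qed.

Lemma int_prime_factor (m : int) p : prime p -> m != 0 ->
  exists t (m' : int), m = (p ^ t)%N%:Z * m' /\ coprime `|m'|%N p.
Proof.
move=> p_pr m0; have am0 : (0 < `|m|)%N by rewrite absz_gt0.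
have [k pk mE] := pfactor_coprime p_pr am0.
exists (logn p `|m|%N), (sgz m * k%:Z); split.
  by rewrite {1}[m]intEsg {1}mE PoszM; ring.
by rewrite abszM absz_sg m0 mul1n coprime_sym.
Qed.

Section Retract.
Variables (G H : zmodType) (iota : {additive G -> H}) (pi : {additive H -> G}).
Hypothesis iotaK : cancel iota pi.
Variable bound : nat -> nat.
Hypothesis boundP : forall p (x : G) k, prime p ->
  x *+ (p ^ k) = 0 -> x *+ (p ^ bound p) = 0.

(** The subgroup generated by the large multiples of the primary torsion: it is
    invariant, it is killed by the retraction to [G], and modulo it [H] has
    bounded torsion too. *)
Definition excess : set H := [set h | exists p t k,
  [/\ prime p, t *+ (p ^ k) = 0 & h = t *+ (p ^ bound p)]].

Definition edivides (q : nat) (h : H) : Prop := exists y, h - y *+ q \in gen excess.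

Lemma edividesB q h k : edivides q h -> edivides q k -> edivides q (h - k).
Proof.
move=> [y hy] [z kz]; exists (y - z).
have -> : h - k - (y - z) *+ q = (h - y *+ q) - (k - z *+ q).
  rewrite mulrnBl !opprB addrACA [RHS]addrACA; congr (_ + _).
  exact: addrC.
exact: rpredB.
Qed.

Lemma edivides_of q h : edivides q (h *+ q).
Proof. by exists h; rewrite subrr rpred0. Qed.

Lemma edivides0 q : edivides q 0.
Proof. by rewrite -(mul0rn _ q); apply: edivides_of. Qed.

Definition epred (q : nat) : {pred H} := fun h => `[< edivides q h >].

Fact epred_zmod_closed q : zmod_closed (epred q).
Proof.
split=> [|x y /asboolP dx /asboolP dy]; apply/asboolP; first exact: edivides0.
exact: edividesB.
Qed.
HB.instance Definition _ q :=
  GRing.isZmodClosed.Build H (epred q) (epred_zmod_closed q).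

Lemma epredP q h : h \in epred q <-> edivides q h.
Proof. by split=> /asboolP. Qed.

Lemma edividesMz q h m : edivides q h -> edivides q (h *~ m).
Proof. by move=> /epredP dh; apply/epredP/rpredMz. Qed.

Lemma edividesMn q h m : edivides q h -> edivides q (h *+ m).
Proof. by move=> /epredP dh; apply/epredP; rewrite rpredMn. Qed.

Lemma edivides_dvdn q r h : (r %| q)%N -> edivides q h -> edivides r h.
Proof.
by move=> /dvdnP[k ->] [y hy]; exists (y *+ k); rewrite -mulrnA.
Qed.

Lemma edivides_map (f : {additive H -> H}) q h : edivides q h -> edivides q (f h).
Proof.
move=> [y hy]; exists (f y); rewrite -raddfMn -raddfB.
pose S : {pred H} := fun h => `[< f h \in gen excess >].
have SS : zmod_closed S.
  split=> [|u v /asboolP fu /asboolP fv]; apply/asboolP.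
    by rewrite raddf0 rpred0.
  by rewrite raddfB; apply: rpredB.
have /genP/(_ S SS) hS := hy.
suff /asboolP : h - y *+ q \in S by [].
apply: hS => _ [p [t [k [p_pr tk ->]]]].
apply/asboolP; rewrite raddfMn; apply: mem_gen; exists p, (f t), k; split=> //.
by rewrite -raddfMn tk raddf0.
Qed.

Lemma edivides_iota q g : edivides q (iota g) -> divides q g.
Proof.
move=> [y gy]; exists (pi y); apply/eqP; rewrite -subr_eq0 -raddfMn -{1}[g]iotaK.
rewrite -raddfB.
pose S : {pred H} := fun h => `[< pi h = 0 >].
have SS : zmod_closed S.
  split=> [|u v /asboolP u0 /asboolP v0]; apply/asboolP; first exact: raddf0.
  by rewrite raddfB u0 v0 subrr.
have /genP/(_ S SS) hS := gy.
suff /asboolP -> : iota g - y *+ q \in S by [].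
apply: hS => _ [p [t [k [p_pr tk ->]]]].
apply/asboolP; by rewrite raddfMn (boundP (k := k)) // -raddfMn tk raddf0.
Qed.

Lemma edivides_coprime q a h : coprime a q -> edivides q (h *+ a) -> edivides q h.
Proof.
move=> aq /epredP ha; apply/epredP; apply: coprime_mem aq ha _.
by apply/epredP/edivides_of.
Qed.

Lemma edivides_coprimez q (a : int) h :
  coprime `|a|%N q -> edivides q (h *~ a) -> edivides q h.
Proof.
move=> aq ha; apply: edivides_coprime aq _; case: a ha => a //.
by rewrite NegzE mulrNz => /epredP; rewrite rpredN => /epredP.
Qed.

Lemma excess_torsion h : h \in gen excess -> exists2 m, (0 < m)%N & h *+ m = 0.
Proof.
pose S : {pred H} := fun h => `[< exists2 m, (0 < m)%N & h *+ m = 0 >].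
move=> /genP/(_ S) hS; have /asboolP // : h \in S; apply: hS.
  split=> [|u v /asboolP[m m0 um] /asboolP[k k0 vk]]; apply/asboolP.
    by exists 1%N.
  exists (m * k)%N; rewrite ?muln_gt0 ?m0 //.
  by rewrite mulrnBl {1}mulrnA um mul0rn mulnC mulrnA vk mul0rn subrr.
move=> _ [p [t [k [p_pr tk ->]]]]; apply/asboolP; exists (p ^ k)%N.
  by rewrite expn_gt0 prime_gt0.
by rewrite mulrnAC tk mul0rn.
Qed.

(** A torsion element splits into a [p]-primary part, whose multiple by
    [p ^ bound p] is in the excess by definition, and a part on which [p] acts
    invertibly. *)
Lemma excess_cancel p h : prime p -> h *+ (p ^ bound p) *+ p \in gen excess ->
  h *+ (p ^ bound p) \in gen excess.
Proof.
move=> p_pr hp; have [M M0 hM] := excess_torsion hp.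
have M'0 : (0 < p ^ bound p * p * M)%N by rewrite !muln_gt0 expn_gt0 prime_gt0 ?M0.
have [m pm mE] := pfactor_coprime p_pr M'0; set a := logn _ _ in mE.
apply: (coprime_mem (a := m) (b := p)) => //; first by rewrite coprime_sym.
rewrite mulrnAC; apply: mem_gen; exists p, (h *+ m), a; split=> //.
by rewrite -mulrnA -mE !mulrnA.
Qed.

Lemma edivides_cancel p al g : prime p -> divides (p ^ bound p) g ->
  edivides (p ^ al.+1) (g *+ p) -> edivides (p ^ al) g.
Proof.
move=> p_pr [g' gE] [y gy]; have [al_le|lt_al] := leqP al (bound p).
  rewrite gE -(subnK al_le) expnD mulrnA; exact: edivides_of.
exists y; have yE : y *+ (p ^ al) = y *+ (p ^ (al - bound p)) *+ (p ^ bound p).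
  by rewrite -mulrnA -expnD subnK // ltnW.
rewrite gE yE -mulrnBl; apply: excess_cancel => //.
rewrite mulrnBl -yE -gE mulrnBl -(mulrnA y) mulnC -expnS.
exact: gy.
Qed.

Lemma edivides_cancel_exp p al t g : prime p -> divides (p ^ bound p) g ->
  edivides (p ^ (al + t)) (g *+ (p ^ t)) -> edivides (p ^ al) g.
Proof.
move=> p_pr dg; elim: t => [|t IH]; first by rewrite addn0.
rewrite addnS (expnSr p t) mulrnA => /(edivides_cancel p_pr (dividesMn _ dg)).
exact: IH.
Qed.

Definition einfinite p g : Prop := forall al, edivides (p ^ al) g.

Lemma height_ex p g : exists h, edivides (p ^ h) g /\
  (einfinite p g \/ forall al, edivides (p ^ al) g -> (al <= h)%N).
Proof.
have [inf|/existsNP[a na]] := pselect (einfinite p g).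
  by exists 0%N; split; [apply: inf|left].
have nex : exists al, ~~ (g \in epred (p ^ al)).
  by exists a; apply/negP => /epredP.
case: (ex_minnP nex) => -[|h] /negP nh hmin.
  by case: nh; apply/epredP; rewrite expn0 -[g]mulr1n; apply: edivides_of.
have dh : edivides (p ^ h) g.
  apply/epredP/negPn/negP => /hmin; by rewrite ltnn.
exists h; split=> //; right=> al dal; rewrite leqNgt; apply/negP => hal.
by apply/nh/epredP; apply: edivides_dvdn dal; apply: dvdn_exp2l.
Qed.

Variables (J : choiceType) (x : J -> H) (pr : J -> {additive H -> H}).
Hypothesis pr_x : forall j k, pr j (x k) = if j == k then x k else 0.
Hypothesis x_inf : forall j n, (0 < n)%N -> x j *+ n <> 0.
Hypothesis x_tors : forall h, exists2 n, (0 < n)%N & exists u, h *+ n = lincomb x u.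

Local Notation V := {freeg J / rat}.
Local Notation ediv := edivides.

Lemma pr_lincomb j u : pr j (lincomb x u) = x j *~ coeff j u.
Proof.
rewrite lincombE raddf_sum /=.
under eq_bigr => k _ do rewrite raddfMz /= pr_x.
have [ju|ju] := boolP (j \in dom u); last first.
  rewrite (coeff_outdom ju) mulr0z big_seq big1 // => k ku.
  have [jk|_] := eqVneq j k; last by rewrite mul0rz.
  by rewrite jk ku in ju.
rewrite (bigD1_seq j) ?uniq_dom //= eqxx big1 ?addr0 // => k.
by rewrite eq_sym => /negbTE ->; rewrite mul0rz.
Qed.

Lemma x_infz j (n : int) : x j *~ n = 0 -> n = 0.
Proof.
case: n => n; first by case: n => // n; rewrite -pmulrn => /x_inf; case.
by rewrite NegzE mulrNz => /eqP; rewrite oppr_eq0 => /eqP /x_inf; case.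
Qed.

Lemma lincomb_x_free u : lincomb x u = 0 -> u = 0.
Proof.
move=> u0; apply: int_freeg_ext => j; rewrite coeff0; apply: (@x_infz j).
by rewrite -pr_lincomb u0 raddf0.
Qed.

(** * The category of lines of a group *)

(** The integers [N] and [z] represent the rational [z / N] as a morphism from
    the line of [x k] to the line of [x i]: it does not lower the heights of the
    multiples of [N * x k].  The freedom in [N] makes the notion independent of
    the choice of [x k] among its multiples and up to torsion. *)
Definition hom_rep (k i : J) (N z : int) : Prop := forall (m : int) p al, prime p ->
  ediv (p ^ al) (x k *~ (m * N)) -> ediv (p ^ al) (x i *~ (m * z)).

Lemma hom_rep_scale k i N z K : hom_rep k i N z -> hom_rep k i (N * K) (z * K).
Proof.
move=> hNz m p al p_pr; rewrite [N * K]mulrC [z * K]mulrC !mulrA; exact: hNz.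
Qed.

Lemma hom_rep0 k i N : hom_rep k i N 0.
Proof. by move=> m p al _ _; rewrite mulr0 mulr0z; apply: edivides0. Qed.

Lemma hom_repB k i N z z' : hom_rep k i N z -> hom_rep k i N z' -> hom_rep k i N (z - z').
Proof.
move=> hz hz' m p al p_pr dN; rewrite mulrBr mulrzBr.
by apply: edividesB; [apply: hz|apply: hz'].
Qed.

Lemma hom_rep_comp k i l N z N' z' : hom_rep k i N z -> hom_rep i l N' z' ->
  hom_rep k l (N * N') (z * z').
Proof.
move=> hNz hNz' m p al p_pr dN.
rewrite mulrA; apply: hNz' => //; rewrite mulrAC; apply: hNz => //.
by rewrite -mulrA [N' * N]mulrC.
Qed.

Definition line_hom (k i : J) (c : rat) : Prop := exists N z : int,
  [/\ N != 0, N%:~R * c = z%:~R & hom_rep k i N z].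

Lemma edivides_unit p al g e (c : int) : coprime `|c|%N p ->
  ediv (p ^ al) (g *~ ((p ^ e)%N%:Z * c)) <-> ediv (p ^ al) (g *+ (p ^ e)).
Proof.
move=> cp; rewrite mulrzA -pmulrn; split; last exact: edividesMz.
by apply: edivides_coprimez; rewrite coprimeXr.
Qed.

Lemma edivides_mul q r g : ediv q g -> ediv (q * r) (g *+ r).
Proof.
by move=> [y gy]; exists y; rewrite mulrnA -mulrnBl rpredMn.
Qed.

(** The comparison of heights at the finitely many primes [s] where the two
    given morphisms are not invertible: large multiples have heights that
    increase by one with each multiplication by [p], or are infinite. *)
Lemma hom_rep_iso k i (N z N' z' : int) : N != 0 -> z != 0 -> N' != 0 -> z' != 0 ->
  hom_rep k i N z -> hom_rep i k N' z' ->
  exists a b : int, [/\ a != 0, b != 0, hom_rep k i a b & hom_rep i k b a].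
Proof.
move=> N0 z0 N'0 z'0 hNz hNz'.
pose s := primes `|(N * z * N' * z')%R|%N.
have D0 : (0 < `|(N * z * N' * z')%R|)%N by rewrite absz_gt0 !mulf_neq0.
have s_pr q : q \in s -> prime q by rewrite mem_primes => /andP[].
have us : uniq s := primes_uniq _.
have not_s p : prime p -> p \notin s -> [/\ coprime `|N|%N p, coprime `|z|%N p,
    coprime `|N'|%N p & coprime `|z'|%N p].
  move=> p_pr; rewrite mem_primes p_pr D0 /= !abszM !Euclid_dvdM // !negb_or.
  move=> /andP[/andP[/andP[pN pz] pN'] pz'].
  by split; rewrite coprime_sym prime_coprime.
pose M := (\prod_(q <- s) q ^ bound q)%N.
have sM0 (f : nat -> nat) : (0 < \prod_(q <- s) q ^ f q)%N.
  rewrite big_seq prodn_cond_gt0 // => q /s_pr q_pr.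
  by rewrite expn_gt0 prime_gt0.
have dM p (g : H) : p \in s -> divides (p ^ bound p) (g *+ M).
  move=> ps; have [a [_ ME]] := prime_power_factor bound us s_pr (s_pr p ps).
  by exists (g *+ a); rewrite /M ME ps -mulrnA mulnC.
have /choice[hk hkP] q := height_ex q (x k *+ M).
have /choice[hi hiP] q := height_ex q (x i *+ M).
pose a := (\prod_(q <- s) q ^ hi q)%N; pose b := (\prod_(q <- s) q ^ hk q)%N.
(* one direction; the other one is obtained by exchanging the roles *)
have dir k' i' (h h' : nat -> nat) (L w : int) : L != 0 -> w != 0 ->
    (forall p, prime p -> p \notin s -> coprime `|L|%N p /\ coprime `|w|%N p) ->
    hom_rep k' i' L w ->
    (forall q, ediv (q ^ h q) (x k' *+ M) /\ (einfinite q (x k' *+ M) \/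
      forall al, ediv (q ^ al) (x k' *+ M) -> (al <= h q)%N)) ->
    (forall q, ediv (q ^ h' q) (x i' *+ M)) ->
    hom_rep k' i' (M%:Z * (\prod_(q <- s) q ^ h' q)%N%:Z)
      (M%:Z * (\prod_(q <- s) q ^ h q)%N%:Z).
  move=> L0 w0 Lw hLw hP h'P m p al p_pr.
  have [->|m0] := eqVneq m 0; first by rewrite !mul0r !mulr0z.
  have [t [m' [mE m'p]]] := int_prime_factor p_pr m0.
  have [a1 [a1p a1E]] := prime_power_factor h' us s_pr p_pr.
  have [b1 [b1p b1E]] := prime_power_factor h us s_pr p_pr.
  have expand j e c : x j *~ (m * (M%:Z * (p ^ e * c)%N%:Z)) =
      x j *+ M *~ ((p ^ (t + e))%N%:Z * (m' * c%:Z)).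
    by rewrite pmulrn -mulrzA mE expnD !PoszM; congr (_ *~ _); ring.
  rewrite a1E b1E !expand !edivides_unit ?abszM ?coprimeMl ?m'p //.
  have [ps|ps] := boolP (p \in s); last first.
    have [Lp wp] := Lw p p_pr ps; rewrite !addn0 => dX.
    apply: (@edivides_coprimez _ w); first by rewrite coprimeXr.
    have swap j c : x j *+ M *+ (p ^ t) *~ c = x j *~ (M%:Z * (p ^ t)%N%:Z * c).
      by rewrite !pmulrn !mulrzA.
    by rewrite swap; apply: hLw => //; rewrite -swap; apply: edividesMz.
  have [dX dY] := (dM p (x k') ps, dM p (x i') ps).
  have [_ [inf|fin]] := hP p => dXe.
    apply: edividesMn.
    have [r [w' [wE w'p]]] := int_prime_factor p_pr w0.
    apply: (edivides_cancel_exp (t := r) p_pr dY).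
    apply/(edivides_unit _ _ _ w'p); rewrite -wE pmulrn -mulrzA; apply: hLw => //.
    by rewrite mulrzA -pmulrn; apply: edividesMz.
  have al_le : (al <= h' p + (t + h p))%N.
    have [le|lt] := leqP al (t + h' p); first by lia.
    have := dXe; rewrite -(subnK (ltnW lt)) => /(edivides_cancel_exp p_pr dX) /fin.
    lia.
  apply: (@edivides_dvdn (p ^ (h' p + (t + h p)))); first exact: dvdn_exp2l.
  by rewrite expnD; apply: edivides_mul; apply: h'P.
exists (M%:Z * a%:Z), (M%:Z * b%:Z); split.
- by rewrite mulf_neq0 // -lt0n ?sM0.
- by rewrite mulf_neq0 // -lt0n ?sM0.
- apply: (dir k i hk hi N z) => //; first by move=> p p_pr ps; have [] := not_s p p_pr ps.
  by move=> q; have [] := hiP q.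
- apply: (dir i k hi hk N' z') => //; first by move=> p p_pr ps; have [] := not_s p p_pr ps.
  by move=> q; have [] := hkP q.
Qed.

Lemma line_hom_category : line_category line_hom.
Proof.
split.
- by move=> i j; exists 1, 0; split=> //; rewrite ?mulr0 //; apply: hom_rep0.
- move=> i j c d [N [z [N0 cE hz]]] [K [w [K0 dE hw]]].
  exists (N * K), (z * K - w * N); split; first exact: mulf_neq0.
    by rewrite intrM intrB !intrM -cE -dE; ring.
  apply: hom_repB; first exact: hom_rep_scale.
  by rewrite (mulrC N); apply: hom_rep_scale.
- by move=> i; exists 1, 1; split=> //; rewrite mul1r.
- move=> i j k c d [N [z [N0 cE hz]]] [K [w [K0 dE hw]]].
  exists (N * K), (z * w); split; first exact: mulf_neq0.
    by rewrite !intrM -cE -dE mulrACA.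
  exact: hom_rep_comp hz hw.
- move=> i j c d c0 d0 [N [z [N0 cE hz]]] [K [w [K0 dE hw]]].
  have z0 : z != 0 by rewrite -(intr_eq0 rat) -cE mulf_neq0 ?intr_eq0.
  have w0 : w != 0 by rewrite -(intr_eq0 rat) -dE mulf_neq0 ?intr_eq0.
  have [a [b [a0 b0 hab hba]]] := hom_rep_iso N0 z0 K0 w0 hz hw.
  have a0' : a%:~R != 0 :> rat by rewrite intr_eq0.
  have b0' : b%:~R != 0 :> rat by rewrite intr_eq0.
  exists (b%:~R / a%:~R); first by rewrite mulf_neq0 ?invr_eq0.
  split; first by exists a, b; split=> //; rewrite mulrC divfK.
  by exists b, a; split=> //; rewrite invf_div mulrC divfK.
Qed.

(** * Rational coordinates *)

Definition ratf (u : {freeg J}) : V := lincomb (fun j => << j >> : V) u.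
HB.instance Definition _ := GRing.isZmodMorphism.Build {freeg J} V ratf
  (lincomb_is_additive _).

Lemma coeff_ratf j u : coeff j (ratf u) = (coeff j u)%:~R.
Proof.
rewrite /ratf lincombE raddf_sum /=.
under eq_bigr => k _ do rewrite raddfMz /= coeffU mul1r.
have [ju|ju] := boolP (j \in dom u); last first.
  rewrite (coeff_outdom ju) big_seq big1 // => k ku.
  have [kj|_] := eqVneq k j; last by rewrite mul0rz.
  by rewrite kj (negbTE ju) in ku.
rewrite (bigD1_seq j) ?uniq_dom //= eqxx big1 ?addr0 // => k /negbTE ->.
by rewrite mul0rz.
Qed.

(** Only a multiple of [h] is a combination of the basis, and [v] determines [h]
    up to torsion. *)
Definition coords (h : H) (v : V) : Prop := exists N (u : {freeg J}),
  [/\ (0 < N)%N, ratf u = N%:R *: v & h *+ N = lincomb x u].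

Lemma coords_lincomb u : coords (lincomb x u) (ratf u).
Proof. by exists 1%N, u; split=> //; rewrite scale1r. Qed.

Lemma coords_ex h : exists v, coords h v.
Proof.
have [n n0 [u uE]] := x_tors h; exists (n%:R^-1 *: ratf u), n, u; split=> //.
by rewrite scalerA divff ?scale1r // pnatr_eq0 -lt0n.
Qed.

Lemma coordsB h k v w : coords h v -> coords k w -> coords (h - k) (v - w).
Proof.
move=> [N [u [N0 uE hE]]] [M [t [M0 tE kE]]].
exists (N * M)%N, (u *+ M - t *+ N); split; first by rewrite muln_gt0 N0.
  rewrite raddfB !raddfMn /= uE tE -!scaler_nat scalerN !scalerA -!natrM scalerBr.
  by rewrite [(M * N)%N]mulnC.
rewrite raddfB !raddfMn /= -hE -kE mulrnBl ?mulNrn -!mulrnA.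
by rewrite [(M * N)%N]mulnC.
Qed.

Lemma coords0 : coords 0 0.
Proof. by exists 1%N, 0; split; rewrite ?raddf0 ?mul0rn ?scaler0. Qed.

Lemma coordsN h v : coords h v -> coords (- h) (- v).
Proof. by move=> hv; rewrite -(sub0r h) -(sub0r v); apply: coordsB => //; apply: coords0. Qed.

Lemma coordsD h k v w : coords h v -> coords k w -> coords (h + k) (v + w).
Proof.
by move=> hv kw; rewrite -[k]opprK -[w]opprK; apply: coordsB => //; apply: coordsN.
Qed.

Lemma coords_sum (T : Type) (s : seq T) F f :
  (forall t, coords (F t) (f t)) -> coords (\sum_(t <- s) F t) (\sum_(t <- s) f t).
Proof.
move=> Ff; elim: s => [|t s IH]; first by rewrite !big_nil; apply: coords0.
by rewrite !big_cons; apply: coordsD.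
Qed.

Lemma coordsMn h v n : coords h v -> coords (h *+ n) (n%:R *: v).
Proof.
move=> [N [u [N0 uE hE]]]; exists N, (u *+ n); split=> //.
  by rewrite raddfMn /= uE -scaler_nat !scalerA mulrC.
by rewrite raddfMn /= -hE mulrnAC.
Qed.

Lemma coordsMz h v n : coords h v -> coords (h *~ n) (n%:~R *: v).
Proof.
case: n => n hv; first exact: coordsMn.
by rewrite NegzE !mulrNz scaleNr; apply/coordsN/coordsMn.
Qed.

Lemma coords_div h v n : (0 < n)%N -> coords (h *+ n) (n%:R *: v) -> coords h v.
Proof.
move=> n0 [N [u [N0 uE hE]]]; exists (n * N)%N, u; split; first by rewrite muln_gt0 n0.
  by rewrite uE scalerA natrM mulrC.
by rewrite mulrnA.
Qed.

Lemma coords_tors h : coords h 0 -> exists2 n, (0 < n)%N & h *+ n = 0.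
Proof.
move=> [N [u [N0 uE hE]]]; exists N => //; rewrite hE; suff -> : u = 0 by rewrite raddf0.
apply: int_freeg_ext => j; apply: (@intr_inj rat); rewrite -coeff_ratf uE.
by rewrite scaler0 !coeff0.
Qed.

Lemma coords_zero v : coords 0 v -> v = 0.
Proof.
move=> [N [u [N0 uE]]]; rewrite mul0rn => /esym /lincomb_x_free u0.
apply/eqP; move/eqP: uE; rewrite u0 raddf0 eq_sym scaler_eq0 pnatr_eq0.
by rewrite eqn0Ngt N0.
Qed.

Lemma coords_unique h v w : coords h v -> coords h w -> v = w.
Proof.
move=> hv hw; apply/eqP; rewrite -subr_eq0; apply/eqP/coords_zero.
by rewrite -(subrr h); apply: coordsB.
Qed.

(** The induced map is admissible because a homomorphism does not lower
    heights, and neither does the passage to one term of a combination. *)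
Lemma coords_map (f : {additive H -> H}) : exists e : {linear V -> V},
  (forall h v, coords h v -> coords (f h) (e v)) /\ admissible line_hom e.
Proof.
have /choice[w wP] j : exists v, coords (f (x j)) v := coords_ex _.
have e_lincomb u : coords (f (lincomb x u)) (linext w (ratf u)).
  rewrite /ratf !lincombE !raddf_sum /=; apply: coords_sum => j.
  rewrite raddfMz /= raddfMz /= linextU -scaler_int; exact: coordsMz.
exists (linext w); split.
  move=> h v [N [u [N0 uE hE]]]; apply: (coords_div N0).
  by rewrite -raddfMn hE -linearZ -uE; apply: e_lincomb.
move=> k v mv i; rewrite (coeff_linear (linext w)).
apply: (line_sum_seq line_hom_category) => j _.
apply: (line_comp line_hom_category (mv j)); rewrite /= linextU.
have [N [u [N0 uE fE]]] := wP j; exists N%:Z, (coeff i u); split.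
- by rewrite eqz_nat -lt0n.
- by rewrite -coeff_ratf uE coeffZ.
- move=> m p al p_pr dN.
  rewrite mulrzA mulrz_swap -pr_lincomb -fE -raddfMz; apply: edivides_map.
  rewrite -raddfMn -raddfMz; apply: edivides_map.
  by rewrite pmulrn mulrz_swap -mulrzA.
Qed.

(** * Decomposition bases of retracts *)

Lemma line_hom_nat k i c : line_hom k i c -> exists (N : nat) (z : int),
  [/\ (0 < N)%N, N%:R * c = z%:~R & hom_rep k i N z].
Proof.
move=> [N [z [N0 cE hz]]]; exists `|N|%N, (z * sgz N); split.
- by rewrite absz_gt0.
- by rewrite pmulrn abszEsg !intrM -cE; ring.
- by rewrite abszEsg mulrC; apply: hom_rep_scale.
Qed.

Lemma common_multiplier (T : eqType) (s : seq T) k (tau : T -> J) (c : T -> rat) :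
  (forall t, t \in s -> line_hom k (tau t) (c t)) ->
  exists (N : nat) (z : T -> int), (0 < N)%N /\ forall t, t \in s ->
    N%:R * c t = (z t)%:~R /\ hom_rep k (tau t) N (z t).
Proof.
elim: s => [|t s IH] sc; first by exists 1%N, (fun=> 0).
have [|N [z [N0 zP]]] := IH; first by move=> u us; apply: sc; rewrite in_cons us orbT.
have [M [w [M0 wE hw]]] := line_hom_nat (sc t (mem_head _ _)).
exists (N * M)%N, (fun u => if u == t then w * N%:Z else z u * M%:Z).
split=> [|u]; first by rewrite muln_gt0 N0.
rewrite in_cons; case: eqVneq => [->|ut] /= => [_|us].
  split; first by rewrite natrM intrM -wE; ring.
  by rewrite PoszM mulrC; apply: hom_rep_scale.
have [zE hz] := zP u us; split; first by rewrite natrM intrM -zE; ring.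
by rewrite PoszM; apply: hom_rep_scale.
Qed.

Lemma coeff_sumU (R : nzRingType) (L : choiceType) (s : seq L) (F : L -> R) i : uniq s ->
  coeff i (\sum_(j <- s) << F j *g j >> : {freeg L / R}) = if i \in s then F i else 0.
Proof.
move=> us; rewrite raddf_sum /=; case: ifP => si; last first.
  rewrite big_seq big1 // => j js; rewrite coeffU.
  by have [ji|_] := eqVneq j i; [rewrite -ji js in si|rewrite mulr0].
rewrite (bigD1_seq i) //= coeffU eqxx mulr1 big1 ?addr0 // => j /negbTE ji.
by rewrite coeffU ji mulr0.
Qed.

Lemma big_extend (T : eqType) (W : zmodType) (r s : seq T) (F : T -> W) :
  uniq r -> uniq s -> {subset r <= s} -> (forall t, t \notin r -> F t = 0) ->
  \sum_(t <- r) F t = \sum_(t <- s) F t.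
Proof.
move=> ur us rs F0; rewrite [RHS](bigID (mem r)) /= [X in _ + X]big1 // addr0.
rewrite -[RHS]big_filter; apply: perm_big; apply: uniq_perm; rewrite ?filter_uniq // => t.
by rewrite mem_filter andb_idr // => /rs.
Qed.

Lemma sub_seq_lift (T : choiceType) (P : set T) (s : seq T) : (forall t, t \in s -> P t) ->
  exists s' : seq {t : T | `[< P t >]}, map val s' = s.
Proof.
elim: s => [|t s IH] sP; first by exists [::].
have [|s' <-] := IH; first by move=> u us; apply: sP; rewrite in_cons us orbT.
by exists (exist _ t (asboolT (sP t (mem_head _ _))) :: s').
Qed.

(** Morphisms of lines compare heights only after multiplication by an integer
    that depends on the morphism.  The finitely many morphisms from one line to
    the members of the frame have a common multiplier [Nf]; the multiple [Mf]
    of a member of the frame is chosen such that its coordinates are divisible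
    by these multipliers.  Then heights are compared exactly, from the
    combination to its coordinates over [x], from these to the lines of the
    frame, and back to the terms. *)
Theorem retract_decomposition_basis : exists (K : choiceType) (g : K -> G),
  decomposition_basis g.
Proof.
have [e [eP adm_e]] := coords_map (iota \o pi).
have idem_e v : e (e v) = e v.
  rewrite [LHS](linear_expand (e \o e)) [RHS](linear_expand e).
  apply: eq_bigr => j _; congr (_ *: _) => /=.
  have hj : coords (x j) << j >>.
    by have := coords_lincomb << j >>; rewrite /ratf !lincombU !mulr1z.
  have := eP _ _ (eP _ _ hj); rewrite /= iotaK => /coords_unique; apply.
  exact: eP.
have [Y frY] := projector_frame line_hom_category (conj adm_e idem_e).
pose K := {t : V * J | `[< Y t >]} : choiceType.
pose y (t : K) := (val t).1; pose tau (t : K) := (val t).2.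
have KY (t : K) : Y (val t) by apply/asboolP/(valP t).
have ey t : e (y t) = y t.
  by have [[v _ vE] _] := frame_sub frY (KY t); rewrite /y -vE idem_e.
have map_val_uniq (s : seq K) : uniq s -> uniq (map val s).
  by move=> us; rewrite map_inj_uniq //; apply: val_inj.
have frame_eq (r s : seq K) (a c : K -> rat) : uniq r -> uniq s ->
    (forall t, t \notin r -> a t = 0) -> (forall t, t \notin s -> c t = 0) ->
    \sum_(t <- r) a t *: y t = \sum_(t <- s) c t *: y t -> a =1 c.
  move=> ur us a0 c0 ac t; pose S := undup (r ++ s).
  have [tS|] := boolP (t \in S); last first.
    by rewrite mem_undup mem_cat negb_or => /andP[/a0-> /c0->].
  rewrite (@big_extend _ _ r S) ?undup_uniq // in ac; last 2 first.
  - by move=> u ur'; rewrite mem_undup mem_cat ur'.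
  - by move=> u /a0 ->; rewrite scale0r.
  rewrite (@big_extend _ _ s S) ?undup_uniq // in ac; last 2 first.
  - by move=> u us'; rewrite mem_undup mem_cat us' orbT.
  - by move=> u /c0 ->; rewrite scale0r.
  have [d dE] := inj_transport (R := rat) (s := S) (fun t => a t - c t)
    (in2W (@val_inj _ _ K)).
  apply/eqP; rewrite -subr_eq0 -(dE t tS); apply/eqP.
  apply: (frame_free frY (s := map val S)) => //.
  - by apply: map_val_uniq; apply: undup_uniq.
  - by move=> _ /mapP[u _ ->].
  - rewrite big_map (eq_big_seq (fun u => a u *: y u - c u *: y u)).
      by rewrite sumrB ac subrr.
    by move=> u uS; rewrite dE // scalerBl.
  - exact: map_f.
have /choice[NR NRP] i : exists NR : nat * (seq K * (K -> int)),
    [/\ (0 < NR.1)%N, uniq NR.2.1, forall t, t \notin NR.2.1 -> NR.2.2 t = 0,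
      NR.1%:R *: e << i >> = \sum_(t <- NR.2.1) (NR.2.2 t)%:~R *: y t &
      forall t, hom_rep i (tau t) NR.1 (NR.2.2 t)].
  have mi : mor line_hom i (e << i >>) by apply/adm_e/(morU line_hom_category).
  have [s [c [us sY eiE]]] := frame_span frY (ex_intro2 _ _ << i >> I erefl).
  have sA := @frame_mor _ _ _ _ frY s c i us sY; rewrite -eiE in sA.
  have [N [z [N0 zP]]] := common_multiplier (sA mi).
  have [r rE] := sub_seq_lift sY.
  exists (N, (r, fun t => if t \in r then z (val t) else 0)); split=> //=.
  - by move: us; rewrite -rE map_inj_uniq //; apply: val_inj.
  - by move=> t /negbTE ->.
  - rewrite eiE -rE big_map scaler_sumr; apply: eq_big_seq => t tr.
    by rewrite tr -(zP (val t) _).1 ?scalerA // -rE map_f.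
  - move=> t; case: ifP => tr; last exact: hom_rep0.
    by apply: (zP (val t) _).2; rewrite -rE map_f.
pose Nf i := (NR i).1; pose Rf i := (NR i).2.1; pose zf i := (NR i).2.2.
have /choice[Mu MuP] t : exists Mu : nat * {freeg J},
    [/\ (0 < Mu.1)%N, ratf Mu.2 = Mu.1%:R *: y t,
      forall i, hom_rep (tau t) i Mu.1 (coeff i Mu.2),
      forall i, ((Nf i)%:Z %| coeff i Mu.2)%Z &
      iota (pi (lincomb x Mu.2)) = lincomb x Mu.2].
  have [_ mt] := frame_sub frY (KY t); rewrite -/(y t) -/(tau t) in mt.
  have [M [z [M0 zP]]] := common_multiplier (s := dom (y t)) (tau := id) (fun i _ => mt i).
  pose N := (\prod_(i <- dom (y t)) Nf i)%N.
  have N0 : (0 < N)%N by rewrite prodn_gt0 // => i; have [] := NRP i.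
  pose u : {freeg J} := \sum_(i <- dom (y t)) << z i * N%:Z *g i >>.
  have uE i : coeff i u = if i \in dom (y t) then z i * N%:Z else 0.
    by apply: coeff_sumU; apply: uniq_dom.
  have ruE : ratf u = (M * N)%N%:R *: y t.
    apply: freeg_coeff_ext => i; rewrite coeff_ratf uE coeffZ.
    case: ifP => [iy|/negbT iy]; last by rewrite (coeff_outdom iy) mulr0.
    by rewrite intrM -(zP i iy).1 natrM; ring.
  (* the coordinates are fixed by e; a multiple kills the torsion in between *)
  have [L L0 uL] : exists2 L, (0 < L)%N &
      (iota (pi (lincomb x u)) - lincomb x u) *+ L = 0.
    apply: coords_tors; have := coords_lincomb u; rewrite ruE => cu.
    have := coordsB (eP _ _ cu) cu; rewrite linearZ /= ey subrr; exact.
  exists (M * N * L, u *+ L)%N; split=> /=.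
  - by rewrite !muln_gt0 M0 N0.
  - by rewrite raddfMn /= ruE -scaler_nat scalerA mulrC -natrM.
  - move=> i; rewrite coeffMn -mulr_natr natz PoszM; apply: hom_rep_scale.
    rewrite uE PoszM; case: ifP => iy; last exact: hom_rep0.
    by apply: hom_rep_scale; apply: (zP i iy).2.
  - move=> i; rewrite coeffMn uE; case: ifP => iy; last by rewrite mul0rn dvdz0.
    rewrite -mulr_natr natz dvdz_mulr // dvdz_mull //.
    by rewrite /N (bigD1_seq i) ?uniq_dom //= PoszM dvdz_mulr.
  - apply/eqP; rewrite -subr_eq0 !raddfMn /= -mulrnDl; exact/eqP.
pose Mf t := (Mu t).1; pose uf t := (Mu t).2.
pose g t := pi (lincomb x (uf t)).
have gE t : iota (g t) = lincomb x (uf t) by have [] := MuP t.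
pose U (w : {freeg K}) : {freeg J} := \sum_(t <- dom w) uf t *~ coeff t w.
have iotaE w : iota (lincomb g w) = lincomb x (U w).
  rewrite lincombE !raddf_sum; apply: eq_bigr => t _.
  by rewrite /= !raddfMz /= gE.
have ratUE w : ratf (U w) = \sum_(t <- dom w) (coeff t w * (Mf t)%:Z)%:~R *: y t.
  rewrite raddf_sum; apply: eq_bigr => t _.
  have [_ uE _ _ _] := MuP t; rewrite /= raddfMz /= uE.
  by rewrite -scaler_int scalerA intrM.
have Mf0 t : (Mf t)%:Z != 0 by have [M0 _ _ _ _] := MuP t; rewrite eqz_nat -lt0n.
exists K, g; split.
- move=> g0; have [v gv] := coords_ex (iota g0).
  have ev : e v = v.
    by have := eP _ _ gv; rewrite /= iotaK => /coords_unique; apply.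
  have [s [c [us sY vE]]] := frame_span frY (ex_intro2 _ _ v I ev).
  have [r rE] := sub_seq_lift sY.
  pose q t := c (val t) / (Mf t)%:R.
  (* D clears the denominators of the coordinates of v over the multiples Mf t *)
  pose D := (\prod_(t <- r) `|denq (q t)|)%N.
  have D0 : (0 < D)%N by rewrite prodn_gt0 // => t; rewrite absz_gt0 denq_neq0.
  pose w : {freeg K} := \sum_(t <- r) << numq (D%:R * q t) *g t >>.
  have ur : uniq r by move: us; rewrite -rE map_inj_uniq //; apply: val_inj.
  have wE : \sum_(t <- r) (numq (D%:R * q t) * (Mf t)%:Z)%:~R *: y t = D%:R *: v.
    rewrite vE -rE big_map scaler_sumr; apply: eq_big_seq => t tr.
    rewrite scalerA; congr (_ *: _); rewrite intrM numq_clear.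
      by rewrite -mulrA /q divfK // -[_%:R]/((Mf t)%:~R) intr_eq0.
    by rewrite /D (bigD1_seq t) //= dvdn_mulr.
  have [L L0 gL] : exists2 L, (0 < L)%N & iota (g0 *+ D - lincomb g w) *+ L = 0.
    apply: coords_tors; rewrite raddfB raddfMn /=.
    rewrite -(subrr (D%:R *: v)); apply: coordsB; first exact: coordsMn.
    rewrite -wE /w raddf_sum raddf_sum; apply: coords_sum => t.
    rewrite /= lincombU raddfMz /= gE intrM -scalerA.
    apply: coordsMz; have [_ uE _ _ _] := MuP t.
    by rewrite -[_%:~R]/((Mf t)%:R) -uE; apply: coords_lincomb.
  exists (D * L)%N; first by rewrite muln_gt0 D0.
  exists (w *+ L); apply: (can_inj iotaK); apply/eqP; rewrite -subr_eq0 -raddfB.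
  by rewrite raddfMn /= mulrnA -mulrnBl raddfMn /= gL.
- move=> w w0; have U0 : ratf (U w) = 0.
    by rewrite (lincomb_x_free (u := U w)) ?raddf0 // -iotaE w0 raddf0.
  apply: int_freeg_ext => t; rewrite coeff0.
  have := frame_eq (dom w) [::] (fun t => (coeff t w * (Mf t)%:Z)%:~R) (fun=> 0)
    (uniq_dom w) isT _ _ _ t.
  rewrite big_nil -ratUE U0 => /(_ _ _ erefl) wt.
  apply/eqP; rewrite -(mulIr_eq0 _ (mulIf (Mf0 t))) -(intr_eq0 rat) wt //.
  by move=> u /coeff_outdom ->; rewrite mul0r.
- move=> p al w p_pr dw t.
  have dU i : ediv (p ^ al) (x i *~ coeff i (U w)).
    rewrite -pr_lincomb; apply: edivides_map; rewrite -iotaE.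
    by have [h ->] := dw; rewrite raddfMn; apply: edivides_of.
  pose m i := (coeff i (U w) %/ Nf i)%Z.
  have mE i : coeff i (U w) = m i * (Nf i)%:Z.
    rewrite /m divzK // /U raddf_sum; apply: rpred_sum => u _.
    have [_ _ _ dN _] := MuP u.
    by rewrite /= raddfMz /= -mulrzr intz; apply: dvdz_mulr.
  pose I' := dom (ratf (U w)).
  have coordE : coeff t w * (Mf t)%:Z = \sum_(i <- I') m i * zf i t.
    apply: (@intr_inj rat); rewrite rmorph_sum /=.
    pose S := undup (flatten [seq Rf i | i <- I']).
    have RS i u : i \in I' -> u \in Rf i -> u \in S.
      move=> iI uR; rewrite mem_undup; apply/flattenP.
      by exists (Rf i) => //; apply: map_f.
    apply: (frame_eq (dom w) S (fun t => (coeff t w * (Mf t)%:Z)%:~R)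
      (fun t => \sum_(i <- I') (m i * zf i t)%:~R)).
    + exact: uniq_dom.
    + exact: undup_uniq.
    + by move=> u /coeff_outdom ->; rewrite mul0r.
    + move=> u uS; rewrite big_seq big1 // => i iI.
      have [_ _ z0 _ _] := NRP i; rewrite /zf z0 ?mulr0 //.
      by apply: contra uS => /(RS i u iI).
    rewrite -ratUE; have <- : e (ratf (U w)) = ratf (U w).
      rewrite ratUE raddf_sum; apply: eq_bigr => u _.
      by rewrite /= linearZ /= ey.
    rewrite linear_expand.
    under [RHS]eq_bigr => u _ do rewrite scaler_suml.
    rewrite exchange_big; apply: eq_big_seq => i iI /=.
    rewrite coeff_ratf mE intrM -scalerA.
    have [_ uR z0 eE _] := NRP i; rewrite -[_%:~R *: e _]/((Nf i)%:R *: e _) eE scaler_sumr.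
    rewrite (@big_extend _ _ (Rf i) S) ?undup_uniq //; first last.
    + by move=> u uR'; rewrite /zf z0 // scale0r scaler0.
    + by move=> u; apply: RS.
    by apply: eq_bigr => u _; rewrite scalerA -intrM.
  have dtau : ediv (p ^ al) (x (tau t) *~ (coeff t w * (Mf t)%:Z)).
    rewrite coordE mulrz_sumr; apply/epredP; apply: rpred_sum => i _; apply/epredP.
    have [_ _ _ _ hz] := NRP i; apply: hz => //.
    by rewrite -mE.
  have [_ _ hM _ _] := MuP t.
  apply: edivides_iota; rewrite raddfMz /= gE lincombE mulrz_suml.
  apply/epredP; apply: rpred_sum => i _; apply/epredP.
  by rewrite mulrz_swap -mulrzA; apply: hM.
Qed.

End Retract.

(** * Direct sums of groups of rank at most one *)

Section DirectSum.
Variables (I : choiceType) (A : I -> zmodType).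

Fact dsum_single_finite i (a : A i) :
  eqtype.dfwith (T := fun k => A k) (fun=> 0) a \in Defs.finite_support (A := A).
Proof.
apply/asboolP; apply: sub_finite_set (finite_set1 i) => k /=.
by have [->//|ik] := eqVneq k i; rewrite dfwith_out // eq_sym.
Qed.

Definition dsum_single i (a : A i) : dsum A := DSum (dsum_single_finite a).

Lemma dsum_single_in i (a : A i) : dsum_val (dsum_single a) i = a.
Proof. exact: dfwith_in. Qed.

Lemma dsum_single_out i k (a : A i) : i != k -> dsum_val (dsum_single a) k = 0.
Proof. exact: dfwith_out. Qed.

Lemma dsum_ext (u v : dsum A) : (forall i, dsum_val u i = dsum_val v i) -> u = v.
Proof. by move=> uv; apply: val_inj; apply: functional_extensionality_dep. Qed.

Lemma dsum_valB i (u v : dsum A) : dsum_val (u - v) i = dsum_val u i - dsum_val v i.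
Proof. by []. Qed.

Fact dsum_single_is_additive i : zmod_morphism (@dsum_single i).
Proof.
move=> a b; apply: dsum_ext => k; rewrite dsum_valB.
have [<-|ik] := eqVneq i k; first by rewrite !dsum_single_in.
by rewrite !dsum_single_out // subrr.
Qed.
HB.instance Definition _ i := GRing.isZmodMorphism.Build (A i) (dsum A)
  (@dsum_single i) (@dsum_single_is_additive i).

Definition dsum_part i (u : dsum A) : dsum A := dsum_single (dsum_val u i).

Fact dsum_part_is_additive i : zmod_morphism (dsum_part i).
Proof. by move=> u v; rewrite /dsum_part dsum_valB raddfB. Qed.
HB.instance Definition _ i := GRing.isZmodMorphism.Build (dsum A) (dsum A)
  (dsum_part i) (dsum_part_is_additive i).

Lemma dsum_part_single i k (a : A k) :
  dsum_part i (dsum_single a) = if i == k then dsum_single a else 0.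
Proof.
case: eqVneq => [->|ik]; first by rewrite /dsum_part dsum_single_in.
by rewrite /dsum_part dsum_single_out 1?eq_sym // raddf0.
Qed.

Lemma dsum_valD i (u v : dsum A) : dsum_val (u + v) i = dsum_val u i + dsum_val v i.
Proof. by []. Qed.

Lemma dsum_expand (u : dsum A) : exists s, u = \sum_(i <- s) dsum_part i u.
Proof.
have /asboolP/finite_seqP[s sE] := dsum_valP u; exists (undup s).
apply: dsum_ext => k.
have -> : dsum_val (\sum_(i <- undup s) dsum_part i u) k =
    \sum_(i <- undup s) dsum_val (dsum_part i u) k.
  by elim: (undup s) => [|i r IH]; rewrite ?big_nil // !big_cons dsum_valD IH.
have [ks|ks] := boolP (k \in undup s).
  rewrite (bigD1_seq k) ?undup_uniq // big1 => [|i ik]; last exact: dsum_single_out.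
  by rewrite [RHS]addr0; apply/esym/dsum_single_in.
rewrite big_seq big1 => [|i is_]; last first.
  by apply: dsum_single_out; apply: contraNneq ks => <-.
have [//|/eqP uk] := eqVneq (dsum_val u k) 0.
have ks' : [set` s] k by move: uk; rewrite -sE.
by rewrite mem_undup in ks; rewrite [k \in s]ks' in ks.
Qed.

Hypothesis rankA : forall i, exists2 n, (n <= 1)%N & torsion_free_rank (A i) n.

Definition has_infinite (i : I) : Prop :=
  exists a : A i, forall n, (0 < n)%N -> a *+ n <> 0.

(** Elements of infinite order of the summands of rank one form a basis of the
    direct sum up to torsion, and a homomorphism such as the projection to a
    summand does not lower heights. *)
Lemma retract_dsum_basis (G : zmodType) (iota : {additive G -> dsum A})
    (pi : {additive dsum A -> G}) :
  bounded_p_torsion G -> cancel iota pi ->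
  exists (K : choiceType) (g : K -> G), decomposition_basis g.
Proof.
move=> bG iotaK.
have /choice[bound boundP] p : exists n, prime p ->
    forall (y : G) k, y *+ (p ^ k) = 0 -> y *+ (p ^ n) = 0.
  have [p_pr|np] := pselect (prime p); last by exists 0%N.
  by have [n nP] := bG p p_pr; exists n => _ y k yk; apply: nP; exists k.
pose J := {i : I | `[< has_infinite i >]} : choiceType.
have aex (j : J) : exists a : A (val j), forall n, (0 < n)%N -> a *+ n <> 0.
  exact/asboolP/(valP j).
pose a j := sval (cid (aex j)).
have aP j n : (0 < n)%N -> a j *+ n <> 0 := svalP (cid (aex j)) n.
pose x j := dsum_single (a j).
have torsD h k : (exists2 n, (0 < n)%N & exists u, h *+ n = lincomb x u) ->
    (exists2 n, (0 < n)%N & exists u, k *+ n = lincomb x u) ->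
    exists2 n, (0 < n)%N & exists u, (h + k) *+ n = lincomb x u.
  move=> [n n0 [u uE]] [m m0 [v vE]]; exists (n * m)%N; first by rewrite muln_gt0 n0.
  exists (u *+ m + v *+ n); rewrite raddfD !raddfMn /= -uE -vE mulrnDl -!mulrnA.
  by rewrite [(m * n)%N]mulnC.
apply: (@retract_decomposition_basis _ _ iota pi iotaK bound _ J x
  (fun j => dsum_part (val j))).
- by move=> p y k p_pr; apply: boundP.
- by move=> j k; rewrite [LHS]dsum_part_single.
- move=> j n n0; rewrite -raddfMn => /(congr1 (fun v : dsum A => dsum_val v (val j))).
  by rewrite dsum_single_in; apply: aP.
move=> h; have [s ->] := dsum_expand h.
elim: s => [|i s IH].
  by rewrite big_nil; exists 1%N => //; exists 0; rewrite raddf0.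
rewrite big_cons; apply: torsD IH; rewrite /dsum_part; set b := dsum_val h i.
have [hi|nhi] := pselect (has_infinite i); last first.
  have [n n0 bn] : exists2 n, (0 < n)%N & b *+ n = 0.
    apply: contrapT => nt; apply: nhi; exists b => n n0 bn; apply: nt; by exists n.
  by exists n => //; exists 0; rewrite -raddfMn bn !raddf0.
pose j : J := exist _ i (asboolT hi).
have [r r1 rk] := rankA i.
have [m [k [mk mkE]]] := rank_le1_dependent r1 rk (a j) b.
have am0 (z : int) : a j *~ z = 0 -> z = 0.
  case: z => z; first by case: z => // z; rewrite -pmulrn => /(aP j z.+1 isT).
  by rewrite NegzE mulrNz => /eqP; rewrite oppr_eq0 => /eqP /(aP j z.+1 isT).
have k0 : k != 0.
  apply: contraTneq mk => k0; rewrite k0 eqxx orbF negbK; apply/eqP/am0.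
  by rewrite mkE k0 mulr0z.
exists `|k|%N; first by rewrite absz_gt0.
exists << m * sgz k *g j >>; rewrite lincombU -raddfMn /= /x -raddfMz /=.
congr (dsum_single _); rewrite mulrzA mkE pmulrn abszEsg mulrC mulrzA.
by [].
Qed.

End DirectSum.

(** * The equivalence *)

(** Direct sums and Warfield groups are both retracts of direct sums of groups of
    rank at most one. *)
Lemma retract_of_dsum_simply_presented (G : zmodType) : bounded_p_torsion G ->
  forall (H : zmodType) (iota : {additive G -> H}) (pi : {additive H -> G}),
  cancel iota pi -> dsum_of_rank_le1 H -> simply_presented G.
Proof.
move=> bG H iota pi iotaK [I [A [rankA [f [h fK hK]]]]].
have hB : zmod_morphism h.
  by move=> u v; apply: (can_inj fK); rewrite raddfB !hK.
pose h' : {additive dsum A -> H} := HB.pack_for {additive dsum A -> H} h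
  (GRing.isZmodMorphism.Build (dsum A) H h hB).
have fiK : cancel (f \o iota) (pi \o h') by move=> g /=; rewrite fK iotaK.
have [K [g gb]] := retract_dsum_basis rankA bG fiK.
exact: decomposition_basis_simply_presented bG gb.
Qed.

Lemma simply_presented_warfield (G : zmodType) : simply_presented G -> warfield G.
Proof.
move=> spG; pose Z : zmodType := 'rV[int]_0; exists G, Z; split=> //.
have fstB : zmod_morphism (@fst G Z) by [].
pose f : {additive (G * Z)%type -> G} := HB.pack_for {additive (G * Z)%type -> G}
  (@fst G Z) (GRing.isZmodMorphism.Build (G * Z)%type G (@fst G Z) fstB).
by exists f; exists (fun g => (g, 0)) => [[g z]|//]; rewrite /= [z]thinmx0.
Qed.

Theorem proposition2p3 (G : zmodType) (hG : bounded_p_torsion G) :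
  [<-> simply_presented G; dsum_of_rank_le1 G; warfield G].
Proof.
tfae.
- exact: simply_presented_dsum.
- move=> dG; apply: simply_presented_warfield.
  exact: (retract_of_dsum_simply_presented hG (iota := idfun) (pi := idfun)).
- move=> [H [K [/simply_presented_dsum dH [f [h fK hK]]]]].
  have iB : zmod_morphism (fun g : G => f (g, 0)).
    move=> u v; rewrite -raddfB; congr (f _).
    by rewrite -[RHS]/(u - v, 0 - 0) subrr.
  have pB : zmod_morphism (fun u : H => (h u).1).
    have hB u v : h (u - v) = h u - h v by apply: (can_inj fK); rewrite raddfB !hK.
    by move=> u v; rewrite hB.
  pose iota : {additive G -> H} := HB.pack_for {additive G -> H}
    (fun g : G => f (g, 0)) (GRing.isZmodMorphism.Build G H _ iB).
  pose pi : {additive H -> G} := HB.pack_for {additive H -> G}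
    (fun u : H => (h u).1) (GRing.isZmodMorphism.Build H G _ pB).
  apply: (retract_of_dsum_simply_presented hG (iota := iota) (pi := pi) _ dH).
  by move=> g /=; rewrite fK.
Qed.
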